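(* Let $z_0=z_1+z_2-z_1z_2$ and $\delta=\dfrac{(z_1+z_2-z_1z_2)^2}{z_1z_2(1-z_1)(1-z_2)}$. The following identity holds in the ring $\mathbb Q(z_1,z_2)[x,y][[\hbar^{1/2}]]$: $$\psi_\hbar(x,z_1)\,\psi_\hbar(y,z_2)=e^{-\frac\hbar{24}}\Big\langle \psi_\hbar\Big(-w-y+\frac{xz_2+yz_1}{z_0},\frac{z_1}{z_0}\Big)\,\psi_\hbar\Big(w+x+y-\frac{xz_2+yz_1}{z_0},z_0\Big)\,\psi_\hbar\Big(-w-x+\frac{xz_2+yz_1}{z_0},\frac{z_2}{z_0}\Big)\Big\rangle_{w,\delta}.$$
   Context: $\mathrm{Li}_0(z)=z/(1-z)$ and $\mathrm{Li}_{m-1}(z)=z\frac{d}{dz}\mathrm{Li}_m(z)$, so $\mathrm{Li}_m\in\mathbb Q(z)$ for $m\le 0$. $B_k$ are the Bernoulli numbers with $B_1=-\frac12$. Define $$\psi_\hbar(x,z)=\exp\Big(-\sum_{k,\ell\ge 0,\;k+\ell/2>1}\frac{B_k x^\ell\hbar^{k+\ell/2-1}}{\ell!\,k!}\mathrm{Li}_{2-k-\ell}(z)\Big)\in 1+\hbar^{1/2}\mathbb Q[z,(1-z)^{-1}][x][[\hbar^{1/2}]].$$ Formal Gaussian integration in one variable $w$ with respect to a nonzero $\lambda\in\mathbb Q(z_1,z_2)$: for a power series $f_\hbar(w)$ in $\hbar^{1/2}$ whose coefficients are polynomials in $w$ (with coefficients in $\mathbb Q(z_1,z_2)[x,y]$),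 $\langle f_\hbar(w)\rangle_{w,\lambda}=\exp\big(\frac1{2\lambda}\partial_w^2\big)f_\hbar(w)\big|_{w=0}$, applied coefficientwise; thus $\langle w^n\rangle_{w,\lambda}=\lambda^{-n/2}(n-1)!!$ for even $n$ and $0$ for odd $n$. (One has $\delta=2+\mathrm{Li}_0(z_1z_0^{-1})+\mathrm{Li}_0(z_0)+\mathrm{Li}_0(z_2z_0^{-1})$.) *)

(* Defs.v *)
From HB Require Import structures.
From mathcomp Require Import all_boot all_order all_algebra.
From mathcomp Require Import mpoly generic_quotient ring.

Set Implicit Arguments.
Unset Strict Implicit.
Unset Printing Implicit Defensive.

Import GRing.Theory.
Local Open Scope ring_scope.

Notation "x %:F" := (@FracField.tofrac _ x) : ring_scope.

(* Bernoulli numbers with B_1 = -1/2: bernoulli_seq n = [:: B_0; ...; B_(n-1)]. *)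
Fixpoint bernoulli_seq (n : nat) : seq rat :=
  if n is m.+1 then
    let s := bernoulli_seq m in
    rcons s (((m == 0)%N%:R - \sum_(j < m) 'C(m.+1, j)%:R * s`_j) / m.+1%:R)
  else [::].

Definition bernoulli (n : nat) : rat := (bernoulli_seq n.+1)`_n.

Lemma size_bernoulli_seq n : size (bernoulli_seq n) = n.
Proof. by elim: n => //= n IHn; rewrite size_rcons IHn. Qed.

Lemma nth_bernoulli_seq n j : (j < n)%N -> (bernoulli_seq n)`_j = bernoulli j.
Proof.
elim: n => // n IHn; rewrite ltnS leq_eqVlt => /predU1P[-> // | lt_jn].
by rewrite /= nth_rcons size_bernoulli_seq lt_jn IHn.
Qed.

Lemma bernoulli_sum n :
  \sum_(j < n.+1) 'C(n.+1, j)%:R * bernoulli j = (n == 0)%N%:R.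
Proof.
rewrite big_ord_recr /= binSn {2}/bernoulli /= nth_rcons size_bernoulli_seq.
rewrite ltnn eqxx [X in _ + X]mulrC divfK ?Num.Theory.pnatr_eq0 //.
rewrite (eq_bigr (fun j : 'I_n => 'C(n.+1, j)%:R * (bernoulli_seq n)`_j)).
  by rewrite addrC subrK.
by move=> j _; rewrite nth_bernoulli_seq.
Qed.

(* Q(z) is {fraction {poly rat}}. *)
Definition ratfun_deriv (f : {fraction {poly rat}}) : {fraction {poly rat}} :=
  let n := \n_(repr f) in
  let d := \d_(repr f) in
  (n^`() * d - n * d^`())%:F / (d ^+ 2)%:F.

Lemma ratfun_numden (f : {fraction {poly rat}}) :
  f = (\n_(repr f))%:F / (\d_(repr f))%:F.
Proof.
rewrite -{1}[f]reprK; case: (repr f) => -[n d] /= d0.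
have dF0 : d%:F != 0 by rewrite tofrac_eq0.
apply: (mulIf dF0); rewrite divfK //; unlock FracField.tofrac.
rewrite -[LHS]FracField.pi_mul; apply/eqmodP; rewrite /= FracField.equivfE.
by rewrite /FracField.mulf !numden_Ratio ?mulr1 ?oner_neq0 // mulrC.
Qed.

Lemma ratfun_derivE (n d : {poly rat}) : d != 0 ->
  ratfun_deriv (n%:F / d%:F) = (n^`() * d - n * d^`())%:F / (d ^+ 2)%:F.
Proof.
move=> d0; rewrite /ratfun_deriv.
set f := n%:F / d%:F; set N := \n_ _; set D := \d_ _.
have D0 : D != 0 by exact: denom_ratioP.
have eq_nD : n * D = N * d.
  have := ratfun_numden f; rewrite -/N -/D /f => /eqP.
  by rewrite eqr_div ?tofrac_eq0 // -!tofracM tofrac_eq => /eqP.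
have := congr1 (fun p : {poly rat} => p^`()) eq_nD; rewrite !derivM => eq_nD'.
apply/eqP; rewrite eqr_div ?tofrac_eq0 ?expf_neq0 //.
rewrite -!tofracM tofrac_eq -subr_eq0; apply/eqP.
transitivity ((N^`() * d + N * d^`() - (n^`() * D + n * D^`())) * (D * d)
              + (n * D - N * d) * (d^`() * D + d * D^`())); first by ring.
by rewrite eq_nD' eq_nD !subrr !mul0r addr0.
Qed.

(* The value at a of a rational function, read off its reduced fraction, so that
   it is the right one at every a that is not a pole. *)
Definition ratfun_eval (A : comUnitRingType) (a : A)
    (f : {fraction {poly rat}}) : A :=
  let n := \n_(repr f) in
  let d := \d_(repr f) in
  let g := gcdp n d in
  (map_poly ratr (n %/ g)).[a] / (map_poly ratr (d %/ g)).[a].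

(* polylog_neg m is Li_(-m). *)
Fixpoint polylog_neg (m : nat) : {fraction {poly rat}} :=
  if m is m'.+1 then 'X%:F * ratfun_deriv (polylog_neg m')
  else 'X%:F / (1 - 'X)%:F.

(* fps A stands for A[[hbar^(1/2)]]: f n is the coefficient of hbar^(n/2). *)
Definition fps (A : Type) := nat -> A.

Definition fps_mul (A : comUnitRingType) (f g : fps A) : fps A :=
  fun n => \sum_(i < n.+1) f i * g (n - i)%N.

Definition fps_one (A : comUnitRingType) : fps A := fun n => (n == 0)%N%:R.

Definition fps_exprn (A : comUnitRingType) (f : fps A) (j : nat) : fps A :=
  iter j (fps_mul f) (fps_one A).

(* Meant for f 0 = 0; then f ^ j has no term below hbar^(j/2), so the truncation
   at j = n loses nothing. *)
Definition fps_exp (A : comUnitRingType) (f : fps A) : fps A :=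
  fun n => \sum_(j < n.+1) (j`!%:R)^-1 * fps_exprn f j n.

(* The exponent of psi. The coefficient of hbar^(n/2) collects the (k, l) with
   k + l/2 - 1 = n/2, that is 2k + l = n + 2; the condition k + l/2 > 1 is n > 0,
   and it forces k + l >= 2, so that Li_(2-k-l) = polylog_neg (k + l - 2).
   Meaningful when A contains Q. *)
Definition log_psi (A : comUnitRingType) (x z : A) : fps A :=
  fun n => if n is 0 then 0 else
    - \sum_(k < n.+3) \sum_(l < n.+3 | (2 * k + l == n + 2)%N)
        ratr (bernoulli k / (l`!%:R * k`!%:R)) * x ^+ l
          * ratfun_eval z (polylog_neg (k + l - 2)).

Definition psi (A : comUnitRingType) (x z : A) : fps A := fps_exp (log_psi x z).

(* exp (1/(2 lambda) d_w^2) p at w = 0; the derivatives vanish beyond size p. *)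
Definition gauss_poly (K : fieldType) (B : lalgType K) (lambda : K)
    (p : {poly B}) : B :=
  \sum_(j < size p) ((2 * lambda) ^- j / j`!%:R) *: (p^`(2 * j)).[0].

Definition gauss (K : fieldType) (B : lalgType K) (lambda : K)
    (f : fps {poly B}) : fps B :=
  fun n => gauss_poly lambda (f n).

(* Main.v *)
(** Put eps = hbar^(1/2) and L = Li_0(z) = z/(1-z), so that Li_(-m)(z) is a polynomial
    in L. The Bernoulli recurrence gives
      psi(x+eps, z) = psi(x, z) (1 + L - L e^(x eps)) e^(L (x + eps/2) eps),
    and translating the Gaussian variable w shows that the bracket satisfies the same
    difference equations in x and in y as psi(x, z1) psi(y, z2). Since the coefficients
    are polynomials in x and y, the quotient Q of the two sides does not depend on x, y.
    Next, every derivation of the coefficient field kills Q: along the vector field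
    eps D - al1 d/dx - al2 d/dy at x = y = 0 each psi is multiplied by a quadratic
    polynomial in w, and integration by parts evaluates the sum. Finally let
    Li_0(z1) = t (1 + a) - 1 and Li_0(z2) = t (1 + b) - 1: at t = 0, that is
    z1 = z2 = infinity, the three psi degenerate to a single exponential and the Gaussian
    integral is explicit, Q is constant in K[[t]], and it specializes at t = 1. *)
Require Import Defs.
From HB Require Import structures.
From mathcomp Require Import all_boot all_order all_algebra.
From mathcomp Require Import mpoly boolp ring zify.

Set Implicit Arguments.
Unset Strict Implicit.
Unset Printing Implicit Defensive.

Import GRing.Theory.
Local Open Scope ring_scope.

(** * Power series over commutative Q-algebras *)

(** The variables x and y, the flow parameter, the path parameter t and the evaluation at t = 1 are
    all handled by changing the coefficient ring. The argument therefore runs over arbitrary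
    commutative Q-algebras, the inverses it uses are carried as data, and psi, the integral and Q
    are transported along ring morphisms given on coefficients. The difference equations only see x
    and y, so they leave an unknown factor in z1, z2. The second equation exists because z d/dz
    turns Li_(2-k-l) into Li_(1-k-l), the polylogarithm that d/dx leaves beside x^l: in log psi, eps
    z d/dz and d/dx cancel up to the terms removed by the condition k + l/2 > 1, whence a quadratic
    polynomial. Infinity is a good base point because Li_(-m), m >= 1, is divisible by L + L^2 and
    vanishes at L = 0 and L = -1, the values met there. The constant is 1/12 + 1/8 - 2/12 = 1/24:
    from psi at z0, from completing the square, and from the two psi on the left. A series in t has
    no value at t = 1; what is evaluated is a fraction of polynomials in t, and a fraction with
    constant expansion is constant. *)

HB.instance Definition _ (A : Type) := gen_eqMixin (fps A).
HB.instance Definition _ (A : Type) := gen_choiceMixin (fps A).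

Lemma fpsP (A : Type) (f g : fps A) : f =1 g -> f = g.
Proof. exact: functional_extensionality_dep. Qed.

Section SeriesZmodule.
Variable A : zmodType.
Implicit Types f g h : fps A.

Let add f g : fps A := fun n => f n + g n.
Let opp f : fps A := fun n => - f n.
Let zero : fps A := fun _ => 0.

Fact fps_addA : associative add.
Proof. by move=> f g h; apply: fpsP => n; apply: addrA. Qed.
Fact fps_addC : commutative add.
Proof. by move=> f g; apply: fpsP => n; apply: addrC. Qed.
Fact fps_add0 : left_id zero add.
Proof. by move=> f; apply: fpsP => n; apply: add0r. Qed.
Fact fps_addN : left_inverse zero opp add.
Proof. by move=> f; apply: fpsP => n; apply: addNr. Qed.

HB.instance Definition _ :=
  GRing.isZmodule.Build (fps A) fps_addA fps_addC fps_add0 fps_addN.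

Lemma coef_fpsD f g n : (f + g) n = f n + g n. Proof. by []. Qed.
Lemma coef_fpsN f n : (- f) n = - f n. Proof. by []. Qed.
Lemma coef_fpsB f g n : (f - g) n = f n - g n. Proof. by []. Qed.
Lemma coef_fps_sum I (r : seq I) (P : pred I) (F : I -> fps A) n :
  (\sum_(i <- r | P i) F i) n = \sum_(i <- r | P i) F i n.
Proof. by elim/big_rec2: _ => // i x y _ <-. Qed.
End SeriesZmodule.

Section SeriesRing.
Variable A : comNzRingType.
Implicit Types f g h : fps A.

Definition fps_trunc N f : {poly A} := \poly_(i < N) f i.

Let mul f g : fps A := fun n => \sum_(i < n.+1) f i * g (n - i)%N.
Let one : fps A := fun n => (n == 0)%N%:R.

Let coef_trunc N f i : (i < N)%N -> (fps_trunc N f)`_i = f i.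
Proof. by move=> lt_iN; rewrite coef_poly lt_iN. Qed.

(** A coefficient of a product depends only on truncations of the factors, so the ring laws are
    inherited from [{poly A}]. *)
Let mulE N f g n : (n < N)%N -> mul f g n = (fps_trunc N f * fps_trunc N g)`_n.
Proof.
move=> lt_nN; rewrite coefM; apply: eq_bigr => i _.
rewrite !coef_trunc //; first exact: leq_ltn_trans (leq_subr _ _) lt_nN.
by apply: leq_ltn_trans lt_nN; rewrite -ltnS.
Qed.

Let mul_poly (p : {poly A}) f g N n : (n < N)%N -> (forall i, (i < N)%N -> f i = p`_i) ->
  mul f g n = (p * fps_trunc N g)`_n.
Proof.
move=> lt_nN eq_fp; rewrite coefM; apply: eq_bigr => i _.
rewrite coef_trunc ?eq_fp //; last exact: leq_ltn_trans (leq_subr _ _) lt_nN.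
by apply: leq_ltn_trans lt_nN; rewrite -ltnS.
Qed.

Fact fps_mulC : commutative mul.
Proof. by move=> f g; apply: fpsP => n; rewrite !(@mulE n.+1) // mulrC. Qed.

Fact fps_mulA : associative mul.
Proof.
move=> f g h; apply: fpsP => n; rewrite [mul f _]fps_mulC.
rewrite (@mul_poly (fps_trunc n.+1 g * fps_trunc n.+1 h) _ _ n.+1) //; last first.
  by move=> i lt_in; rewrite (@mulE n.+1).
rewrite (@mul_poly (fps_trunc n.+1 f * fps_trunc n.+1 g) _ _ n.+1) //; last first.
  by move=> i lt_in; rewrite (@mulE n.+1).
by congr ((polyseq _)`_n); ring.
Qed.

Fact fps_mul1 : left_id one mul.
Proof.
move=> f; apply: fpsP => n; rewrite /mul big_ord_recl /= subn0 mul1r big1 ?addr0 //.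
by move=> i _; rewrite mul0r.
Qed.

Fact fps_mulDl : left_distributive mul +%R.
Proof.
move=> f g h; apply: fpsP => n; rewrite coef_fpsD -big_split /=.
by apply: eq_bigr => i _; rewrite mulrDl.
Qed.

Fact fps_one_neq0 : one != 0.
Proof.
by apply/eqP => /(congr1 (fun f => f 0%N)) /eqP; rewrite /one /= oner_eq0.
Qed.

HB.instance Definition _ := GRing.Zmodule_isComNzRing.Build (fps A)
  fps_mulA fps_mulC fps_mul1 fps_mulDl fps_one_neq0.

Lemma coef_fps1 n : (1 : fps A) n = (n == 0)%N%:R. Proof. by []. Qed.
Lemma coef_fpsM f g n : (f * g) n = \sum_(i < n.+1) f i * g (n - i)%N.
Proof. by []. Qed.
Lemma coef_fpsM0 f g : (f * g) 0%N = f 0%N * g 0%N.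
Proof. by rewrite coef_fpsM big_ord1. Qed.
Lemma coef_trunc_mul N f g n : (n < N)%N ->
  (f * g) n = (fps_trunc N f * fps_trunc N g)`_n.
Proof. exact: mulE. Qed.
End SeriesRing.

(** The datum is the structure map rather than a unit predicate, because that is what [{poly A}],
    [fps A] and the ring [spec K] supply directly. *)
HB.mixin Record ComNzRing_isRatAlgebra A of GRing.ComNzRing A := {
  ratA : {rmorphism rat -> A}
}.

#[short(type="ratAlgType")]
HB.structure Definition RatAlgebra :=
  {A of GRing.ComNzRing A & ComNzRing_isRatAlgebra A}.

Section RatAlgebraTheory.
Variable A : ratAlgType.

Lemma ratAVK n : ratA n.+1%:R^-1 * n.+1%:R = 1 :> A.
Proof.
by rewrite -(rmorph_nat (@ratA A)) -rmorphM mulVf ?rmorph1 // Num.Theory.pnatr_eq0.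
Qed.

Lemma natrA_inj n (x y : A) : n.+1%:R * x = n.+1%:R * y -> x = y.
Proof. by move/(congr1 ( *%R (ratA n.+1%:R^-1))); rewrite !mulrA ratAVK !mul1r. Qed.

Lemma natrA_eq0 n (x : A) : n.+1%:R * x = 0 -> x = 0.
Proof. by move=> nx0; apply: (@natrA_inj n); rewrite nx0 mulr0. Qed.

(** Multiplying by the denominator of q reduces to integers, on which ring morphisms agree. Hence
    every ring morphism between Q-algebras is automatically Q-linear. *)
Lemma ratA_uniq (f : {rmorphism rat -> A}) : f =1 ratA.
Proof.
move=> q; have [n dn] : exists n, denq q = Posz n.+1.
  by case: (denq q) (denq_gt0 q) => [[|n]|n] // _; exists n.
have qE : n.+1%:R * q = (numq q)%:~R.
  by rewrite -{1}(divq_num_den q) dn mulrC divfK // Num.Theory.pnatr_eq0.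
apply: (@natrA_inj n); rewrite -{1}(rmorph_nat f).
by rewrite -(rmorph_nat (@ratA A)) -!rmorphM qE !rmorph_int.
Qed.

Lemma ratA_factM n (x : A) : ratA n.+1`!%:R^-1 * (x *+ n.+1) = ratA n`!%:R^-1 * x.
Proof.
rewrite mulrnAr -mulrnAl -raddfMn /= -[_ *+ n.+1]mulr_natr factS natrM invfM mulrAC mulVf ?mul1r //.
by rewrite Num.Theory.pnatr_eq0.
Qed.
End RatAlgebraTheory.

Lemma rmorph_ratA (A B : ratAlgType) (h : {rmorphism A -> B}) q : h (ratA q) = ratA q.
Proof. exact: (ratA_uniq (h \o ratA)). Qed.

HB.instance Definition _ (A : ratAlgType) :=
  ComNzRing_isRatAlgebra.Build {poly A} (@polyC A \o @ratA A).

(* The alias selects the [ratAlgType] path to the ring structure of {poly A}; terms mixing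
   it with the [comNzRingType] path are very slow to unify. *)
Definition polyQ (A : ratAlgType) : ratAlgType := {poly A}.

Section SeriesConstants.
Variable A : comNzRingType.
Implicit Types f g h : fps A.

Definition fpsC (c : A) : fps A := fun n => if n is 0 then c else 0.
Definition eps : fps A := fun n => (n == 1)%N%:R.

Lemma coef_fpsCM c f n : (fpsC c * f) n = c * f n.
Proof.
rewrite coef_fpsM big_ord_recl /= subn0 big1 ?addr0 // => i _.
by rewrite mul0r.
Qed.

Fact fpsC_is_zmod_morphism : zmod_morphism fpsC.
Proof.
by move=> c d; apply: fpsP => -[|n] //; rewrite coef_fpsB subr0.
Qed.
Fact fpsC_is_monoid_morphism : monoid_morphism fpsC.
Proof.
split; first by apply: fpsP => -[].
by move=> c d; apply: fpsP => -[|n]; rewrite coef_fpsCM ?mulr0.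
Qed.
HB.instance Definition _ := GRing.isZmodMorphism.Build A (fps A) fpsC fpsC_is_zmod_morphism.
HB.instance Definition _ := GRing.isMonoidMorphism.Build A (fps A) fpsC fpsC_is_monoid_morphism.

Lemma coef_epsM f n : (eps * f) n = if n is m.+1 then f m else 0.
Proof.
case: n => [|n]; first by rewrite coef_fpsM0 mul0r.
rewrite coef_fpsM !big_ord_recl big1 => [|i _]; last by rewrite mul0r.
by rewrite mul0r add0r addr0 mul1r subn1.
Qed.

Lemma coef_epsXM k f n : (eps ^+ k * f) n = if (n < k)%N then 0 else f (n - k)%N.
Proof.
elim: k n => [|k IHk] n; first by rewrite mul1r subn0.
by rewrite exprS -mulrA coef_epsM; case: n => // n; rewrite IHk subSS ltnS.
Qed.

(* Congruence modulo [eps ^+ N]. *)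
Definition eqm N f g := forall n, (n < N)%N -> f n = g n.

Lemma eqm_refl N f : eqm N f f. Proof. by []. Qed.
Lemma eqm_sym N f g : eqm N f g -> eqm N g f.
Proof. by move=> fg n ltn; rewrite fg. Qed.
Lemma eqm_trans N f g h : eqm N f g -> eqm N g h -> eqm N f h.
Proof. by move=> fg gh n ltn; rewrite fg ?gh. Qed.
Lemma eqm_le N M f g : (N <= M)%N -> eqm M f g -> eqm N f g.
Proof. by move=> leNM fg n ltn; apply/fg/(leq_trans ltn). Qed.
Lemma eqmP f g : (forall N, eqm N f g) -> f = g.
Proof. by move=> fg; apply: fpsP => n; apply: (fg n.+1). Qed.

Lemma eqmM N f f' g g' : eqm N f f' -> eqm N g g' -> eqm N (f * g) (f' * g').
Proof.
move=> ff gg n ltn; rewrite !coef_fpsM; apply: eq_bigr => i _.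
by rewrite ff ?gg //; [exact: leq_ltn_trans (leq_subr _ _) ltn | have := ltn_ord i; lia].
Qed.

Lemma eqmD N f f' g g' : eqm N f f' -> eqm N g g' -> eqm N (f + g) (f' + g').
Proof. by move=> ff gg n ltn; rewrite !coef_fpsD ff ?gg. Qed.

Lemma fps_expand N f : eqm N f (\sum_(m < N) fpsC (f m) * eps ^+ m).
Proof.
move=> n ltn; rewrite coef_fps_sum (bigD1 (Ordinal ltn)) //= mulrC coef_epsXM.
rewrite ltnn subnn /= big1 ?addr0 // => i ne_in; rewrite mulrC coef_epsXM.
case: ltngtP => // [lt_in|eq_in]; last by case/eqP: ne_in; apply: val_inj.
by rewrite -(subnKC lt_in) addSnnS addKn.
Qed.

Lemma coef_exp_lt f j n : f 0%N = 0 -> (n < j)%N -> (f ^+ j) n = 0.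
Proof.
move=> f0; elim: j n => // j IHj n lt_nj; rewrite exprS coef_fpsM big_ord_recl f0.
by rewrite mul0r add0r big1 // => i _; rewrite IHj ?mulr0 //= /bump /=; have := ltn_ord i; lia.
Qed.

Definition fderiv f : fps A := fun n => n.+1%:R * f n.+1.

Fact fderiv_is_zmod_morphism : zmod_morphism fderiv.
Proof. by move=> f g; apply: fpsP => n; rewrite /fderiv !coef_fpsB mulrBr. Qed.
HB.instance Definition _ :=
  GRing.isZmodMorphism.Build (fps A) (fps A) fderiv fderiv_is_zmod_morphism.

Lemma fderivM f g : fderiv (f * g) = fderiv f * g + f * fderiv g.
Proof.
apply: fpsP => n.
have der_trunc u i : (i < n.+1)%N -> (fps_trunc n.+2 u)^`()`_i = fderiv u i.
  by move=> lt_in; rewrite coef_deriv coef_poly ltnS lt_in /fderiv mulr_natl.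
have truncE u i : (i < n.+1)%N -> (fps_trunc n.+2 u)`_i = u i.
  by move=> lt_in; rewrite coef_poly ltnS ltnW.
rewrite {1}/fderiv (@coef_trunc_mul _ n.+2) // mulr_natl -coef_deriv derivM coefD coef_fpsD.
by congr (_ + _); rewrite coef_fpsM coefM; apply: eq_bigr => i _;
  rewrite der_trunc ?truncE // ltnS leq_subr.
Qed.

Lemma fderiv_eqm N f g : eqm N.+1 f g -> eqm N (fderiv f) (fderiv g).
Proof. by move=> fg n ltn; rewrite /fderiv fg. Qed.

Lemma fderivC c : fderiv (fpsC c) = 0.
Proof. by apply: fpsP => n; rewrite /fderiv mulr0. Qed.

Lemma fderiv_eps : fderiv eps = 1.
Proof. by apply: fpsP => -[|n]; rewrite /fderiv ?mulr1 ?mulr0. Qed.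
End SeriesConstants.

Arguments eps {A}.

HB.instance Definition _ (A : ratAlgType) :=
  ComNzRing_isRatAlgebra.Build (fps A) (@fpsC A \o @ratA A).

(* A derivation along [h], which need not be the identity. *)
Definition is_derivation (A B : comNzRingType) (h d : A -> B) :=
  forall a b, d (a * b) = d a * h b + h a * d b.

Section Derivation.
Variables (A B : ratAlgType) (h : {rmorphism A -> B}) (d : {additive A -> B}).
Hypothesis derM : is_derivation h d.

Lemma der_X a n : d (a ^+ n) = h a ^+ n.-1 * d a *+ n.
Proof.
have d1 : d 1 = 0.
  have /eqP := derM 1 1; rewrite !mulr1 rmorph1 mulr1 mul1r -subr_eq0 opprD addrA subrr.
  by rewrite sub0r oppr_eq0 => /eqP.
elim: n => [|n IHn]; first by rewrite d1.
rewrite exprS derM IHn rmorphXn mulrC mulrS; congr (_ + _).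
by case: n {IHn} => [|n]; rewrite ?mulr0 // exprS mulrnAr mulrA.
Qed.

Lemma der_ratA q : d (ratA q) = 0.
Proof.
have d1 : d 1 = 0 by rewrite -[1](expr0 0) der_X mulr0n.
have [n dn] : exists n, denq q = Posz n.+1.
  by case: (denq q) (denq_gt0 q) => [[|n]|n] // _; exists n.
have qE : n.+1%:R * q = (numq q)%:~R.
  by rewrite -{1}(divq_num_den q) dn mulrC divfK // Num.Theory.pnatr_eq0.
apply: (@natrA_eq0 _ n); rewrite mulr_natl -raddfMn -mulr_natl.
by rewrite -(rmorph_nat (@ratA A)) -rmorphM qE rmorph_int raddfMz d1 mul0rz.
Qed.

Lemma der_ratAM q a : d (ratA q * a) = ratA q * d a.
Proof. by rewrite derM der_ratA mul0r add0r rmorph_ratA. Qed.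
End Derivation.

(** * Extending maps from coefficients to series *)

Section Extension.
Variables A B : comNzRingType.
Implicit Types f g : fps A.

(* The [eps]-linear extension of [Phi : A -> B[[eps]]] to [A[[eps]]]; it is given on the
   coefficients, so no convergence condition on [Phi] is needed. *)
Definition fext (Phi : A -> fps B) f : fps B := fun n => \sum_(m < n.+1) Phi (f m) (n - m)%N.

Lemma fext_eqm Phi N f g : eqm N f g -> eqm N (fext Phi f) (fext Phi g).
Proof.
move=> fg n ltn; apply: eq_bigr => i _; rewrite fg //.
by apply: leq_trans ltn; rewrite ltnS -ltnS.
Qed.

(** Below order N only finitely many coefficients matter, so identities for [fext] are checked on
    such finite sums and then for all N. *)
Lemma fext_expand (Phi : A -> fps B) N f :
  eqm N (fext Phi f) (\sum_(m < N) Phi (f m) * eps ^+ m).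
Proof.
move=> n ltn; rewrite coef_fps_sum /fext (big_ord_widen _ (fun m => Phi (f m) (n - m)%N) ltn).
rewrite big_mkcond; apply: eq_bigr => m _; rewrite mulrC coef_epsXM ltnS leqNgt.
by case: (n < m)%N.
Qed.

Section Additive.
Variable Phi : {additive A -> fps B}.

Fact fext_is_zmod_morphism : zmod_morphism (fext Phi).
Proof.
move=> f g; apply: fpsP => n; rewrite coef_fpsB /fext -sumrB.
by apply: eq_bigr => i _; rewrite raddfB.
Qed.
HB.instance Definition _ :=
  GRing.isZmodMorphism.Build (fps A) (fps B) (fext Phi) fext_is_zmod_morphism.

Lemma fext_CX c k : fext Phi (fpsC c * eps ^+ k) = Phi c * eps ^+ k.
Proof.
apply: fpsP => n; rewrite [Phi c * _]mulrC coef_epsXM /fext.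
under eq_bigr => i _ do rewrite mulrC coef_epsXM.
case: ltnP => [lt_nk|le_kn].
  by rewrite big1 // => i _; rewrite ifT ?raddf0 //; apply: leq_ltn_trans lt_nk; rewrite -ltnS.
have lt_k : (k < n.+1)%N by [].
rewrite (bigD1 (Ordinal lt_k)) //= ltnn subnn big1 ?addr0 // => i ne_ik.
case: ltngtP => [_|lt_ki|eq_ik]; rewrite ?raddf0 //.
  by rewrite -(subnKC lt_ki) addSnnS addKn /= raddf0.
by case/eqP: ne_ik; apply: val_inj.
Qed.

Lemma fextC c : fext Phi (fpsC c) = Phi c.
Proof. by have := fext_CX c 0; rewrite !expr0 !mulr1. Qed.

Lemma fext_epsX f k : fext Phi (f * eps ^+ k) = fext Phi f * eps ^+ k.
Proof.
apply: eqmP => N; apply: eqm_trans (fext_eqm _ (eqmM (fps_expand f) (@eqm_refl _ _ _))) _.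
apply: eqm_sym; apply: eqm_trans (eqmM (fext_expand _ _) (@eqm_refl _ _ _)) _.
rewrite !mulr_suml raddf_sum /=.
by under [X in eqm _ _ X]eq_bigr => i _ do rewrite -mulrA -exprD fext_CX exprD mulrA.
Qed.

Lemma fext_mul_expand N f g : eqm N (fext Phi (f * g))
  (\sum_(i < N) \sum_(j < N) Phi (f i * g j) * eps ^+ (i + j)).
Proof.
apply: eqm_trans (fext_eqm _ (eqmM (fps_expand f) (fps_expand g))) _.
rewrite mulr_suml raddf_sum /=; under eq_bigr => i _.
  rewrite mulr_sumr raddf_sum /=.
  under eq_bigr => j _ do rewrite mulrACA -rmorphM -exprD fext_CX.
  over.
by [].
Qed.
End Additive.

Lemma fextM_expand (Phi Psi : {additive A -> fps B}) N f g :
  eqm N (fext Phi f * fext Psi g)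
    (\sum_(i < N) \sum_(j < N) Phi (f i) * Psi (g j) * eps ^+ (i + j)).
Proof.
apply: eqm_trans (eqmM (fext_expand Phi f) (fext_expand Psi g)) _.
rewrite mulr_suml; under eq_bigr => i _.
  rewrite mulr_sumr; under eq_bigr => j _ do rewrite mulrACA -exprD.
  over.
by [].
Qed.

Lemma fext_derivation (h d : {additive A -> fps B}) :
  is_derivation h d -> is_derivation (fext h) (fext d).
Proof.
move=> derM f g; apply: eqmP => N; apply: eqm_trans (fext_mul_expand _ _ _) _.
apply: eqm_sym; apply: eqm_trans (eqmD (fextM_expand _ _ _ _) (fextM_expand _ _ _ _)) _.
rewrite -big_split /=; under eq_bigr => i _.
  rewrite -big_split /=; under eq_bigr => j _ do rewrite -mulrDl -derM.
  over.
by [].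
Qed.

Section RMorphism.
Variable Phi : {rmorphism A -> fps B}.

Fact fext_is_monoid_morphism : monoid_morphism (fext Phi).
Proof.
split; first by rewrite -(rmorph1 (@fpsC A)) fextC /= rmorph1.
move=> f g; apply: eqmP => N; apply: eqm_trans (fext_mul_expand _ _ _) _.
apply: eqm_sym; apply: eqm_trans (fextM_expand _ _ _ _) _.
under eq_bigr => i _ do under eq_bigr => j _ do rewrite -rmorphM.
by [].
Qed.
HB.instance Definition _ :=
  GRing.isMonoidMorphism.Build (fps A) (fps B) (fext Phi) fext_is_monoid_morphism.

Lemma fext_eps : fext Phi eps = eps.
Proof. by have := fext_CX Phi 1 1; rewrite /= !rmorph1 !mul1r expr1. Qed.
End RMorphism.
End Extension.

Lemma fext_comp (A B C : comNzRingType) (Phi : A -> fps B)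
    (Psi : {additive B -> fps C}) (f : fps A) :
  fext Psi (fext Phi f) = fext (fext Psi \o Phi) f.
Proof.
apply: eqmP => N; apply: eqm_trans (fext_eqm _ (fext_expand _ f)) _.
apply: eqm_sym; apply: eqm_trans (fext_expand _ f) _.
by rewrite raddf_sum /=; under [X in eqm _ _ X]eq_bigr => i _ do rewrite fext_epsX.
Qed.

Lemma coef_fext_const (A B : comNzRingType) (g : A -> B) (f : fps A) n :
  fext (@fpsC B \o g) f n = g (f n).
Proof.
rewrite /fext big_ord_recr /= subnn big1 ?add0r // => i _.
by have := ltn_ord i; rewrite -subn_gt0; case: (n - i)%N.
Qed.

Lemma eq_fext (A B : comNzRingType) (Phi Psi : A -> fps B) :
  Phi =1 Psi -> fext Phi =1 fext Psi.
Proof. by move=> eq_PP f; apply: fpsP => n; apply: eq_bigr => i _; rewrite eq_PP. Qed.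

(** * Exponentials of series *)

Section Exponential.
Variable A : ratAlgType.
Implicit Types f g : fps A.

Definition fexp f : fps A := fun n => \sum_(j < n.+1) ratA j`!%:R^-1 * (f ^+ j) n.

Lemma fexp_eqm N f : f 0%N = 0 -> eqm N (fexp f) (\sum_(j < N) ratA j`!%:R^-1 * f ^+ j).
Proof.
move=> f0 n ltn; rewrite coef_fps_sum /fexp.
rewrite -(big_mkord xpredT (fun j => ratA j`!%:R^-1 * (f ^+ j) n)).
under [RHS]eq_bigr => i _ do rewrite coef_fpsCM /=.
rewrite -(big_mkord xpredT (fun j => ratA j`!%:R^-1 * (f ^+ j) n)).
rewrite [RHS](@big_cat_nat _ _ _ n.+1) //= [X in _ + X]big_nat [X in _ + X]big1 ?addr0 // => i /andP[lt_ni _].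
by rewrite coef_exp_lt ?mulr0.
Qed.

Lemma fexp_0 f : fexp f 0%N = 1.
Proof. by rewrite /fexp big_ord1 expr0 mulr1 /= invr1 rmorph1. Qed.

(** Uniqueness for a linear first-order equation: the difference u solves u' = h u with u_0 = 0, and
    each coefficient is determined by the earlier ones because n + 1 is invertible. This is the tool
    for identities between exponentials. *)
Lemma fderiv_inj f g h : fderiv f = h * f -> fderiv g = h * g -> f 0%N = g 0%N -> f = g.
Proof.
move=> df dg fg0; apply/eqP; rewrite -subr_eq0; apply/eqP; set u := f - g.
have du : fderiv u = h * u by rewrite raddfB /= df dg mulrBr.
have u0 : u 0%N = 0 by rewrite /u coef_fpsB fg0 subrr.
suff IH n : eqm n.+1 u 0 by apply: eqmP => N; apply: eqm_le (leqnSn N) (IH N).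
elim: n => [|n IHn] [|m] // le_mn; rewrite ltnS in le_mn.
apply: (@natrA_eq0 _ m); have /(congr1 (fun v => v m)) := du; rewrite {1}/fderiv => ->.
rewrite coef_fpsM big1 // => i _; rewrite (IHn (m - i)%N) ?mulr0 //.
by rewrite ltnS (leq_trans (leq_subr _ _)) // ltnW.
Qed.
End Exponential.

Section ExponentialMorphism.
Variables (A B : ratAlgType) (h : {rmorphism fps A -> fps B}).
Hypothesis h_eqm : forall N f g, eqm N f g -> eqm N (h f) (h g).
Implicit Types f g : fps A.

Let h0 f : f 0%N = 0 -> h f 0%N = 0.
Proof.
move=> f0; have /h_eqm/(_ 0%N isT) -> : eqm 1 f 0 by case.
by rewrite rmorph0.
Qed.

Lemma rmorph_fexp f : f 0%N = 0 -> h (fexp f) = fexp (h f).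
Proof.
move=> f0; apply: eqmP => N; apply: eqm_trans (h_eqm (fexp_eqm f0)) _.
apply: eqm_sym; apply: eqm_trans (fexp_eqm (h0 f0)) _; rewrite rmorph_sum.
by under [X in eqm _ _ X]eq_bigr => j _ do rewrite rmorphM rmorphXn /= rmorph_ratA.
Qed.

Variable d : {additive fps A -> fps B}.
Hypothesis d_eqm : forall N f g, eqm N.+1 f g -> eqm N (d f) (d g).
Hypothesis derM : is_derivation h d.

(** The hypothesis on [d] tolerates the loss of one order of precision, so that [fderiv] is covered
    together with the derivations that act on coefficients. *)
Lemma der_fexp f : f 0%N = 0 -> d (fexp f) = d f * fexp (h f).
Proof.
move=> f0; apply: eqmP => N; apply: eqm_trans (d_eqm (fexp_eqm f0)) _.
apply: eqm_sym; apply: eqm_trans (eqmM (@eqm_refl _ _ _) (fexp_eqm (h0 f0))) _.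
rewrite mulr_sumr raddf_sum big_ord_recl /= (der_ratAM derM) (der_X derM) mulr0n mulr0 add0r.
under [X in eqm _ _ X]eq_bigr => j _.
  rewrite (der_ratAM derM) (der_X derM) /= /bump add1n ratA_factM mulrA mulrC.
  over.
by [].
Qed.
End ExponentialMorphism.

Lemma fext_fexp (A B : ratAlgType) (Phi : {rmorphism A -> fps B}) (f : fps A) :
  f 0%N = 0 -> fext Phi (fexp f) = fexp (fext Phi f).
Proof. by apply: rmorph_fexp => N g g'; apply: fext_eqm. Qed.

Lemma fext_der_fexp (A B : ratAlgType) (h : {rmorphism A -> fps B})
    (d : {additive A -> fps B}) (f : fps A) :
  is_derivation h d -> f 0%N = 0 -> fext d (fexp f) = fext d f * fexp (fext h f).
Proof.
move=> derM; apply: der_fexp; first by move=> N g g'; apply: fext_eqm.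
  by move=> N g g' gg; apply: fext_eqm; apply: eqm_le gg.
exact: fext_derivation.
Qed.

Section ExponentialTheory.
Variable A : ratAlgType.
Implicit Types f g : fps A.

Lemma fderiv_fexp f : f 0%N = 0 -> fderiv (fexp f) = fderiv f * fexp f.
Proof.
apply: (@der_fexp _ _ idfun) => //; first exact: fderiv_eqm.
exact: fderivM.
Qed.

Lemma fderiv_fexp_eq f g : f 0%N = 0 -> fderiv f = g -> fderiv (fexp f) = g * fexp f.
Proof. by move=> f0 <-; apply: fderiv_fexp. Qed.

Lemma fexp0 : fexp 0 = 1 :> fps A.
Proof.
apply: (@fderiv_inj _ _ _ 0); rewrite ?fexp_0 // ?mul0r.
  by rewrite fderiv_fexp // raddf0 mul0r.
by rewrite -[1](rmorph1 (@fpsC A)) fderivC.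
Qed.

Lemma fexpD f g : f 0%N = 0 -> g 0%N = 0 -> fexp (f + g) = fexp f * fexp g.
Proof.
move=> f0 g0; apply: (@fderiv_inj _ _ _ (fderiv (f + g))).
- by rewrite fderiv_fexp // coef_fpsD f0 g0 addr0.
- by rewrite fderivM !fderiv_fexp // raddfD /=; ring.
- by rewrite coef_fpsM0 !fexp_0 mulr1.
Qed.

Lemma fexpNK f : f 0%N = 0 -> fexp f * fexp (- f) = 1.
Proof. by move=> f0; rewrite -fexpD ?coef_fpsN ?f0 ?oppr0 // subrr fexp0. Qed.
End ExponentialTheory.

Section PolynomialSubstitution.
Variables A B : comNzRingType.
Variables (Phi : {rmorphism A -> fps B}) (X : fps B).

Definition peval (p : {poly A}) : fps B := (map_poly Phi p).[X].

HB.instance Definition _ :=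
  GRing.RMorphism.copy peval (horner_eval X \o map_poly Phi).

Lemma pevalC c : peval c%:P = Phi c.
Proof. by rewrite /peval map_polyC hornerC. Qed.

Lemma pevalX : peval 'X = X.
Proof. by rewrite /peval map_polyX hornerX. Qed.
End PolynomialSubstitution.

Notation fsub X := (fext (peval (@fpsC _) X)).

Lemma fext_peval (A B C : comNzRingType) (Phi : {rmorphism A -> fps B}) (X : fps B)
    (Psi : {rmorphism B -> fps C}) (p : {poly A}) :
  fext Psi (peval Phi X p) = peval (fext Psi \o Phi) (fext Psi X) p.
Proof. by rewrite /peval -horner_map -map_poly_comp. Qed.

Section Taylor.
Variable A : comNzRingType.
Implicit Types (X : fps A) (p : {poly A}) (f : fps {poly A}).

Definition taylor p : fps {poly A} := fun j => p^`N(j).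

Fact taylor_is_zmod_morphism : zmod_morphism taylor.
Proof. by move=> p q; apply: fpsP => j; rewrite /taylor raddfB. Qed.
HB.instance Definition _ :=
  GRing.isZmodMorphism.Build {poly A} (fps {poly A}) taylor taylor_is_zmod_morphism.

(** [taylor] is made of divided derivatives, so this is Taylor's formula without factorials. The
    work lies in the ranges: one sum stops at N, the other at the size of p, and the terms outside
    either range do not affect coefficient n. *)
Lemma peval_taylor X p : peval (@fpsC A) (X + eps) p = fsub X (taylor p).
Proof.
apply: eqmP => N; apply: eqm_sym; apply: eqm_trans (fext_expand _ _) _.
rewrite /peval nderiv_taylor; last exact: mulrC.
rewrite size_map_inj_poly ?rmorph0 //; last first.
  by move=> c d /(congr1 (fun f : fps A => f 0%N)).
under [X in eqm _ _ X]eq_bigr => i _ do rewrite nderivn_map.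
move=> n ltn; rewrite !coef_fps_sum.
pose F i := ((map_poly (@fpsC A) p^`N(i)).[X] * eps ^+ i) n.
rewrite -(big_mkord xpredT F) -[RHS](big_mkord xpredT F).
have F0 i : (n < i)%N || (size p <= i)%N -> F i = 0.
  rewrite /F => /orP[lt_ni|le_pi]; first by rewrite mulrC coef_epsXM lt_ni.
  by rewrite nderivn_poly0 // rmorph0 horner0 mul0r.
have cut M : (n < M)%N -> \sum_(0 <= i < M) F i = \sum_(0 <= i < n.+1) F i.
  move=> ltM; rewrite (@big_cat_nat _ _ _ n.+1) //= [X in _ + X]big_nat [X in _ + X]big1 ?addr0 //.
  by move=> i /andP[lt_ni _]; rewrite F0 ?lt_ni.
rewrite cut //; have [ltp|lep] := ltnP n (size p); first by rewrite cut.
rewrite (@big_cat_nat _ _ _ (size p)) ?leqW //= [X in _ + X]big_nat [X in _ + X]big1 ?addr0 //.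
by move=> i /andP[le_pi _]; rewrite F0 ?le_pi ?orbT.
Qed.

Lemma fsub_shift X f : fsub (X + eps) f = fsub X (fext taylor f).
Proof. by rewrite fext_comp; apply: eq_fext => p; apply: peval_taylor. Qed.
End Taylor.

(** * The series psi and its difference equation *)

Fixpoint Li_poly m : {poly rat} :=
  if m is m'.+1 then ('X + 'X^2) * (Li_poly m')^`() else 'X.

Section Polylog.
Variable A : ratAlgType.

(* [Li m L] is Li_(-m)(z) for L = z / (1 - z): z d/dz acts on functions of L as
   (L + L^2) d/dL. *)
Definition Li m (L : A) : A := (map_poly ratA (Li_poly m)).[L].

Lemma Li0 L : Li 0 L = L.
Proof. by rewrite /Li map_polyX hornerX. Qed.

Lemma Li1 L : Li 1 L = L + L ^+ 2.
Proof. by rewrite /Li /= derivX mulr1 rmorphD rmorphXn /= map_polyX !hornerE. Qed.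
End Polylog.

Lemma rmorph_Li (A B : ratAlgType) (h : {rmorphism A -> B}) m L : h (Li m L) = Li m (h L).
Proof.
rewrite /Li -horner_map -map_poly_comp; congr _.[_].
by apply: eq_map_poly => q /=; rewrite rmorph_ratA.
Qed.

Lemma der_Li (A B : ratAlgType) (h : {rmorphism A -> B}) (d : {additive A -> B}) m L u :
  is_derivation h d -> d L = u * (h L + h L ^+ 2) -> d (Li m L) = u * Li m.+1 (h L).
Proof.
move=> derM dL; rewrite /Li /= rmorphM rmorphD rmorphXn /= map_polyX.
rewrite hornerM hornerD hornerXn hornerX mulrA -dL.
elim/poly_ind: (Li_poly m) => [|p q IHp].
  by rewrite !raddf0 !horner0 raddf0 mulr0.
rewrite derivD derivM derivC derivX mulr1 addr0 !rmorphD !rmorphM /= map_polyX map_polyC /=.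
rewrite !(hornerD, hornerM, hornerX, hornerC) raddfD /= derM IHp (der_ratA derM) -horner_map -map_poly_comp.
have -> : map_poly (h \o ratA) p = map_poly ratA p.
  by apply: eq_map_poly => r /=; rewrite rmorph_ratA.
rewrite map_polyX hornerX; ring.
Qed.

(** The Taylor series of Li_0(z e^s) in s, written in terms of L = Li_0(z). *)
Definition Li_series : fps {poly rat} := fun n => n`!%:R^-1 *: Li_poly n.

(** Write y for the series and theta for the derivation (L + L^2) d/dL. It commutes with d/ds and y'
    = theta y, so u = y' - y - y^2 satisfies u' = theta u; since u_0 = 0, all coefficients of u
    vanish in turn. *)
Lemma fderiv_Li_series : fderiv Li_series = Li_series + Li_series ^+ 2.
Proof.
pose th (p : {poly rat}) := ('X + 'X^2) * p^`().
have thB p q : th (p - q) = th p - th q by rewrite /th derivB mulrBr.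
have thD p q : th (p + q) = th p + th q by rewrite /th derivD mulrDr.
have thM p q : th (p * q) = th p * q + p * th q by rewrite /th derivM; ring.
have th0 : th 0 = 0 by rewrite /th deriv0 mulr0.
pose Th (f : fps {poly rat}) : fps {poly rat} := fun n => th (f n).
have ThM f g : Th (f * g) = Th f * g + f * Th g.
  apply: fpsP => n; rewrite /Th coef_fpsD !coef_fpsM (big_morph _ thD th0) -big_split.
  by apply: eq_bigr => i _; rewrite thM.
have ThB f g : Th (f - g) = Th f - Th g by apply: fpsP => n; rewrite /Th coef_fpsB thB.
have Thd f : fderiv (Th f) = Th (fderiv f).
  by apply: fpsP => n; rewrite /fderiv /Th thM -polyC_natr /th derivC mulr0 mul0r add0r.
have yTh : fderiv Li_series = Th Li_series.
  apply: fpsP => n; rewrite /fderiv /Th /Li_series /= /th derivZ mulr_natl -scaler_nat scalerA.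
  rewrite -scalerAr; congr (_ *: _); rewrite factS natrM invfM mulrA mulfV ?mul1r //.
  by rewrite Num.Theory.pnatr_eq0.
apply/eqP; rewrite -subr_eq0; apply/eqP; set u := _ - _.
have du : fderiv u = Th u.
  rewrite /u yTh opprD addrA !ThB expr2 ThM !raddfB /= fderivM yTh !Thd yTh.
  ring.
apply: fpsP; elim=> [|n IHn].
  rewrite /u coef_fpsB coef_fpsD expr2 coef_fpsM0 /fderiv /Li_series /= derivX.
  by rewrite !invr1 !scale1r mulr1 mul1r -expr2 subrr.
have /(congr1 (fun f : fps _ => f n)) := du; rewrite {1}/fderiv /Th IHn th0 -polyC_natr => /eqP.
by rewrite mulf_eq0 polyC_eq0 Num.Theory.pnatr_eq0 => /eqP.
Qed.

Section PsiPolynomials.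
Variable A : ratAlgType.
Implicit Types (L : A) (X : fps A).

(* exp (hbar^(1/2) X) *)
Definition fE X : fps A := fexp (X * eps).

(** The shape of the exponent of psi with its coefficients left free, because the same shape returns
    with the polylogarithm index raised by one when the coefficients are differentiated. *)
Definition diag_poly (c : nat -> nat -> A) : fps {poly A} := fun n => if n is 0 then 0 else
  - \sum_(k < n.+3) \sum_(l < n.+3 | (2 * k + l == n + 2)%N) (c k l)%:P * 'X^l.

Definition lpsi_coef L k l : A :=
  ratA (bernoulli k / (l`!%:R * k`!%:R)) * Li (k + l - 2) L.

Definition lpsi_poly L : fps {poly A} := diag_poly (lpsi_coef L).

Definition lpsi X L : fps A := fsub X (lpsi_poly L).
(* psi_hbar(X, z) for L = z / (1 - z), where X may itself be a series in [eps]. *)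
Definition psiS X L : fps A := fexp (lpsi X L).
End PsiPolynomials.

Lemma fext_coef0 (A B : comNzRingType) (Phi : {additive A -> fps B}) (f : fps A) :
  f 0%N = 0 -> fext Phi f 0%N = 0.
Proof. by move=> f0; rewrite /fext big_ord1 f0 raddf0. Qed.

Lemma lpsi_0 (A : ratAlgType) (X : fps A) L : lpsi X L 0%N = 0.
Proof. exact: fext_coef0. Qed.

Lemma mul_eps_0 (A : comNzRingType) (X : fps A) : (X * eps) 0%N = 0.
Proof. by rewrite coef_fpsM0 mulr0. Qed.

Lemma fE_D (A : ratAlgType) (X Y : fps A) : fE (X + Y) = fE X * fE Y.
Proof. by rewrite /fE mulrDl fexpD ?mul_eps_0. Qed.

Lemma fE0 (A : ratAlgType) : fE 0 = 1 :> fps A.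
Proof. by rewrite /fE mul0r fexp0. Qed.

Lemma fE_eq2 (A : ratAlgType) (X1 X2 Y1 Y2 : fps A) :
  X1 + X2 = Y1 + Y2 -> fE X1 * fE X2 = fE Y1 * fE Y2.
Proof. by move=> eqXY; rewrite -[LHS]fE_D eqXY fE_D. Qed.

Lemma fE_D3 (A : ratAlgType) (X Y Z : fps A) : fE (X + Y + Z) = fE X * fE Y * fE Z.
Proof. by rewrite [LHS]fE_D fE_D. Qed.

Lemma fE_eq3 (A : ratAlgType) (X1 X2 X3 Y1 Y2 Y3 : fps A) :
  X1 + X2 + X3 = Y1 + Y2 + Y3 -> fE X1 * fE X2 * fE X3 = fE Y1 * fE Y2 * fE Y3.
Proof. by move=> eqXY; rewrite -[LHS]fE_D3 eqXY fE_D3. Qed.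

Section PsiMorphism.
Variables (A B : ratAlgType) (Phi : {rmorphism A -> fps B}).

Lemma fext_fE X : fext Phi (fE X) = fE (fext Phi X).
Proof. by rewrite /fE fext_fexp ?mul_eps_0 // rmorphM /= fext_eps. Qed.

Lemma fext_lpsi X L L' : Phi L = fpsC L' -> fext Phi (lpsi X L) = lpsi (fext Phi X) L'.
Proof.
move=> PhiL; rewrite /lpsi fext_comp; apply: fpsP => n; apply: eq_bigr => m _.
congr ((_ : fps B) _); rewrite /= fext_peval; case: (m : nat) => [|{}m]; first by rewrite !raddf0.
rewrite /= !raddfN /= !rmorph_sum; congr (- _); apply: eq_bigr => k _.
rewrite !rmorph_sum; apply: eq_bigr => l _; rewrite !rmorphM !rmorphXn /= !pevalX; congr (_ * _).
by rewrite !pevalC /= !fextC /= !rmorph_ratA !rmorph_Li PhiL.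
Qed.

Lemma fext_psiS X L L' : Phi L = fpsC L' -> fext Phi (psiS X L) = psiS (fext Phi X) L'.
Proof. by move=> PhiL; rewrite /psiS fext_fexp ?lpsi_0 // (fext_lpsi _ PhiL). Qed.
End PsiMorphism.

Lemma natr_fact_neq0 n : n`!%:R != 0 :> rat.
Proof. by rewrite Num.Theory.pnatr_eq0 -lt0n fact_gt0. Qed.

Lemma binE (m j : nat) : 'C(m + j, j)%:R = (m + j)`!%:R / (j`!%:R * m`!%:R) :> rat.
Proof.
rewrite -(@bin_fact (m + j) j) ?leq_addl // addnK !natrM mulfK //.
by rewrite mulf_neq0 ?natr_fact_neq0.
Qed.

(** The coefficient of t^r in e^t B(t) = B(t) + t, where B(t) = t/(e^t - 1). *)
Lemma bernoulli_conv r :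
  \sum_(j < r.+1) bernoulli (r - j) / (j`!%:R * (r - j)`!%:R)
  = bernoulli r / r`!%:R + (r == 1)%N%:R.
Proof.
have -> : \sum_(j < r.+1) bernoulli (r - j) / (j`!%:R * (r - j)`!%:R)
  = (r`!%:R)^-1 * \sum_(j < r.+1) 'C(r, j)%:R * bernoulli j.
  rewrite mulr_sumr [RHS](reindex_inj rev_ord_inj) /=; apply: eq_bigr => j _.
  have le_jr : (j <= r)%N by rewrite -ltnS.
  rewrite subSS; have := binE (r - j) j; rewrite subnK // => binr.
  by rewrite bin_sub // binr; field; rewrite !natr_fact_neq0.
rewrite big_ord_recr /= binn mul1r mulrDr addrC [_^-1 * bernoulli r]mulrC; congr (_ + _).
by case: r => [|r]; rewrite ?big_ord0 ?mulr0 // bernoulli_sum; case: r => [|r]; rewrite ?mulr0.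
Qed.

Lemma bernoulli0 : bernoulli 0 = 1.
Proof. by have := bernoulli_sum 0; rewrite big_ord1 mul1r. Qed.

Lemma bernoulli1 : bernoulli 1 = - 2%:R^-1.
Proof.
have /eqP := bernoulli_sum 1; rewrite !big_ord_recl big_ord0 bernoulli0 /= addr0 mulr1.
rewrite addrC addr_eq0 => /eqP b1; by apply: (@mulfI _ 2%:R) => //; apply: etrans b1 _; rewrite mulrN mulfV.
Qed.

Section Shift.
Variable A : ratAlgType.
Implicit Types (L : A) (X : fps A).

(** The logarithm of (1 - z e^(x eps))/(1 - z), that is Li_1(z) - Li_1(z e^(x eps)) expanded in
    [eps]: the transcendental constant term cancels and only rational polylogarithms remain. *)
Definition lshift_poly L : fps {poly A} := fun n =>
  if n is m.+1 then - ((ratA n`!%:R^-1 * Li m L)%:P * 'X^n) else 0.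

Lemma coef_diag_poly c n i :
  (diag_poly c n : {poly A})`_i = if n is 0 then 0 else
    - \sum_(k < n.+3 | (2 * k + i == n + 2)%N) c k i.
Proof.
case: n => [|n]; first by rewrite coef0.
rewrite /diag_poly coefN coef_sum [in RHS]big_mkcond /=; congr (- _).
apply: eq_bigr => k _; rewrite coef_sum; case: ifP => [/eqP kiE|kiF].
  have lti : (i < n.+4)%N by lia.
  rewrite (bigD1 (Ordinal lti)) /= ?kiE // coefCM coefXn eqxx mulr1 big1 ?addr0 //.
  move=> l /andP[_ ne_li]; rewrite coefCM coefXn; case: eqP => [il|_]; last by rewrite mulr0.
  by case/eqP: ne_li; apply: val_inj.
rewrite big1 // => l klE; rewrite coefCM coefXn; case: eqP => [il|_]; last by rewrite mulr0.
by rewrite il klE in kiF.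
Qed.

Lemma coef_diag_poly_even c n i r : (0 < n)%N -> (2 * r + i = n + 2)%N ->
  (diag_poly c n : {poly A})`_i = - c r i.
Proof.
case: n => // n _ rE; rewrite coef_diag_poly; congr (- _).
have ltr : (r < n.+4)%N by lia.
rewrite (bigD1 (Ordinal ltr)) /= ?rE // big1 ?addr0 // => k /andP[/eqP kE ne_k].
by case/eqP: ne_k; apply: val_inj => /=; lia.
Qed.

Lemma coef_diag_poly_odd c n i : (forall r, 2 * r + i <> n + 2)%N ->
  (diag_poly c n : {poly A})`_i = 0.
Proof.
move=> odd_i; rewrite coef_diag_poly; case: n odd_i => // n odd_i.
by rewrite big1 ?oppr0 // => k /eqP /odd_i.
Qed.

Lemma coef_lpsi_poly_even L n i r : (0 < n)%N -> (2 * r + i = n + 2)%N ->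
  (lpsi_poly L n)`_i = - (ratA (bernoulli r / (i`!%:R * r`!%:R)) * Li (r + i - 2) L).
Proof. exact: coef_diag_poly_even. Qed.

Lemma coef_lpsi_poly_odd L n i : (forall r, 2 * r + i <> n + 2)%N -> (lpsi_poly L n)`_i = 0.
Proof. exact: coef_diag_poly_odd. Qed.

Lemma coef_taylor_lpsi L n i : (fext (@taylor A) (lpsi_poly L) n)`_i =
  \sum_(j < n.+1) (lpsi_poly L (n - j)%N)`_(j + i) *+ 'C(i + j, j).
Proof.
rewrite /fext coef_sum [LHS](reindex_inj rev_ord_inj) /=; apply: eq_bigr => j _.
have le_jn : (j <= n)%N by rewrite -ltnS.
by rewrite subSS subKn // /taylor coef_nderivn [(i + j)%N]addnC.
Qed.

Lemma coef_taylor_lpsi_even L n i r : (2 * r + i = n + 2)%N ->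
  (fext (@taylor A) (lpsi_poly L) n)`_i =
  - (ratA ((\sum_(j < n.+1 | (j < n)%N && (j <= r)%N)
              bernoulli (r - j) / (j`!%:R * (r - j)`!%:R)) / i`!%:R)
     * Li (r + i - 2) L).
Proof.
move=> rE; rewrite coef_taylor_lpsi [in RHS]big_mkcond /= mulr_suml rmorph_sum mulr_suml -sumrN.
apply: eq_bigr => j _; have le_jn : (j <= n)%N by rewrite -ltnS.
case: ifP => [/andP[lt_jn le_jr]|jF].
  rewrite (@coef_lpsi_poly_even _ _ _ (r - j)); [| lia | lia].
  have -> : (r - j + (j + i) - 2 = r + i - 2)%N by lia.
  rewrite mulNrn -mulrnAl -raddfMn /= -[_ *+ 'C(_, _)]mulr_natr binE [(j + i)%N]addnC.
  congr (- (ratA _ * _)); rewrite !invfM.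
  have := natr_fact_neq0 (i + j); set u := (i + j)`!%:R => u0.
  transitivity ((u / u) * (bernoulli (r - j) * ((j`!%:R)^-1 * ((r - j)`!%:R)^-1) / i`!%:R)); last by rewrite mulfV ?mul1r.
  ring.
rewrite mul0r rmorph0 mul0r oppr0.
have [lt_jn|le_nj] := ltnP j n; last first.
  by rewrite (_ : n - j = 0)%N ?coef0 ?mul0rn //; apply/eqP.
rewrite coef_lpsi_poly_odd ?mul0rn // => r' r'E.
by move/negbT: jF; rewrite lt_jn /=; lia.
Qed.

Lemma coef_taylor_lpsi_odd L n i : (forall r, 2 * r + i <> n + 2)%N ->
  (fext (@taylor A) (lpsi_poly L) n)`_i = 0.
Proof.
move=> odd_i; rewrite coef_taylor_lpsi big1 // => j _.
have le_jn : (j <= n)%N by rewrite -ltnS.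
by rewrite coef_lpsi_poly_odd ?mul0rn // => r rE; apply: (odd_i (r + j)%N); lia.
Qed.

(** Expanding at x + eps convolves B_k/k! with 1/j!. By [bernoulli_conv] this changes only the terms
    with k = 1, which form [lshift_poly]. The last two terms make up for the summands that are
    absent because the exponent of psi starts at n = 1. *)
Lemma taylor_lpsi L : fext (@taylor A) (lpsi_poly L) =
  lpsi_poly L + lshift_poly L + fpsC (L%:P * 'X) * eps
  + fpsC (L * ratA 2%:R^-1)%:P * eps ^+ 2.
Proof.
apply: fpsP => n; apply/polyP => i; rewrite !coef_fpsD !coef_fpsCM !coefD.
have -> : eps n = (n == 1)%N%:R :> {poly A} by [].
have -> : (eps ^+ 2) n = (n == 2)%N%:R :> {poly A}.
  rewrite -[eps ^+ 2]mulr1 coef_epsXM; case: n => [|[|[|n]]] //=.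
have -> : (lshift_poly L n)`_i = if n is m.+1 then
    - (ratA n`!%:R^-1 * Li m L * (i == n)%N%:R) else 0.
  by case: n => [|n]; rewrite /= ?coef0 // coefN coefCM coefXn.
have -> : (L%:P * 'X * (n == 1)%N%:R)`_i = L * ((i == 1) && (n == 1))%N%:R.
  by case: (n == 1)%N; rewrite ?mulr1 ?mulr0 ?coef0 ?andbF ?mulr0 // coefCM coefX andbT.
have -> : ((L * ratA 2^-1)%:P * (n == 2)%N%:R)`_i = L * ratA 2^-1 * ((i == 0) && (n == 2))%N%:R.
  by case: (n == 2)%N; rewrite ?mulr1 ?mulr0 ?coef0 ?andbF ?mulr0 // coefC andbT; case: eqP; rewrite ?mulr1 ?mulr0.
have [[r rE]|odd_i] := pselect (exists r, 2 * r + i = n + 2)%N; last first.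
  have {}odd_i r : (2 * r + i <> n + 2)%N by move=> rE; apply: odd_i; exists r.
  rewrite coef_taylor_lpsi_odd // coef_lpsi_poly_odd //.
  have /negbTE -> : (i != n)%N by apply/eqP => iE; apply: (odd_i 1%N); lia.
  have /negbTE -> : ~~ ((i == 1) && (n == 1))%N.
    by apply/andP => -[/eqP iE /eqP nE]; apply: (odd_i 1%N); lia.
  have /negbTE -> : ~~ ((i == 0) && (n == 2))%N.
    by apply/andP => -[/eqP iE /eqP nE]; apply: (odd_i 2%N); lia.
  by case: n {odd_i} => [|n]; rewrite !mulr0 ?oppr0 !addr0.
rewrite (coef_taylor_lpsi_even _ rE); case: (posnP n) => [n0|n_gt0].
  rewrite n0 coef0 big1 ?mul0r ?rmorph0 ?mul0r ?oppr0; last by case=> -[|j].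
  by rewrite !andbF !mulr0 !addr0.
rewrite (coef_lpsi_poly_even _ n_gt0 rE).
(* For r < n the convolution is complete. Otherwise 2r + i = n + 2 leaves only (n, r, i) = (1, 1, 1)
   and (2, 2, 0), where the summand j = n meets the zero coefficient of the exponent. *)
have [lt_rn|le_nr] := ltnP r n.
  have -> : \sum_(j < n.+1 | (j < n)%N && (j <= r)%N) bernoulli (r - j) / (j`!%:R * (r - j)`!%:R)
    = bernoulli r / r`!%:R + (r == 1)%N%:R.
    rewrite -bernoulli_conv.
    rewrite [RHS](big_ord_widen n.+1 (fun j => bernoulli (r - j) / (j`!%:R * (r - j)`!%:R))); last first.
      by rewrite ltnS ltnW.
    by apply: eq_bigl => j; rewrite ltnS; lia.
  have -> : ((i == 0) && (n == 2) = false)%N by apply/negbTE/negP => /andP[/eqP ? /eqP ?]; lia.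
  have -> : ((i == 1) && (n == 1) = false)%N by apply/negbTE/negP => /andP[/eqP ? /eqP ?]; lia.
  have -> : (i == n)%N = (r == 1)%N by apply/eqP/eqP; lia.
  case: eqP => [r1|_].
    case: n n_gt0 rE lt_rn => // n _ rE _.
    have -> : i = n.+1 by lia.
    rewrite r1 add1n /= subSS subn1 /= !mulr0 !addr0 -opprD !mulr1 -mulrDl -rmorphD /=.
    by congr (- (ratA _ * _)); rewrite mulrDl mul1r.
  case: n {n_gt0 rE lt_rn} => [|n]; rewrite !mulr0 ?oppr0 !addr0;
   by congr (- (ratA _ * _)); rewrite invfM mulrA mulrAC.
have [[n1 r1 i1]|[n2 r2 i2]] : [/\ n = 1, r = 1 & i = 1]%N \/ [/\ n = 2, r = 2 & i = 0]%N.
- case: (ltngtP n 2) => n2; [left | exfalso | right]; last by split; lia.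
    by split; lia.
  by lia.
- rewrite n1 r1 i1 /= big_mkcond !big_ord_recl big_ord0 /= !addr0 Li0 mulr0 addr0 mulr1.
  have -> : ratA 1`!%:R^-1 = 1 :> A by rewrite invr1 rmorph1.
  by rewrite [1 * L]mul1r [L * 1]mulr1 subrK.
rewrite n2 r2 i2 /= big_mkcond !big_ord_recl big_ord0 /= Li0 !mulr0 oppr0 !addr0 mulr1.
rewrite bernoulli1.
have -> : (bump 0 0)`!%:R * (2 - bump 0 0)`!%:R = 1 :> rat by [].
by rewrite divr1 rmorphD rmorphN /= mulrDl mulNr opprD opprK mulr1 [L * _]mulrC.
Qed.

Lemma fE_0 (B : ratAlgType) (X : fps B) : fE X 0%N = 1.
Proof. exact: fexp_0. Qed.

Definition Li_eval L : fps A := fun n => ratA n`!%:R^-1 * Li n L.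

Lemma fderiv_Li_eval L : fderiv (Li_eval L) = Li_eval L + Li_eval L ^+ 2.
Proof.
pose rho : {rmorphism {poly rat} -> A} := horner_eval L \o map_poly (@ratA A).
have evE n : rho (Li_series n) = Li_eval L n.
  by rewrite /rho /Li_series /= linearZ_LR /= /horner_eval hornerZ.
apply: fpsP => n; have /(congr1 (fun f : fps _ => rho (f n))) := fderiv_Li_series.
rewrite /fderiv rmorphM rmorph_nat evE => ->; rewrite !coef_fpsD rmorphD evE.
rewrite !expr2 !coef_fpsM rmorph_sum; congr (_ + _); apply: eq_bigr => i _.
by rewrite rmorphM !evE.
Qed.

(* With y = sum_n Li_(-n)(z) (x eps)^n / n!, which solves y' = x (y + y^2), both sides
   solve the same first-order equation; y is the expansion of Li_0(z e^(x eps)). *)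
Lemma fexp_lshift L :
  fexp (lshift_poly L) = 1 + fpsC L%:P - fpsC L%:P * fE (fpsC 'X).
Proof.
pose x : fps {poly A} := fpsC 'X; pose CL : fps {poly A} := fpsC L%:P.
pose Y : fps {poly A} := fun n => (Li_eval L n)%:P * 'X^n.
have dE : fderiv (fE x) = x * fE x.
  by rewrite /fE fderiv_fexp ?mul_eps_0 // fderivM fderivC mul0r add0r fderiv_eps mulr1.
have dY : fderiv Y = x * (Y + Y ^+ 2).
  apply: fpsP => n; rewrite coef_fpsCM coef_fpsD /fderiv /Y expr2 coef_fpsM.
  have /(congr1 (fun f : fps _ => f n)) := fderiv_Li_eval L.
  rewrite /fderiv coef_fpsD expr2 coef_fpsM => dYn.
  rewrite -polyC_natr mulrA -polyCM dYn polyCD rmorph_sum /= mulrDl mulrDr exprS.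
  congr (_ + _); first by rewrite mulrCA.
  rewrite mulr_suml mulr_sumr; apply: eq_bigr => i _.
  have -> : 'X^n = 'X^i * 'X^(n - i) :> {poly A}.
    by rewrite -exprD subnKC // -ltnS.
  by rewrite polyCM; ring.
have dl : fderiv (lshift_poly L) = - (x * Y).
  apply: fpsP => n; rewrite coef_fpsN coef_fpsCM /fderiv /lshift_poly /Y /Li_eval.
  rewrite mulrN mulrA -polyC_natr -polyCM mulrCA mulr_natl ratA_factM exprS.
  by congr (- _); rewrite mulrCA.
set V := RHS; have V0 : V = (1 + CL) - CL * fE x by [].
have V_0 : V 0%N = 1.
  have -> : V 0%N = (1 + CL) 0%N - (CL * fE x) 0%N by [].
  by rewrite coef_fpsM0 fE_0 mulr1 coef_fpsD addrK.
have dV : fderiv V = - (x * Y) * V.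
  (* This is Li_0(z e^s) = L e^s / (1 + L - L e^s) with s = x eps, cleared of its denominator. The
     defect v solves a homogeneous linear equation and starts at 0. *)
  suff YV : Y * V = CL * fE x.
    rewrite mulNr -mulrA YV V0 raddfB raddfD /= fderivM fderivC dE.
    rewrite -[1](rmorph1 (@fpsC {poly A})) fderivC.
    ring.
  apply/eqP; rewrite -subr_eq0; apply/eqP; set v := _ - _.
  suff dv : fderiv v = x * (Y + 1) * v.
    apply: (fderiv_inj dv); first by rewrite raddf0 mulr0.
    have Y0 : Y 0%N = L%:P by rewrite /Y /Li_eval invr1 rmorph1 mul1r Li0 mulr1.
    have -> : v 0%N = (Y * V) 0%N - (CL * fE x) 0%N by [].
    by rewrite !coef_fpsM0 V_0 fE_0 Y0 !mulr1 subrr.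
  have -> : v = Y * V - CL * fE x by [].
  rewrite V0 raddfB /= !fderivM raddfB raddfD /= fderivM fderivC dE dY.
  rewrite -[1](rmorph1 (@fpsC {poly A})) fderivC rmorph1.
  ring.
have l0 : lshift_poly L 0%N = 0 by [].
by apply: (fderiv_inj (fderiv_fexp_eq l0 dl) dV); rewrite fexp_0 V_0.
Qed.

Definition shift_factor X L : fps A :=
  (1 + fpsC L - fpsC L * fE X) * fE (fpsC L * (X + fpsC (ratA 2%:R^-1) * eps)).

Lemma psiS_shift X L : psiS (X + eps) L = psiS X L * shift_factor X L.
Proof.
set q := fpsC L * (X + fpsC (ratA 2%:R^-1) * eps).
set l1 : fps A := fsub X (lpsi_poly L); set l2 : fps A := fsub X (lshift_poly L).
have l1_0 : l1 0%N = 0 by apply: fext_coef0.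
have l2_0 : l2 0%N = 0 by apply: fext_coef0.
have -> : psiS (X + eps) L = fexp (l1 + l2 + q * eps).
  rewrite /psiS /lpsi fsub_shift taylor_lpsi; congr fexp.
  have fsubC c : fsub X (fpsC c%:P) = fpsC c by rewrite fextC /= pevalC.
  have fsubX : fsub X (fpsC 'X) = X by rewrite fextC /= pevalX.
  rewrite !raddfD /= -addrA; congr (_ + _).
  rewrite expr2 !rmorphM /= fext_eps fsubX !fsubC /q.
  by ring.
rewrite fexpD ?mul_eps_0 ?coef_fpsD ?l1_0 ?l2_0 ?addr0 // fexpD // -mulrA; congr (_ * (_ * _)).
rewrite /l2 -fext_fexp // fexp_lshift.
by rewrite rmorphB rmorphD rmorph1 rmorphM /= fext_fE !fextC /= pevalC pevalX.
Qed.
End Shift.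

(** * Formal Gaussian integration *)

Section GaussianIntegral.
Variables (A : ratAlgType) (sigma : A).
Implicit Types (p : (polyQ A)) (f : fps (polyQ A)) (g : fps A).

(* [sigma] is the variance, that is the inverse of lambda. *)
Definition gmom i : A :=
  if odd i then 0 else ratA (i`!%:R / (2 ^ i./2 * i./2`!)%:R) * sigma ^+ i./2.

Lemma gmomSS i : gmom i.+2 = i.+1%:R * sigma * gmom i.
Proof.
rewrite /gmom /= negbK; case: ifP => odd_i; first by rewrite mulr0.
rewrite exprS -(rmorph_nat (@ratA A)) mulrCA -!mulrA [_ * (sigma * _)]mulrCA; congr (_ * _).
rewrite mulrA -rmorphM; congr (ratA _ * _).
have i2 : i.+2%:R = 2 * (i./2).+1%:R :> rat.
  by rewrite -natrM -[in LHS](odd_double_half i) odd_i add0n -doubleS -mul2n.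
rewrite !factS !natrM i2 !natrX exprS; field.
by rewrite natr_fact_neq0 expf_neq0 // -[1 + _]mulrS Num.Theory.pnatr_eq0.
Qed.

Lemma gmom0 : gmom 0 = 1.
Proof. by rewrite /gmom /= mulr1 divr1 rmorph1. Qed.

Lemma gmom1 : gmom 1 = 0. Proof. by []. Qed.

Definition gint p : A := \sum_(i < size p) p`_i * gmom i.

Lemma gintE N p : (size p <= N)%N -> gint p = \sum_(i < N) p`_i * gmom i.
Proof.
move=> le_pN; rewrite /gint (big_ord_widen _ (fun i => p`_i * gmom i) le_pN).
rewrite big_mkcond; apply: eq_bigr => i _; case: ltnP => // le_pi.
by rewrite nth_default // mul0r.
Qed.

Fact gint_is_zmod_morphism : zmod_morphism gint.
Proof.
move=> p q; set N := maxn (size p) (size q).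
rewrite !(@gintE N) ?leq_maxl ?leq_maxr //; last first.
  by rewrite (leq_trans (size_polyD _ _)) ?size_polyN.
by rewrite -sumrB; apply: eq_bigr => i _; rewrite coefB mulrBl.
Qed.
HB.instance Definition _ :=
  GRing.isZmodMorphism.Build (polyQ A) A gint gint_is_zmod_morphism.

Lemma gintCM c p : gint (c%:P * p) = c * gint p.
Proof.
rewrite (@gintE (size p)) ?mulr_sumr; last by rewrite mul_polyC size_scale_leq.
by apply: eq_bigr => i _; rewrite coefCM mulrA.
Qed.

Lemma gintC c : gint c%:P = c.
Proof.
by rewrite (@gintE 1) ?size_polyC ?leq_b1 // big_ord1 coefC gmom0 mulr1.
Qed.

(** Integration by parts against the Gaussian density; on monomials it is the moment recursion
    [gmomSS]. *)
Lemma gint_parts p : gint ('X * p) = sigma * gint p^`().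
Proof.
have mono k q : gint (q%:P * 'X^k) = q * gmom k.
  rewrite gintCM; congr (_ * _); rewrite (@gintE k.+1) ?size_polyXn //.
  rewrite (bigD1 ord_max) //= coefXn eqxx mul1r big1 ?addr0 // => i ne_ik.
  by rewrite -val_eqE /= in ne_ik; rewrite coefXn (negbTE ne_ik) mul0r.
have mono_parts k q : gint ('X * (q%:P * 'X^k)) = sigma * gint (q%:P * 'X^k)^`().
  rewrite mulrCA -exprS mono derivM derivC mul0r add0r derivXn.
  case: k => [|k]; first by rewrite gmom1 mulr0 mulr0n mulr0 raddf0 mulr0.
  by rewrite mulrnAr raddfMn /= mono gmomSS -mulr_natl; ring.
rewrite -(coefK p) poly_def mulr_sumr !raddf_sum /= mulr_sumr.
by apply: eq_bigr => i _; rewrite -mul_polyC mono_parts.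
Qed.

Definition gintS f : fps A := fun n => gint (f n).

Fact gintS_is_zmod_morphism : zmod_morphism gintS.
Proof. by move=> f g; apply: fpsP => n; rewrite /gintS coef_fpsB raddfB. Qed.
HB.instance Definition _ :=
  GRing.isZmodMorphism.Build (fps (polyQ A)) (fps A) gintS gintS_is_zmod_morphism.

Definition fconst g : fps (polyQ A) := fext (@fpsC (polyQ A) \o @polyC A) g.

HB.instance Definition _ := GRing.RMorphism.copy fconst (fext (@fpsC (polyQ A) \o @polyC A)).

Lemma coef_fconst g n : fconst g n = (g n)%:P.
Proof.
exact: coef_fext_const.
Qed.

Lemma gintSM g f : gintS (fconst g * f) = g * gintS f.
Proof.
apply: fpsP => n; rewrite /gintS !coef_fpsM raddf_sum; apply: eq_bigr => i _.
by rewrite /= coef_fconst gintCM.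
Qed.

Lemma gintS_epsX f m : gintS (f * eps ^+ m) = gintS f * eps ^+ m.
Proof.
have -> : f * eps ^+ m = fconst (eps ^+ m) * f.
  by rewrite mulrC rmorphXn /= /fconst fext_eps.
by rewrite gintSM mulrC.
Qed.

Lemma gintS_eqm N f f' : eqm N f f' -> eqm N (gintS f) (gintS f').
Proof. by move=> ff n ltn; rewrite /gintS ff. Qed.
End GaussianIntegral.

(** * Morphisms and derivations under the integral sign *)

Section CoefficientExtension.
Variables A B : ratAlgType.

(** [Phi] acts on coefficients while w stays fixed. As [Phi] takes values in series, the result is
    regrouped by powers of [eps], each coefficient remaining a polynomial in w. *)
Definition coefw (Phi : A -> fps B) (p : (polyQ A)) : fps (polyQ B) :=
  fun n => \poly_(i < size p) Phi p`_i n.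

Lemma coef_coefw (Phi : {additive A -> fps B}) p n i : (coefw Phi p n)`_i = Phi p`_i n.
Proof. by rewrite coef_poly; case: ltnP => // le_pi; rewrite nth_default ?raddf0. Qed.

Fact coefw_is_zmod_morphism (Phi : {additive A -> fps B}) : zmod_morphism (coefw Phi).
Proof.
move=> p q; apply: fpsP => n; apply/polyP => i.
by rewrite coef_fpsB coefB !coef_coefw coefB raddfB.
Qed.
HB.instance Definition _ (Phi : {additive A -> fps B}) :=
  GRing.isZmodMorphism.Build (polyQ A) (fps (polyQ B)) (coefw Phi) (coefw_is_zmod_morphism Phi).

Lemma coef_coefwM (Phi Psi : {additive A -> fps B}) p q n i :
  ((coefw Phi p * coefw Psi q) n)`_i = \sum_(j < i.+1) (Phi p`_j * Psi q`_(i - j)) n.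
Proof.
rewrite coef_fpsM coef_sum.
under eq_bigr => m _ do rewrite coefM.
rewrite exchange_big; apply: eq_bigr => j _; rewrite coef_fpsM; apply: eq_bigr => m _.
by rewrite !coef_coefw.
Qed.

Lemma coefw_derivation (h d : {additive A -> fps B}) :
  is_derivation h d -> is_derivation (coefw h) (coefw d).
Proof.
move=> derM p q; apply: fpsP => n; apply/polyP => i.
rewrite coef_fpsD coefD !coef_coefwM coef_coefw coefM raddf_sum coef_fps_sum -big_split.
by apply: eq_bigr => j _ /=; rewrite derM.
Qed.

Lemma coefwC (Phi : {additive A -> fps B}) c : coefw Phi c%:P = fconst (Phi c).
Proof.
apply: fpsP => n; apply/polyP => i; rewrite coef_coefw coef_fconst !coefC.
by case: eqP => // _; rewrite raddf0.
Qed.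

Section RMorphism.
Variable Phi : {rmorphism A -> fps B}.

Fact coefw_is_monoid_morphism : monoid_morphism (coefw Phi).
Proof.
split.
  by rewrite -[1]/(1%:P) coefwC /= !rmorph1.
move=> p q; apply: fpsP => n; apply/polyP => i.
rewrite coef_coefwM coef_coefw coefM raddf_sum coef_fps_sum.
by apply: eq_bigr => j _ /=; rewrite rmorphM.
Qed.
HB.instance Definition _ := GRing.isMonoidMorphism.Build (polyQ A) (fps (polyQ B))
  (coefw Phi) coefw_is_monoid_morphism.

Lemma coefwX : coefw Phi 'X = fpsC 'X.
Proof.
apply: fpsP => n; apply/polyP => i; rewrite coef_coefw coefX.
by case: n => [|n]; rewrite ?coefX ?coef0 /= rmorph_nat; case: (i == 1%N).
Qed.

Lemma fext_gintS sigma sigma' f : Phi sigma = fpsC sigma' ->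
  fext Phi (gintS sigma f) = gintS sigma' (fext (coefw Phi) f).
Proof.
move=> Phis; apply: fpsP => n; rewrite /gintS /fext raddf_sum; apply: eq_bigr => m _ /=.
rewrite (@gintE _ _ (size (f m)) (coefw _ _ _)) ?size_poly // rmorph_sum coef_fps_sum.
apply: eq_bigr => i _; rewrite coef_coefw rmorphM mulrC.
have -> : Phi (gmom sigma i) = fpsC (gmom sigma' i).
  rewrite /gmom; case: ifP => _; first by rewrite !rmorph0.
  by rewrite !rmorphM !rmorphXn /= Phis !rmorph_ratA.
by rewrite coef_fpsCM mulrC.
Qed.
End RMorphism.

Definition euler (f : fps (polyQ B)) : fps (polyQ B) := fun n => 'X * (f n)^`().

(** Differentiation under the integral when the variance moves too. Here u is the logarithmic
    derivative of the variance; the moment of w^i scales as sigma^(i/2) and so contributes i u / 2,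
    where the factor i is produced by [euler], the operator w d/dw. *)
Lemma fext_der_gintS (h : {rmorphism A -> fps B}) (d : {additive A -> fps B})
    sigma sigma' u f :
  is_derivation h d -> h sigma = fpsC sigma' -> d sigma = u * fpsC sigma' ->
  fext d (gintS sigma f) = gintS sigma' (fext (coefw d) f)
    + ratA 2^-1 * u * gintS sigma' (euler (fext (coefw h) f)).
Proof.
move=> derM hs ds; set v := ratA 2^-1 * u.
have hmom i : h (gmom sigma i) = fpsC (gmom sigma' i).
  rewrite /gmom; case: ifP => _; first by rewrite !rmorph0.
  by rewrite !rmorphM !rmorphXn /= hs !rmorph_ratA.
have dmom i : d (gmom sigma i) = i%:R * v * fpsC (gmom sigma' i).
  rewrite /gmom; case: ifP => odd_i; first by rewrite !raddf0 mulr0.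
  rewrite (der_ratAM derM) (der_X derM) hs ds.
  have -> : i%:R * v = (i./2)%:R * u.
    rewrite -{1}(odd_double_half i) odd_i add0n -mul2n natrM /v.
    transitivity (ratA 2%:R^-1 * 2%:R * ((i./2)%:R * u)); first by ring.
    by rewrite ratAVK mul1r.
  rewrite [fpsC (_ * _)]rmorphM /= [fpsC (_ ^+ _)]rmorphXn /= rmorph_ratA.
  case: (i./2) => [|k]; first by rewrite !mulr0n mulr0 !mul0r.
  by rewrite exprS -mulr_natr /=; ring.
have dint p : d (gint sigma p) = gintS sigma' (coefw d p)
    + v * gintS sigma' (euler (coefw h p)).
  have -> : gintS sigma' (coefw d p) = \sum_(i < size p) d p`_i * fpsC (gmom sigma' i).
    apply: fpsP => n; rewrite /gintS (@gintE _ _ (size p)) ?size_poly // coef_fps_sum.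
    by apply: eq_bigr => i _; rewrite coef_coefw [d _ * _]mulrC coef_fpsCM mulrC.
  have -> : gintS sigma' (euler (coefw h p)) =
      \sum_(i < size p) i%:R * (h p`_i * fpsC (gmom sigma' i)).
    apply: fpsP => n; rewrite /gintS (@gintE _ _ (size p)).
      rewrite coef_fps_sum; apply: eq_bigr => i _; rewrite /euler coefXM coef_deriv.
      rewrite [h _ * _]mulrC -(rmorph_nat (@fpsC B)) !coef_fpsCM.
      case: (nat_of_ord i) => [|k]; first by rewrite !mul0r.
      by rewrite coef_coefw /= !mulrnAl mul1r [gmom _ _ * _]mulrC.
    have le_p : (size (coefw h p n) <= size p)%N by apply: size_poly.
    rewrite /euler; have [->|nz] := eqVneq (coefw h p n) 0.
      by rewrite deriv0 mulr0 size_poly0.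
    by rewrite (leq_trans (size_polyMleq _ _)) // size_polyX (leq_trans (lt_size_deriv nz)).
  rewrite mulr_sumr -big_split /= {1}/gint raddf_sum; apply: eq_bigr => i _.
  by rewrite derM dmom hmom; ring.
have -> : fext d (gintS sigma f) = fext (d \o gint sigma) f by [].
have -> : fext (d \o gint sigma) f =
    fext (fun p => gintS sigma' (coefw d p) + v * gintS sigma' (euler (coefw h p))) f.
  by apply: eq_fext => p; apply: dint.
apply: eqmP => N; apply: eqm_trans (fext_expand _ _) _.
under [X in eqm _ X _]eq_bigr => m _ do rewrite mulrDl -mulrA.
rewrite big_split /= -mulr_sumr.
apply: eqmD.
  apply: eqm_sym; apply: eqm_trans (gintS_eqm _ (fext_expand _ _)) _.
  by rewrite raddf_sum; under [X in eqm _ X _]eq_bigr => m _ do rewrite /= gintS_epsX.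
have eulerD g g' : euler (g + g') = euler g + euler g'.
  by apply: fpsP => n; rewrite /euler coef_fpsD derivD mulrDr.
have euler0 : euler 0 = 0 by apply: fpsP => n; rewrite /euler deriv0 mulr0.
have eulerX g m : euler (g * eps ^+ m) = euler g * eps ^+ m.
  apply: fpsP => n; rewrite /euler ![_ * eps ^+ m]mulrC !coef_epsXM.
  by case: ifP; rewrite ?deriv0 ?mulr0.
have euler_eqm g g' : eqm N g g' -> eqm N (euler g) (euler g').
  by move=> gg n ltn; rewrite /euler gg.
apply: eqmM => //; apply: eqm_sym.
apply: eqm_trans (gintS_eqm _ (euler_eqm _ _ (fext_expand _ _))) _.
rewrite (big_morph _ eulerD euler0) raddf_sum.
by under [X in eqm _ X _]eq_bigr => m _ do rewrite eulerX /= gintS_epsX.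
Qed.
End CoefficientExtension.

Lemma der_peval (A B C : comNzRingType) (Phi : {rmorphism A -> fps B}) X
    (h : {rmorphism fps B -> fps C}) (d : {additive fps B -> fps C}) p :
  is_derivation h d -> (forall c, d (Phi c) = 0) ->
  d (peval Phi X p) = h (peval Phi X p^`()) * d X.
Proof.
move=> derM dPhi; elim/poly_ind: p => [|p c IHp]; first by rewrite deriv0 !rmorph0 mul0r raddf0.
rewrite derivD derivM derivX derivC addr0 mulr1 !rmorphD !rmorphM /= pevalX pevalC.
by rewrite raddfD /= dPhi addr0 derM IHp; ring.
Qed.

Section Constants.
Variable A : ratAlgType.

Definition wC (c : A) : fps (polyQ A) := fpsC (c%:P : polyQ A).
Definition wX : fps (polyQ A) := fpsC ('X : polyQ A).

HB.instance Definition _ := GRing.RMorphism.copy wC (@fpsC (polyQ A) \o @polyC A).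
End Constants.
Arguments wX {A}.

(** * Translation of the Gaussian variable *)

Section GaussianShift.
Variables (A : ratAlgType) (sigma delta kappa : A).
Hypothesis sigmaK : delta * sigma = 1.
Implicit Types (p : (polyQ A)) (f : fps (polyQ A)).

Definition wshift : (polyQ A) -> fps (polyQ A) :=
  peval (@wC A) (wX + wC kappa * eps).
HB.instance Definition _ := GRing.RMorphism.copy wshift
  (peval (@wC A) (wX + wC kappa * eps)).

(* exp(- delta (kappa w eps + kappa^2 eps^2 / 2)): the density of variance 1/delta at
   w + kappa eps divided by the density at w. *)
Definition gauss_weight : fps (polyQ A) :=
  fE (- (wC (delta * kappa) * (wX + wC (kappa * ratA 2%:R^-1) * eps))).

Definition wderiv f : fps (polyQ A) := fun n => (f n)^`().

Fact wderiv_is_zmod_morphism : zmod_morphism wderiv.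
Proof. by move=> f g; apply: fpsP => n; rewrite /wderiv coef_fpsB derivB. Qed.
HB.instance Definition _ := GRing.isZmodMorphism.Build (fps (polyQ A)) (fps (polyQ A))
  wderiv wderiv_is_zmod_morphism.

Lemma wderivM f g : wderiv (f * g) = wderiv f * g + f * wderiv g.
Proof.
apply: fpsP => n; rewrite /wderiv coef_fpsD !coef_fpsM raddf_sum -big_split.
by apply: eq_bigr => i _ /=; rewrite derivM.
Qed.

Lemma wderiv_wC (c : A) : wderiv (wC c) = 0.
Proof. by apply: fpsP => -[|n]; rewrite /wderiv /wC /= ?deriv0 // derivC. Qed.

Lemma wderiv_wX : wderiv wX = 1.
Proof. by apply: fpsP => -[|n]; rewrite /wderiv /wX /= ?deriv0 // derivX. Qed.

Lemma fderiv_wC (c : A) : fderiv (wC c) = 0. Proof. exact: fderivC. Qed.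
Lemma fderiv_wX : fderiv wX = 0 :> fps (polyQ A). Proof. exact: fderivC. Qed.

Lemma wderiv_eps : wderiv eps = 0.
Proof. by apply: fpsP => n; rewrite /wderiv /eps /= -polyC_natr derivC. Qed.

Lemma wshift_0 p : wshift p 0%N = p.
Proof.
elim/poly_ind: p => [|p c IHp]; first by rewrite rmorph0.
rewrite rmorphD rmorphM /= coef_fpsD coef_fpsM0 IHp /wshift pevalX pevalC.
by rewrite coef_fpsD coef_fpsCM mulr0 addr0.
Qed.

Lemma fderiv_wshift p : fderiv (wshift p) = wC kappa * wshift p^`().
Proof.
rewrite /wshift (@der_peval _ _ _ _ _ idfun); [| exact: fderivM | by move=> c; apply: fderivC].
by do 6!rewrite ?(fderivM, fderiv_eps, raddfN, raddfD, fderiv_wC, fderiv_wX) /=; ring.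
Qed.

(* The eps-derivative of the integrand is kappa (d/dw - delta w) applied to it, which
   integrates to 0 by parts. *)
Lemma gint_shift p : gintS sigma (wshift p * gauss_weight) = fpsC (gint sigma p).
Proof.
set q := wC (delta * kappa) * (wX + wC (kappa * ratA 2%:R^-1) * eps).
have dG : fderiv gauss_weight
    = - (wC (delta * kappa) * (wX + wC kappa * eps)) * gauss_weight.
  apply: fderiv_fexp_eq; first exact: mul_eps_0.
  do 6!rewrite ?(fderivM, fderiv_eps, raddfN, raddfD, fderiv_wC, fderiv_wX) /=.
  have -> : wC kappa = wC (kappa * ratA 2%:R^-1) + wC (kappa * ratA 2%:R^-1).
    by rewrite -raddfD -mulrDr -rmorphD (_ : 2%:R^-1 + 2%:R^-1 = 1 :> rat) // rmorph1 mulr1.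
  by ring.
have wG : wderiv gauss_weight = - (wC (delta * kappa) * eps) * gauss_weight.
  rewrite /gauss_weight /fE (@der_fexp _ _ idfun) ?mul_eps_0 //; last first.
  - exact: wderivM.
  - by move=> N f g fg n ltn; rewrite /= /wderiv fg // leqW.
  congr (_ * _); do 6!rewrite ?(wderivM, wderiv_eps, raddfN, raddfD, wderiv_wC, wderiv_wX) /=.
  by ring.
have dT := fderiv_wshift p.
have wT : wderiv (wshift p) = wshift p^`().
  rewrite /wshift (@der_peval _ _ _ _ _ idfun); [| exact: wderivM | exact: wderiv_wC].
  by do 6!rewrite ?(wderivM, wderiv_eps, raddfN, raddfD, wderiv_wC, wderiv_wX) /=; ring.
set g := wshift p * gauss_weight.
have dg : fderiv g = wC kappa * (wderiv g - wC delta * (wX * g)).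
  by rewrite /g fderivM wderivM dT wT dG wG [wC (delta * _)]rmorphM /=; ring.
apply: fpsP => -[|n].
  by rewrite /gintS /g coef_fpsM0 /gauss_weight fE_0 mulr1 wshift_0.
apply: (@natrA_eq0 _ n); rewrite /gintS mulr_natl -raddfMn /= -mulr_natl.
have -> : n.+1%:R * g n.+1 = fderiv g n by [].
rewrite dg coef_fpsCM coef_fpsB !coef_fpsCM gintCM raddfB /= gintCM gint_parts.
by rewrite mulrA sigmaK mul1r subrr mulr0.
Qed.

Lemma gintS_shift f : gintS sigma (fext wshift f * gauss_weight) = gintS sigma f.
Proof.
apply: eqmP => N.
apply: eqm_trans (gintS_eqm _ (eqmM (fext_expand _ _) (@eqm_refl _ _ _))) _.
rewrite mulr_suml raddf_sum /=; under [X in eqm _ X _]eq_bigr => m _.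
  rewrite mulrAC gintS_epsX gint_shift.
  over.
by apply: eqm_sym; apply: fps_expand.
Qed.
End GaussianShift.

(** * The pentagon data and the difference equations of the integral *)

(* [pa] and [pb] are Li_0(z1) and Li_0(z2). Then [pL0], [pLA], [pLC] below are Li_0 at z0,
   z1/z0, z2/z0, while [pdelta] is delta, [pcx] is z2/z0 and [pcy] is z1/z0. These make
   sense over a ring as soon as a, b and a + b + ab are invertible. *)
Record pentagon (A : comNzRingType) := Pentagon {
  pa : A; pb : A; pai : A; pbi : A; pL0i : A;
  paK : pa * pai = 1;
  pbK : pb * pbi = 1;
  pL0K : (pa + pb + pa * pb) * pL0i = 1
}.

Section PentagonDefs.
Variables (A : comNzRingType) (d : pentagon A).
Local Notation a := (pa d).
Local Notation b := (pb d).

Definition pL0 := a + b + a * b.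
Definition pLA := a * (1 + b) * pbi d.
Definition pLC := b * (1 + a) * pai d.
Definition pdelta := pL0 ^+ 2 * (pai d * pbi d).
Definition psigma := a * b * pL0i d ^+ 2.
Definition pcx := b * (1 + a) * pL0i d.
Definition pcy := a * (1 + b) * pL0i d.

Lemma pdeltaK : pdelta * psigma = 1.
Proof.
transitivity ((a * pai d) * (b * pbi d) * ((a + b + a * b) * pL0i d) ^+ 2).
  by rewrite /pdelta /psigma /pL0; ring.
by rewrite paK pbK pL0K !mul1r expr1n.
Qed.

Lemma pLAC : pLA * pLC = 1 + pL0.
Proof.
transitivity ((1 + a) * (1 + b) * (a * pai d) * (b * pbi d)).
  by rewrite /pLA /pLC; ring.
by rewrite paK pbK !mulr1 /pL0; ring.
Qed.

Lemma p1LA : 1 + pLA = pL0 * pbi d.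
Proof. rewrite -(pbK d) /pLA /pL0; ring. Qed.

Lemma p1LC : 1 + pLC = pL0 * pai d.
Proof. rewrite -(paK d) /pLC /pL0; ring. Qed.

Lemma pcxB : pcx - 1 = - (a * pL0i d).
Proof. rewrite -(pL0K d) /pcx; ring. Qed.

Lemma pdelta_kappa : pdelta * (pcx - 1) = - (pL0 * pbi d).
Proof.
transitivity (- (pL0 * pbi d * (a * pai d) * ((a + b + a * b) * pL0i d))).
  by rewrite pcxB /pdelta /pL0; ring.
by rewrite paK pL0K !mulr1.
Qed.

Lemma pLA_cx : pcx * (1 + pLA) = 1 + a.
Proof.
transitivity ((1 + a) * (b * pbi d) * ((a + b + a * b) * pL0i d)).
  by rewrite p1LA /pcx /pL0; ring.
by rewrite pbK pL0K !mulr1.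
Qed.

Lemma pLA_cy : pcy * (1 + pLA) = pLA.
Proof.
transitivity (pLA * ((a + b + a * b) * pL0i d)).
  by rewrite p1LA /pcy /pLA /pL0; ring.
by rewrite pL0K mulr1.
Qed.

(** In this form delta balances the exponents linear in w that appear when w moves by [eps]; see
    [pentagon_key_exponent]. *)
Lemma pdelta_sum : pdelta = 2%:R + pLA + pL0 + pLC.
Proof.
transitivity ((1 + pLA) * (1 + pLC)); first by rewrite p1LA p1LC /pdelta; ring.
transitivity (1 + pLA + pLC + pLA * pLC); first by ring.
by rewrite pLAC; ring.
Qed.

Lemma pLC_1LA : pLC * (1 + pLA) = (1 + a) * (1 + pLC).
Proof.
transitivity (pLC + pLA * pLC); first by ring.
rewrite pLAC; transitivity (1 + a + pLC + b * (1 + a) * (a * pai d)).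
  by rewrite paK /pL0; ring.
by rewrite /pLC; ring.
Qed.

Lemma pdelta_cx : pcx * pdelta = 1 + pL0 + pLC.
Proof.
transitivity (pcx * (1 + pLA) * (1 + pLC)).
  by rewrite p1LA p1LC /pdelta; ring.
rewrite pLA_cx -pLC_1LA; transitivity (pLC + pLA * pLC); first by ring.
by rewrite pLAC; ring.
Qed.

Lemma pdelta_cy : pcy * pdelta = 1 + pL0 + pLA.
Proof.
transitivity (pcy * (1 + pLA) * (1 + pLC)).
  by rewrite p1LA p1LC /pdelta; ring.
rewrite pLA_cy; transitivity (pLA + pLA * pLC); first by ring.
by rewrite pLAC; ring.
Qed.

Lemma pL0i_1LC : a * pL0i d * (1 + pLC) = 1.
Proof.
transitivity ((a * pai d) * ((a + b + a * b) * pL0i d)).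
  by rewrite p1LC /pL0; ring.
by rewrite paK pL0K mulr1.
Qed.

Lemma pL0i_L0 : a * pL0i d * pL0 = a.
Proof. by rewrite -mulrA [_ * pL0]mulrC pL0K mulr1. Qed.

Lemma pL0i_LC_1LA : a * pL0i d * ((1 + pLA) * pLC) = 1 + a.
Proof.
transitivity (a * pL0i d * (1 + pLC) * (1 + a)); last by rewrite pL0i_1LC mul1r.
by rewrite [(1 + pLA) * _]mulrC pLC_1LA; ring.
Qed.
End PentagonDefs.

(** To be read with u, v, e the exponentials of x eps, y eps and XB eps, where XB is the argument of
    the middle psi, primes denoting inverses, and m = 1/(1 + LC). The last parenthesis is a
    combination that integrates to 0 by [pI_key]. *)
Lemma pentagon_exp_identity (S : comNzRingType) (a m LA L0 LC u v v' e e' : S) :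
  e * e' = 1 -> v * v' = 1 -> LA * LC = 1 + L0 -> m * (1 + LC) = 1 ->
  m * ((1 + LA) * LC) = 1 + a -> m * L0 = a ->
  (1 + LA - LA * (u * e')) * (e * v') =
  1 + a - a * u + m * v' * ((1 + LA - LA * (u * e')) * (1 + LC - LC * (v * e')) * e
                            - (1 + L0 - L0 * e) * (u * v * e')).
Proof.
move=> ee vv LAC mLC mLAC mL0.
transitivity ((1 + LA) * e * v' - LA * u * v' * (e * e')); first by ring.
transitivity (1 + a - a * u + (m * (1 + LC) * ((1 + LA) * e * v')
  - m * ((1 + LA) * LC) * (v * v') * (e * e') - m * (1 + LC) * LA * u * v' * (e * e')
  + m * u * (v * v') * e' * (LA * LC * (e * e') - (1 + L0))
  + m * L0 * u * (v * v') * (e * e'))); last by ring.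
rewrite ee vv LAC mLC mLAC mL0; ring.
Qed.

(** The symmetry exchanging z1 and z2, by which statements about y follow from those about x. It is
    transparent so that its projections compute. *)
Definition swap_pentagon (A : comNzRingType) (d : pentagon A) : pentagon A.
Proof.
apply: (@Pentagon _ (pb d) (pa d) (pbi d) (pai d) (pL0i d) (pbK d) (paK d)).
by rewrite [_ * pa d]mulrC [pb d + _]addrC pL0K.
Defined.

Section PentagonSwap.
Variables (A : comNzRingType) (d : pentagon A).

Lemma swap_L0 : pL0 (swap_pentagon d) = pL0 d. Proof. by rewrite /pL0 /=; ring. Qed.
Lemma swap_LA : pLA (swap_pentagon d) = pLC d. Proof. by []. Qed.
Lemma swap_LC : pLC (swap_pentagon d) = pLA d. Proof. by []. Qed.
Lemma swap_cx : pcx (swap_pentagon d) = pcy d. Proof. by []. Qed.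
Lemma swap_cy : pcy (swap_pentagon d) = pcx d. Proof. by []. Qed.
Lemma swap_sigma : psigma (swap_pentagon d) = psigma d. Proof. by rewrite /psigma /=; ring. Qed.
End PentagonSwap.

(** Compares the exponents in [pI_key], with h = 1/2 and e = eps. The four relations are hypotheses
    on atoms, so that [ring] never sees the ring of series. *)
Lemma pentagon_key_exponent (S : comNzRingType) (LA L0 LC dl cx cy h e W X Y : S) :
  h + h = 1 -> dl = 2%:R + LA + L0 + LC -> cx * dl = 1 + L0 + LC -> cy * dl = 1 + L0 + LA ->
  L0 * (W + X + Y - (cx * X + cy * Y) + h * e) + (W + X + Y - (cx * X + cy * Y) + e)
    - dl * (W + h * e) =
  LA * (- W - Y + (cx * X + cy * Y) - e + h * e)
  + LC * (- W - X + (cx * X + cy * Y) - e + h * e)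
  + (X + Y - (W + X + Y - (cx * X + cy * Y))).
Proof.
move=> hh dlE cxE cyE; apply/eqP; rewrite -subr_eq0; apply/eqP.
transitivity (X * (1 + L0 + LC - cx * dl) + Y * (1 + L0 + LA - cy * dl)
              + e * (1 - (h + h)) * (1 + LA + LC)); first by rewrite dlE; ring.
by rewrite cxE cyE hh; ring.
Qed.

Lemma pentagon_key_product (S : comNzRingType)
    (A B C FB E' tA tB tC tFA tFC tE G uA uB uC : S) :
  A = tA * (tFA * uA) -> tB = B * (FB * uB) -> C = tC * (tFC * uC) ->
  uB * tE * G = uA * uC * E' ->
  tA * tB * tC * (tFA * tFC * tE) * G = A * B * C * (FB * E').
Proof.
move=> -> -> -> uE; transitivity (tA * B * tC * tFA * tFC * FB * (uB * tE * G)).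
  by ring.
by rewrite uE; ring.
Qed.

Lemma pentagon_shift_exponent (S : comNzRingType) (LA a cx cy dk kh h e W X Y : S) :
  dk = - (1 + LA) -> kh = (cx - 1) * h -> cx * (1 + LA) = 1 + a -> cy * (1 + LA) = LA ->
  LA * (- W - Y + (cx * X + cy * Y) + h * e) - dk * (W + kh * e) =
  - (- W - X + (cx * X + cy * Y)) + a * (X + h * e).
Proof.
move=> dkE khE cxE cyE; apply/eqP; rewrite -subr_eq0; apply/eqP.
transitivity ((X + h * e) * (cx * (1 + LA) - (1 + a)) + Y * (cy * (1 + LA) - LA)).
  by rewrite dkE khE; ring.
by rewrite cxE cyE; ring.
Qed.

Lemma pentagon_shift_product (S : comNzRingType) (A B C FA tA tB tC G uA E E1 : S) :
  tA = A * (FA * uA) -> tB = B -> tC = C -> uA * G = E * E1 ->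
  tA * tB * tC * G = E1 * (A * B * C * (FA * E)).
Proof.
move=> -> -> -> uE; transitivity (A * B * C * FA * (uA * G)); first by ring.
by rewrite uE; ring.
Qed.

Lemma rmorph_prod3 (R S : comNzRingType) (h : {rmorphism R -> S}) a b c :
  h (a * b * c) = h a * h b * h c.
Proof. by rewrite !rmorphM. Qed.

Lemma rmorph_prod6 (R S : comNzRingType) (h : {rmorphism R -> S}) a b c e f g :
  h (a * b * c * (e * f * g)) = h a * h b * h c * (h e * h f * h g).
Proof. by rewrite !rmorphM. Qed.

Section PentagonIntegral.
Variables (A : ratAlgType) (d : pentagon A).
Implicit Types (X Y : fps A) (Z : fps (polyQ A)) (c L kappa : A).
Local Notation K := (@wC A).

Definition psiP Z L : fps (polyQ A) := psiS Z (L%:P : polyQ A).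

Definition psiP_factor Z L : fps (polyQ A) := 1 + K L - K L * fE Z.

Definition pc X Y : fps (polyQ A) := K (pcx d) * fconst X + K (pcy d) * fconst Y.
Definition pXA X Y : fps (polyQ A) := - wX - fconst Y + pc X Y.
Definition pXB X Y : fps (polyQ A) := wX + fconst X + fconst Y - pc X Y.
Definition pXC X Y : fps (polyQ A) := - wX - fconst X + pc X Y.

Definition pI X Y : fps (polyQ A) :=
  psiP (pXA X Y) (pLA d) * psiP (pXB X Y) (pL0 d) * psiP (pXC X Y) (pLC d).

Definition pR X Y : fps A := gintS (psigma d) (pI X Y).

Lemma fconst_eps : fconst eps = eps :> fps (polyQ A).
Proof. by rewrite /fconst fext_eps. Qed.

Lemma fconstM X Y : fconst (X * Y) = fconst X * fconst Y. Proof. exact: rmorphM. Qed.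
Lemma fconstD X Y : fconst (X + Y) = fconst X + fconst Y. Proof. exact: rmorphD. Qed.
Lemma fconstB X Y : fconst (X - Y) = fconst X - fconst Y. Proof. exact: rmorphB. Qed.
Lemma fconstN X : fconst (- X) = - fconst X. Proof. exact: rmorphN. Qed.
Lemma fconst_fE X : fconst (fE X) = fE (fconst X). Proof. exact: fext_fE. Qed.
Lemma fconstC c : fconst (fpsC c) = K c.
Proof. by rewrite /fconst fextC. Qed.

Lemma wC_half : K (ratA 2%:R^-1) + K (ratA 2%:R^-1) = 1.
Proof. by rewrite -raddfD -rmorphD (_ : 2%:R^-1 + 2%:R^-1 = 1 :> rat) // rmorph1 /= rmorph1. Qed.

Lemma psiP_shift Z L : psiP (Z + eps) L =
  psiP Z L * (psiP_factor Z L * fE (K L * (Z + K (ratA 2%:R^-1) * eps))).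
Proof. exact: psiS_shift. Qed.

Lemma pXA_shift X Y : pXA (X + eps) Y = pXA X Y + K (pcx d) * eps.
Proof. by rewrite /pXA /pc rmorphD /= fconst_eps; ring. Qed.
Lemma pXB_shift X Y : pXB (X + eps) Y = pXB X Y + (1 - K (pcx d)) * eps.
Proof. by rewrite /pXB /pc rmorphD /= fconst_eps; ring. Qed.
Lemma pXC_shift X Y : pXC (X + eps) Y = pXC X Y + (K (pcx d) - 1) * eps.
Proof. by rewrite /pXC /pc rmorphD /= fconst_eps; ring. Qed.

Section Wshift.
Variable kappa : A.
Local Notation tau := (fext (wshift kappa)).

Lemma wshift_mul Z Z' : tau (Z * Z') = tau Z * tau Z'.
Proof. exact: rmorphM. Qed.
Lemma wshift_fconst X : tau (fconst X) = fconst X.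
Proof.
rewrite /fconst fext_comp; apply: eq_fext => c /=.
by rewrite fextC; apply: pevalC.
Qed.
Lemma wshift_wC c : tau (K c) = K c.
Proof. by rewrite -fconstC wshift_fconst. Qed.
Lemma wshift_wX : tau wX = wX + K kappa * eps.
Proof. by rewrite fextC; apply: pevalX. Qed.
Lemma wshift_pc X Y : tau (pc X Y) = pc X Y.
Proof. by rewrite /pc rmorphD /= !wshift_mul !wshift_fconst !wshift_wC. Qed.
Lemma wshift_psiP Z L : tau (psiP Z L) = psiP (tau Z) L.
Proof. by apply: fext_psiS; apply: pevalC. Qed.
Lemma wshift_factor Z L : tau (psiP_factor Z L) = psiP_factor (tau Z) L.
Proof.
by rewrite /psiP_factor rmorphB rmorphD rmorph1 /= wshift_mul wshift_wC fext_fE.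
Qed.
Lemma wshift_pXA X Y : tau (pXA X Y) = pXA X Y - K kappa * eps.
Proof.
by rewrite /pXA rmorphD rmorphB rmorphN /= wshift_fconst wshift_pc wshift_wX; ring.
Qed.
Lemma wshift_pXB X Y : tau (pXB X Y) = pXB X Y + K kappa * eps.
Proof.
by rewrite /pXB rmorphB rmorphD rmorphD /= !wshift_fconst wshift_pc wshift_wX; ring.
Qed.
Lemma wshift_pXC X Y : tau (pXC X Y) = pXC X Y - K kappa * eps.
Proof.
by rewrite /pXC rmorphD rmorphB rmorphN /= wshift_fconst wshift_pc wshift_wX; ring.
Qed.
End Wshift.

Lemma psiP_unshift Z L : psiP Z L = psiP (Z - eps) L *
  (psiP_factor (Z - eps) L * fE (K L * (Z - eps + K (ratA 2%:R^-1) * eps))).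
Proof. by rewrite -psiP_shift subrK. Qed.

(* The second integrand is the first one with w translated by eps, up to the quotient of
   the Gaussian densities. *)
Lemma pI_key X Y :
  gintS (psigma d) (pI X Y * (psiP_factor (pXA X Y) (pLA d)
    * psiP_factor (pXC X Y) (pLC d) * fE (pXB X Y)))
  = gintS (psigma d) (pI X Y * (psiP_factor (pXB X Y) (pL0 d)
    * fE (fconst X + fconst Y - pXB X Y))).
Proof.
rewrite -[LHS](gintS_shift 1 (pdeltaK d)); congr gintS.
pose tau (Z : fps (polyQ A)) := fext (wshift (1 : A)) Z.
have tauA : psiP (pXA X Y) (pLA d) = tau (psiP (pXA X Y) (pLA d)) *
    (tau (psiP_factor (pXA X Y) (pLA d)) *
     fE (K (pLA d) * (pXA X Y - eps + K (ratA 2%:R^-1) * eps))).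
  by rewrite /tau wshift_psiP wshift_factor wshift_pXA rmorph1 mul1r; apply: psiP_unshift.
have tauC : psiP (pXC X Y) (pLC d) = tau (psiP (pXC X Y) (pLC d)) *
    (tau (psiP_factor (pXC X Y) (pLC d)) *
     fE (K (pLC d) * (pXC X Y - eps + K (ratA 2%:R^-1) * eps))).
  by rewrite /tau wshift_psiP wshift_factor wshift_pXC rmorph1 mul1r; apply: psiP_unshift.
have tauB : tau (psiP (pXB X Y) (pL0 d)) = psiP (pXB X Y) (pL0 d) *
    (psiP_factor (pXB X Y) (pL0 d) *
     fE (K (pL0 d) * (pXB X Y + K (ratA 2%:R^-1) * eps))).
  by rewrite /tau wshift_psiP wshift_pXB rmorph1 mul1r; apply: psiP_shift.
have tauE : fE (K (pL0 d) * (pXB X Y + K (ratA 2%:R^-1) * eps)) * tau (fE (pXB X Y))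
      * gauss_weight (pdelta d) 1 =
    fE (K (pLA d) * (pXA X Y - eps + K (ratA 2%:R^-1) * eps)) *
    fE (K (pLC d) * (pXC X Y - eps + K (ratA 2%:R^-1) * eps)) *
    fE (fconst X + fconst Y - pXB X Y).
  rewrite /tau fext_fE wshift_pXB rmorph1 mul1r /gauss_weight !mulr1 mul1r.
  apply: fE_eq3.
  rewrite /pXA /pXB /pXC /pc; apply: pentagon_key_exponent.
  - exact: wC_half.
  - by rewrite pdelta_sum rmorphD rmorphD rmorphD rmorph_nat.
  - by rewrite -rmorphM pdelta_cx rmorphD rmorphD rmorph1.
  - by rewrite -rmorphM pdelta_cy rmorphD rmorphD rmorph1.
apply: etrans (congr1 (fun Z => Z * gauss_weight (pdelta d) 1)
  (rmorph_prod6 (fext (wshift (1 : A))) _ _ _ _ _ _)) _.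
exact: (pentagon_key_product tauA tauB tauC tauE).
Qed.

Lemma fE_pXA X Y : fE (pXA X Y) = fE (fconst X) * fE (- pXB X Y).
Proof. by rewrite -fE_D; congr fE; rewrite /pXA /pXB; ring. Qed.

Lemma fE_pXC X Y : fE (pXC X Y) = fE (fconst Y) * fE (- pXB X Y).
Proof. by rewrite -fE_D; congr fE; rewrite /pXC /pXB; ring. Qed.

Lemma fE_NpXC X Y : fE (- pXC X Y) = fE (pXB X Y) * fE (- fconst Y).
Proof. by rewrite -fE_D; congr fE; rewrite /pXC /pXB; ring. Qed.

Lemma fconst_factor L X : fconst (1 + fpsC L - fpsC L * fE X) = psiP_factor (fconst X) L.
Proof. by rewrite fconstB fconstD fconstM fconstC fconst_fE rmorph1. Qed.

Lemma fconst_CE c X : fconst (fpsC c * fE X) = K c * fE (fconst X).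
Proof. by rewrite fconstM fconstC fconst_fE. Qed.

(** The left side is what a step in x inserts in the integrand. The right side splits it into a
    factor free of w, the one expected from psi(x, z1), and a multiple of the difference whose
    integral [pI_key] shows to be 0. *)
Lemma psiP_bracket X Y : psiP_factor (pXA X Y) (pLA d) * fE (- pXC X Y)
  = fconst (1 + fpsC (pa d) - fpsC (pa d) * fE X)
  + fconst (fpsC (pa d * pL0i d) * fE (- Y)) *
    (psiP_factor (pXA X Y) (pLA d) * psiP_factor (pXC X Y) (pLC d) * fE (pXB X Y)
     - psiP_factor (pXB X Y) (pL0 d) * fE (fconst X + fconst Y - pXB X Y)).
Proof.
rewrite fconst_factor fconst_CE fE_NpXC fE_D3 fconstN /psiP_factor fE_pXA fE_pXC.
have fENK Z : fE Z * fE (- Z) = 1 by rewrite -[LHS]fE_D subrr fE0.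
apply: pentagon_exp_identity; [exact: fENK | exact: fENK | | | |].
- by rewrite -(rmorphM K) pLAC rmorphD rmorph1.
- by rewrite -(rmorph1 K) -(rmorphD K) -(rmorphM K) pL0i_1LC.
- by rewrite -(rmorph1 K) -!(rmorphD K) -!(rmorphM K) pL0i_LC_1LA.
- by rewrite -(rmorphM K) pL0i_L0.
Qed.

Lemma gintS_mulB s X (Z Z1 Z2 : fps (polyQ A)) :
  gintS s (Z * Z1) = gintS s (Z * Z2) -> gintS s (Z * (fconst X * (Z1 - Z2))) = 0.
Proof.
move=> eqZ; rewrite mulrCA gintSM mulrBr raddfB /= eqZ subrr; exact: mulr0.
Qed.

Lemma pR_shift X Y : pR (X + eps) Y = shift_factor X (pa d) * pR X Y.
Proof.
(* This translation of w undoes the effect of x + eps on the last two arguments, so only the first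
   psi moves, by exactly [eps]. *)
pose kappa := pcx d - 1.
pose tau (Z : fps (polyQ A)) := fext (wshift kappa) Z.
have Kk : K kappa = K (pcx d) - 1 by rewrite rmorphB rmorph1.
have tauA : tau (psiP (pXA (X + eps) Y) (pLA d)) = psiP (pXA X Y) (pLA d) *
    (psiP_factor (pXA X Y) (pLA d) *
     fE (K (pLA d) * (pXA X Y + K (ratA 2%:R^-1) * eps))).
  rewrite /tau wshift_psiP wshift_pXA pXA_shift Kk -psiP_shift.
  by congr psiP; ring.
have tauB : tau (psiP (pXB (X + eps) Y) (pL0 d)) = psiP (pXB X Y) (pL0 d).
  by rewrite /tau wshift_psiP wshift_pXB pXB_shift Kk; congr psiP; ring.
have tauC : tau (psiP (pXC (X + eps) Y) (pLC d)) = psiP (pXC X Y) (pLC d).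
  by rewrite /tau wshift_psiP wshift_pXC pXC_shift Kk; congr psiP; ring.
pose E1 : fps A := fE (fpsC (pa d) * (X + fpsC (ratA 2%:R^-1) * eps)).
have expE : fE (K (pLA d) * (pXA X Y + K (ratA 2%:R^-1) * eps)) * gauss_weight (pdelta d) kappa
    = fE (- pXC X Y) * fconst E1.
  rewrite /E1 fconst_fE /gauss_weight; apply: fE_eq2.
  rewrite fconstM fconstD fconstM !fconstC fconst_eps /pXA /pXC /pc.
  apply: pentagon_shift_exponent.
  - by rewrite pdelta_kappa -p1LA rmorphN /= rmorphD rmorph1.
  - by rewrite -Kk -rmorphM.
  - by rewrite -(rmorph1 K) -!rmorphD -rmorphM pLA_cx.
  - by rewrite -(rmorph1 K) -!rmorphD -rmorphM pLA_cy.
rewrite /pR -[LHS](gintS_shift kappa (pdeltaK d)).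
have -> : fext (wshift kappa) (pI (X + eps) Y) * gauss_weight (pdelta d) kappa =
    fconst E1 * (pI X Y * (psiP_factor (pXA X Y) (pLA d) * fE (- pXC X Y))).
  apply: etrans (congr1 (fun Z => Z * gauss_weight (pdelta d) kappa)
    (rmorph_prod3 (fext (wshift kappa)) _ _ _)) _.
  exact: (pentagon_shift_product tauA tauB tauC expE).
rewrite gintSM psiP_bracket mulrDr raddfD /= [_ * fconst (1 + _ - _)]mulrC gintSM.
apply: etrans (congr1 (fun V => E1 * ((1 + fpsC (pa d) - fpsC (pa d) * fE X)
  * gintS (psigma d) (pI X Y) + V)) (gintS_mulB _ (pI_key X Y))) _.
by rewrite addr0 mulrA [E1 * _]mulrC.
Qed.
End PentagonIntegral.

(** * The quotient does not depend on x and y *)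

Section WExtension.
Variables (A B : ratAlgType).

Lemma fext_coefw_wC (Phi : {additive A -> fps B}) c :
  fext (coefw Phi) (wC c) = fconst (Phi c).
Proof. by rewrite /wC fextC; apply: coefwC. Qed.

Lemma fext_coefw_fconst (Phi : {additive A -> fps B}) X :
  fext (coefw Phi) (fconst X) = fconst (fext Phi X).
Proof.
rewrite /fconst !fext_comp; apply: eq_fext => c.
exact: fext_coefw_wC.
Qed.

Lemma fext_coefw_wX (Phi : {rmorphism A -> fps B}) : fext (coefw Phi) wX = wX.
Proof. by rewrite /wX fextC; apply: coefwX. Qed.
End WExtension.

Lemma inv_unique (R : comNzRingType) (x y z : R) : x * y = 1 -> x * z = 1 -> y = z.
Proof. by move=> xy xz; rewrite -[y]mulr1 -xz mulrCA mulrA xy mul1r. Qed.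

Section PentagonMorphism.
Variables (A B : ratAlgType) (d : pentagon A) (d' : pentagon B).
Variable Phi : {rmorphism A -> fps B}.
Hypotheses (Phia : Phi (pa d) = fpsC (pa d')) (Phib : Phi (pb d) = fpsC (pb d')).

(** By uniqueness of inverses it is enough to prescribe a morphism on a and b; its values on the
    other pentagon data follow. *)
Let Phi_inv x y x' y' : Phi x = fpsC x' -> x * y = 1 -> x' * y' = 1 -> Phi y = fpsC y'.
Proof.
move=> xE xy xy'; apply: (@inv_unique _ (fpsC x')); last by rewrite -rmorphM xy' rmorph1.
by rewrite -xE -rmorphM xy rmorph1.
Qed.

Let Phiai : Phi (pai d) = fpsC (pai d').
Proof. exact: Phi_inv Phia (paK d) (paK d'). Qed.
Let Phibi : Phi (pbi d) = fpsC (pbi d').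
Proof. exact: Phi_inv Phib (pbK d) (pbK d'). Qed.
Lemma morph_pL0 : Phi (pL0 d) = fpsC (pL0 d').
Proof. by rewrite /pL0 !rmorphD !rmorphM /= Phia Phib. Qed.
Let Phis : Phi (pL0i d) = fpsC (pL0i d').
Proof. exact: Phi_inv morph_pL0 (pL0K d) (pL0K d'). Qed.
Lemma morph_pLA : Phi (pLA d) = fpsC (pLA d').
Proof. by rewrite /pLA !rmorphM !rmorphD !rmorph1 /= Phia Phib Phibi. Qed.
Lemma morph_pLC : Phi (pLC d) = fpsC (pLC d').
Proof. by rewrite /pLC !rmorphM !rmorphD !rmorph1 /= Phia Phib Phiai. Qed.
Lemma morph_pcx : Phi (pcx d) = fpsC (pcx d').
Proof. by rewrite /pcx !rmorphM !rmorphD !rmorph1 /= Phia Phib Phis. Qed.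
Lemma morph_pcy : Phi (pcy d) = fpsC (pcy d').
Proof. by rewrite /pcy !rmorphM !rmorphD !rmorph1 /= Phia Phib Phis. Qed.

Lemma morph_psigma : Phi (psigma d) = fpsC (psigma d').
Proof. by rewrite /psigma !expr2 !rmorphM /= Phia Phib Phis. Qed.

Local Notation tau := (fext (coefw Phi)).

Lemma fext_psiP Z L L' : Phi L = fpsC L' -> tau (psiP Z L) = psiP (tau Z) L'.
Proof.
move=> LE; apply: fext_psiS; apply: etrans (coefwC _ _) _.
by rewrite /= LE fconstC.
Qed.

Let tau_wC c c' : Phi c = fpsC c' -> tau (wC c) = wC c'.
Proof. by move=> cE; rewrite fext_coefw_wC /= cE fconstC. Qed.

Let tau_pc X Y : tau (pc d X Y) = pc d' (fext Phi X) (fext Phi Y).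
Proof.
have tauM Z Z' : tau (Z * Z') = tau Z * tau Z' by exact: rmorphM.
rewrite /pc rmorphD /= !tauM (tau_wC morph_pcx) (tau_wC morph_pcy).
by rewrite !fext_coefw_fconst.
Qed.

Lemma fext_pXA X Y : tau (pXA d X Y) = pXA d' (fext Phi X) (fext Phi Y).
Proof. by rewrite /pXA rmorphD rmorphB rmorphN /= tau_pc fext_coefw_wX fext_coefw_fconst. Qed.
Lemma fext_pXB X Y : tau (pXB d X Y) = pXB d' (fext Phi X) (fext Phi Y).
Proof.
by rewrite /pXB rmorphB rmorphD rmorphD /= tau_pc fext_coefw_wX !fext_coefw_fconst.
Qed.
Lemma fext_pXC X Y : tau (pXC d X Y) = pXC d' (fext Phi X) (fext Phi Y).
Proof. by rewrite /pXC rmorphD rmorphB rmorphN /= tau_pc fext_coefw_wX fext_coefw_fconst. Qed.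

Lemma fext_pI X Y : tau (pI d X Y) = pI d' (fext Phi X) (fext Phi Y).
Proof.
rewrite /pI; apply: etrans (rmorph_prod3 tau _ _ _) _; congr (_ * _ * _).
- by apply: etrans (fext_psiP _ morph_pLA) _; rewrite fext_pXA.
- by apply: etrans (fext_psiP _ morph_pL0) _; rewrite fext_pXB.
- by apply: etrans (fext_psiP _ morph_pLC) _; rewrite fext_pXC.
Qed.

Lemma fext_pR X Y : fext Phi (pR d X Y) = pR d' (fext Phi X) (fext Phi Y).
Proof. by rewrite /pR (fext_gintS _ morph_psigma) fext_pI. Qed.
End PentagonMorphism.

Section Quotient.
Variable A : ratAlgType.
Implicit Types (X Y : fps A) (L : A).

Definition psiS_inv X L : fps A := fexp (- lpsi X L).

Lemma psiSK X L : psiS X L * psiS_inv X L = 1.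
Proof. exact: fexpNK (lpsi_0 _ _). Qed.

Lemma psiS_inv_shift X L : shift_factor X L * psiS_inv (X + eps) L = psiS_inv X L.
Proof.
apply: (inv_unique _ (psiSK X L)).
by rewrite mulrA -psiS_shift psiSK.
Qed.

(** The quotient Q without the prefactor e^(-hbar/24); the goal is thus Q = e^(hbar/24). *)
Definition pQ (d : pentagon A) X Y :=
  pR d X Y * (psiS_inv X (pa d) * psiS_inv Y (pb d)).

Lemma pQ_shift d X Y : pQ d (X + eps) Y = pQ d X Y.
Proof.
rewrite /pQ pR_shift -(psiS_inv_shift X).
by ring.
Qed.
End Quotient.

Lemma fext_psiS_inv (A B : ratAlgType) (Phi : {rmorphism A -> fps B}) X L L' :
  Phi L = fpsC L' -> fext Phi (psiS_inv X L) = psiS_inv (fext Phi X) L'.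
Proof.
move=> LE; rewrite /psiS_inv fext_fexp ?coef_fpsN ?lpsi_0 ?oppr0 //.
by rewrite rmorphN /= (fext_lpsi _ LE).
Qed.

Lemma fext_pQ (A B : ratAlgType) (d : pentagon A) (d' : pentagon B)
    (Phi : {rmorphism A -> fps B}) X Y :
  Phi (pa d) = fpsC (pa d') -> Phi (pb d) = fpsC (pb d') ->
  fext Phi (pQ d X Y) = pQ d' (fext Phi X) (fext Phi Y).
Proof.
move=> aE bE; rewrite /pQ; have tauM Z Z' : fext Phi (Z * Z') = fext Phi Z * fext Phi Z'.
  exact: rmorphM.
by rewrite !tauM (fext_pR aE bE) (fext_psiS_inv _ aE) (fext_psiS_inv _ bE).
Qed.

Definition map_pentagon (A B : comNzRingType) (h : {rmorphism A -> B}) (d : pentagon A) :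
  pentagon B.
Proof.
apply: (@Pentagon _ (h (pa d)) (h (pb d)) (h (pai d)) (h (pbi d)) (h (pL0i d))).
- by rewrite -rmorphM paK rmorph1.
- by rewrite -rmorphM pbK rmorph1.
- by rewrite -!(rmorphM, rmorphD) pL0K rmorph1.
Defined.

Section MapPentagon.
Variables (A B : comNzRingType) (h : {rmorphism A -> B}) (d : pentagon A).
Lemma map_pL0 : pL0 (map_pentagon h d) = h (pL0 d).
Proof. by rewrite /pL0 !rmorphD rmorphM. Qed.
Lemma map_pLA : pLA (map_pentagon h d) = h (pLA d).
Proof. by rewrite /pLA !rmorphM rmorphD rmorph1. Qed.
Lemma map_pLC : pLC (map_pentagon h d) = h (pLC d).
Proof. by rewrite /pLC !rmorphM rmorphD rmorph1. Qed.
Lemma map_psigma : psigma (map_pentagon h d) = h (psigma d).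
Proof. by rewrite /psigma !expr2 !rmorphM. Qed.
End MapPentagon.

Lemma fext_fpsC (A : comNzRingType) (f : fps A) : fext (@fpsC A) f = f.
Proof.
by apply: eqmP => N; apply: eqm_trans (fext_expand _ f) _; apply: eqm_sym; apply: fps_expand.
Qed.

Lemma fsub_fconst (A : ratAlgType) (Z X : fps A) :
  fext (peval (@fpsC A) Z) (fconst X) = X.
Proof.
rewrite /fconst fext_comp -[RHS]fext_fpsC; apply: eq_fext => c /=.
by rewrite fextC; apply: pevalC.
Qed.

Lemma fsub_wX (A : ratAlgType) (Z : fps A) : fext (peval (@fpsC A) Z) wX = Z.
Proof. by rewrite /wX fextC; apply: pevalX. Qed.

Lemma deriv_eq0 (A : ratAlgType) (p : {poly A}) : p^`() = 0 -> p = (p`_0)%:P.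
Proof.
move=> dp; apply/polyP => -[|i]; rewrite coefC //=; apply: (@natrA_eq0 _ i).
by rewrite mulr_natl -coef_deriv dp coef0.
Qed.

(* The coefficient of eps^(n+1) in f(w + eps) - f(w) is f_n' once f_0, ..., f_(n-1) are
   known to be constant. *)
Lemma wshift_fixed (A : ratAlgType) (f : fps (polyQ A)) :
  fext (wshift (1 : A)) f = f -> f = fconst (fun n => (f n : {poly A})`_0).
Proof.
move=> ff; suff df n : (f n : {poly A})^`() = 0.
  by apply: fpsP => n; rewrite coef_fconst; apply: deriv_eq0.
have [m] := ubnP n; elim: m n => // m IHm n; rewrite ltnS => le_nm.
have /(congr1 (fun g : fps _ => g n.+1)) := ff; rewrite {1}/fext !big_ord_recr /=.
rewrite big1 => [|i _].
  rewrite add0r subnn wshift_0 subSnn.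
  have -> : wshift (1 : A) (f n) 1 = (f n : {poly A})^`().
    have /(congr1 (fun g : fps _ => g 0%N)) := fderiv_wshift (1 : A) (f n).
    by rewrite /fderiv mul1r coef_fpsCM wshift_0 mul1r.
  by move/eqP; rewrite -subr_eq0 addrK => /eqP.
rewrite (deriv_eq0 (IHm i _)); last exact: leq_trans (ltn_ord i) le_nm.
rewrite [wshift _ _]pevalC /wC; case E : (n.+1 - i)%N => [|//].
by move/eqP: E; rewrite subn_eq0 => le_ni; have := ltn_ord i; rewrite ltnNge (ltnW le_ni).
Qed.

Section Constancy.
Variable A : ratAlgType.

(** X is replaced by a polynomial variable. This universal quotient is fixed by [wshift], hence
    constant in the variable, and substituting X or 0 for the variable gives both sides. *)
Lemma pQ_const_l (d : pentagon A) X Y : pQ d X Y = pQ d 0 Y.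
Proof.
pose D : pentagon (polyQ A) := map_pentagon (@polyC A) d.
pose Q := pQ D wX (fconst Y).
have Qfix : fext (wshift (1 : A)) Q = Q.
  rewrite /Q (@fext_pQ _ _ D D); try exact: pevalC.
  by rewrite wshift_wX wshift_fconst rmorph1 mul1r pQ_shift.
have QE Z : fext (peval (@fpsC A) Z) Q = pQ d Z Y.
  rewrite /Q (@fext_pQ _ _ D d); try exact: pevalC.
  exact: (congr2 (pQ d) (fsub_wX Z) (fsub_fconst Z Y)).
by rewrite -(QE X) -(QE 0) (wshift_fixed Qfix) !fsub_fconst.
Qed.

Lemma pXA_swap (d : pentagon A) X Y : pXA (swap_pentagon d) Y X = pXC d X Y.
Proof. by rewrite /pXA /pXC /pc swap_cx swap_cy; ring. Qed.
Lemma pXC_swap (d : pentagon A) X Y : pXC (swap_pentagon d) Y X = pXA d X Y.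
Proof. by rewrite /pXA /pXC /pc swap_cx swap_cy; ring. Qed.
Lemma pXB_swap (d : pentagon A) X Y : pXB (swap_pentagon d) Y X = pXB d X Y.
Proof. by rewrite /pXB /pc swap_cx swap_cy; ring. Qed.

Lemma pI_swap (d : pentagon A) X Y : pI (swap_pentagon d) Y X = pI d X Y.
Proof.
have rev3 (R : comNzRingType) (u v t u' v' t' : R) :
    u' = u -> v' = v -> t' = t -> t' * v' * u' = u * v * t.
  by move=> -> -> ->; ring.
apply: rev3.
- exact: (congr2 (@psiP A) (pXC_swap d X Y) (swap_LC d)).
- exact: (congr2 (@psiP A) (pXB_swap d X Y) (swap_L0 d)).
- exact: (congr2 (@psiP A) (pXA_swap d X Y) (swap_LA d)).
Qed.

Lemma pR_swap (d : pentagon A) X Y : pR (swap_pentagon d) Y X = pR d X Y.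
Proof. exact: (congr2 (@gintS A) (swap_sigma d) (pI_swap d X Y)). Qed.

Lemma pQ_swap (d : pentagon A) X Y : pQ (swap_pentagon d) Y X = pQ d X Y.
Proof. by rewrite /pQ pR_swap [psiS_inv Y _ * _]mulrC. Qed.

Lemma pQ_const (d : pentagon A) X Y : pQ d X Y = pQ d 0 0.
Proof. by rewrite pQ_const_l -pQ_swap pQ_const_l pQ_swap. Qed.

Lemma pRE (d : pentagon A) X Y :
  pR d X Y = pQ d 0 0 * (psiS X (pa d) * psiS Y (pb d)).
Proof.
rewrite -(pQ_const d X Y) /pQ.
transitivity (pR d X Y * (psiS X (pa d) * psiS_inv X (pa d))
                       * (psiS Y (pb d) * psiS_inv Y (pb d))); last by ring.
by rewrite !psiSK !mulr1.
Qed.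
End Constancy.

(** * The quotient is killed by derivations *)

Section DerivationPolynomial.
Variable A : ratAlgType.
Implicit Type L : A.

Definition lpsi_coef1 L k l : A :=
  ratA (bernoulli k / (l`!%:R * k`!%:R)) * Li (k + l - 2).+1 L.

(** The (k, l) term of the first series at order n matches the x-derivative of the (k, l + 1) term
    at order n + 1. Only the derivative at n = 1 has no partner, since the shape is cut at n = 0;
    its terms (0, 2) and (1, 0) form the right side. *)
Lemma lpsi_poly_deriv L :
  eps * diag_poly (lpsi_coef1 L) - ((fun n => (lpsi_poly L n)^`()) : fps {poly A}) =
  eps * fpsC ((ratA 2%:R^-1 * Li 1 L)%:P * 'X^2 - (ratA 2%:R^-1 * L)%:P) :> fps {poly A}.
Proof.
apply: fpsP => -[|n]; rewrite coef_fpsB !coef_epsM; first by rewrite deriv0 subr0.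
apply/polyP => i; rewrite coefB coef_deriv.
have [[r rE]|odd_i] := pselect (exists r, 2 * r + i = n + 2)%N; last first.
  have {}odd_i r : (2 * r + i <> n + 2)%N by move=> rE; apply: odd_i; exists r.
  rewrite coef_diag_poly_odd // coef_lpsi_poly_odd ?mul0rn ?subr0; last first.
    by move=> r rE; apply: (odd_i r); lia.
  case: n odd_i => [|n] odd_i; last by rewrite coef0.
  rewrite /= coefB coefCM coefXn coefC.
  case: eqP => [i2|_]; first by case: (odd_i 0%N); rewrite i2.
  case: eqP => [i0|_]; last by rewrite mulr0 subr0.
  by case: (odd_i 1%N); rewrite i0.
rewrite (@coef_lpsi_poly_even _ _ n.+1 _ r); [| by [] | lia].
case: n rE => [|n] rE; last first.
  rewrite (@coef_diag_poly_even _ _ _ _ r) //= coef0 /lpsi_coef1.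
  have -> : (r + i.+1 - 2 = (r + i - 2).+1)%N by lia.
  rewrite mulNrn opprK -mulrnAl -raddfMn /= -[X in _ + ratA X * _]mulr_natr factS natrM.
  have -> : bernoulli r / (i.+1%:R * i`!%:R * r`!%:R) * i.+1%:R
    = bernoulli r / (i`!%:R * r`!%:R).
    by field; rewrite !natr_fact_neq0 -[1 + _]mulrS Num.Theory.pnatr_eq0.
  by rewrite addNr.
rewrite [diag_poly _ _]/= coef0 sub0r mulNrn opprK /= coefB coefCM coefXn coefC.
have [[r0 i2]|[r1 i0]] : (r = 0 /\ i = 2 \/ r = 1 /\ i = 0)%N by lia.
  rewrite r0 i2 /= subr0 mulr1 -mulrnAl -raddfMn bernoulli0.
  by rewrite mulr1; congr (ratA _ * _); apply/eqP.
rewrite r1 i0 /= bernoulli1 mulr0 sub0r mulr1n Li0 divr1 -mulNr -rmorphN.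
by [].
Qed.
End DerivationPolynomial.

Section DerivationPsi.
Variables (A B : ratAlgType) (h : {rmorphism A -> fps B}) (d : {additive A -> fps B}).
Hypothesis derM : is_derivation h d.
Variables (X : fps A) (L : A) (L' alpha : B).
Hypotheses (dX : fext d X = - fpsC alpha) (hL : h L = fpsC L').
Hypothesis dL : d L = eps * fpsC (alpha * (L' + L' ^+ 2)).

Local Notation D := (fext d).
Local Notation H := (fext h).
Let DM : is_derivation H D. Proof. exact: fext_derivation. Qed.

Let der_diag n :
  D (peval (@fpsC A) X (lpsi_poly L n)) =
  fpsC alpha * (eps * peval (@fpsC B) (H X) (diag_poly (lpsi_coef1 L') n)
                - peval (@fpsC B) (H X) (lpsi_poly L' n)^`()).
Proof.
have der_Lic m : d (Li m L) = eps * fpsC alpha * fpsC (Li m.+1 L').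
  rewrite (der_Li m (u := eps * fpsC alpha) derM) hL ?rmorph_Li //.
  by rewrite dL rmorphM rmorphD rmorphXn /= mulrA.
have hLic m : h (Li m L) = fpsC (Li m L') by rewrite !rmorph_Li hL.
have hc k l : h (lpsi_coef L k l) = fpsC (lpsi_coef L' k l).
  by rewrite /lpsi_coef (rmorphM h) (rmorphM (@fpsC B)) hLic /= !rmorph_ratA.
have dc k l : d (lpsi_coef L k l) = eps * fpsC alpha * fpsC (lpsi_coef1 L' k l).
  rewrite /lpsi_coef /lpsi_coef1 (der_ratAM derM) der_Lic (rmorphM (@fpsC B)) /= rmorph_ratA.
  ring.
have step k l : D (peval (@fpsC A) X ((lpsi_coef L k l)%:P * 'X^l)) =
    fpsC alpha * (eps * peval (@fpsC B) (H X) ((lpsi_coef1 L' k l)%:P * 'X^l)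
                  - peval (@fpsC B) (H X) ((lpsi_coef L' k l)%:P * 'X^l)^`()).
  rewrite !(rmorphM (peval _ _)) !(rmorphXn (peval _ _)) /= !pevalC !pevalX.
  rewrite DM (der_X DM) !fextC /= dX hc dc.
  rewrite derivM derivC mul0r add0r derivXn (rmorphM (peval _ _)) raddfMn /=.
  rewrite (rmorphXn (peval _ _)) /= pevalC pevalX (rmorphXn H) /=.
  by ring.
case: n => [|n].
  by rewrite /= deriv0 !(rmorph0 (peval _ _)) mulr0 subrr mulr0 raddf0.
have pevalN (p : {poly B}) : peval (@fpsC B) (H X) (- p) = - peval (@fpsC B) (H X) p.
  exact: rmorphN.
have -> : diag_poly (lpsi_coef1 L') n.+1 = - \sum_(k < n.+4)
  \sum_(l < n.+4 | (2 * k + l == n.+1 + 2)%N) (lpsi_coef1 L' k l)%:P * 'X^l by [].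
rewrite /lpsi_poly /diag_poly derivN !pevalN mulrN opprK addrC -opprB mulrN.
rewrite !raddfN /=; congr (- _).
pose K (p : {poly A}) (q1 q2 : {poly B}) := D (peval (@fpsC A) X p) =
  fpsC alpha * (eps * peval (@fpsC B) (H X) q1 - peval (@fpsC B) (H X) q2^`()).
have K0 : K 0 0 0 by rewrite /K deriv0 !(rmorph0 (peval _ _)) mulr0 subrr mulr0 raddf0.
have KD p q1 q2 p' q1' q2' : K p q1 q2 -> K p' q1' q2' -> K (p + p') (q1 + q1') (q2 + q2').
  rewrite /K derivD !(rmorphD (peval _ _)) raddfD /= => -> ->; ring.
rewrite -/(K _ _ _); apply: (big_ind3 K K0 KD) => k _.
by apply: (big_ind3 K K0 KD) => l _; apply: step.
Qed.

(** Since z dL/dz = L + L^2, alpha is the logarithmic derivative of z. The argument moves with slope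
    -alpha while z moves with eps alpha, and this ratio makes all but the quadratic terms of
    [lpsi_poly_deriv] cancel. *)
Lemma der_psiS : fext d (psiS X L) =
  ratA 2%:R^-1 * (eps * fpsC alpha) * (fpsC (L' + L' ^+ 2) * fext h X ^+ 2 - fpsC L')
  * psiS (fext h X) L'.
Proof.
rewrite /psiS (fext_der_fexp derM) ?lpsi_0 // (fext_lpsi _ hL); congr (_ * _).
rewrite /lpsi fext_comp.
pose U : fps {poly B} := diag_poly (lpsi_coef1 L').
pose V : fps {poly B} := fun n => (lpsi_poly L' n)^`().
have -> : fext (D \o peval (@fpsC A) X) (lpsi_poly L) =
    fpsC alpha * fext (peval (@fpsC B) (H X)) (eps * U - V).
  have -> : fext (peval (@fpsC B) (H X)) (eps * U - V) =
      eps * fext (peval (@fpsC B) (H X)) U - fext (peval (@fpsC B) (H X)) V.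
    by rewrite raddfB /= -[in RHS](fext_eps (peval (@fpsC B) (H X))) -rmorphM.
  apply: eqmP => N; apply: eqm_trans (fext_expand _ _) _.
  apply: eqm_sym; apply: eqm_trans (eqmM (@eqm_refl _ _ _) (eqmD (eqmM (@eqm_refl _ _ _)
    (fext_expand _ _)) (_ : eqm _ _ (- \sum_(m < N) peval (@fpsC B) (H X) (V m) * eps ^+ m)))) _.
    by move=> n ltn; rewrite !coef_fpsN (fext_expand _ _ ltn).
  rewrite mulr_sumr -sumrB mulr_sumr.
  by under [X in eqm _ X _]eq_bigr => m _ do rewrite mulrA -mulrBl mulrA -der_diag.
rewrite /U /V lpsi_poly_deriv (rmorphM (fext _)) /= fext_eps fextC /=.
rewrite (rmorphB (peval _ _)) (rmorphM (peval _ _)) (rmorphXn (peval _ _)) /= !pevalC pevalX.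
rewrite !(rmorphM (@fpsC B)) /= Li1.
by clear; move: (fext h X) => Z; ring.
Qed.
End DerivationPsi.

Section Alpha.
Variables (A : comNzRingType) (d : pentagon A) (al1 al2 : A).
(** These three elements are at once the logarithmic derivatives of z1/z0, z2/z0 and z0 under D and
    the slopes of the arguments of the three psi along x = al1 s, y = al2 s. This coincidence lets
    [der_psiS] apply to every factor of the integrand. *)
Definition alphaA := al1 * pcx d + al2 * pcy d - al2.
Definition alphaC := al1 * pcx d + al2 * pcy d - al1.
Definition alpha0 := al1 + al2 - al1 * pcx d - al2 * pcy d.
End Alpha.

Section PentagonDerivation.
Variables (A : ratAlgType) (D : {additive A -> A}) (d : pentagon A) (al1 al2 : A).
Hypothesis DM : is_derivation idfun D.
Hypotheses (Da : D (pa d) = al1 * (pa d + pa d ^+ 2)).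
Hypotheses (Db : D (pb d) = al2 * (pb d + pb d ^+ 2)).
Local Notation a := (pa d).
Local Notation b := (pb d).

Local Notation alA := (alphaA d al1 al2).
Local Notation al0 := (alpha0 d al1 al2).

Lemma D1 : D 1 = 0.
Proof. by rewrite -(expr0 1) (der_X DM) mulr0n. Qed.

Lemma D_inv x y : x * y = 1 -> D y = - y ^+ 2 * D x.
Proof.
move=> xy; have := D1; rewrite -xy DM /= => /(congr1 ( *%R y)); rewrite mulr0 mulrDr => Dxy.
apply/eqP; rewrite -subr_eq0; apply/eqP.
transitivity (y * (D x * y) + x * y * D y); first by rewrite xy; ring.
by rewrite -[RHS]Dxy; ring.
Qed.

Lemma D_pLA : D (pLA d) = alA * (pLA d + pLA d ^+ 2).
Proof.
have -> : alA * (pLA d + pLA d ^+ 2) =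
    pLA d * (al1 * (pcx d * (1 + pLA d)) + al2 * (pcy d * (1 + pLA d)) - al2 * (1 + pLA d)).
  by rewrite /alphaA; ring.
rewrite pLA_cx pLA_cy {1}/pLA DM DM (raddfD D) /= D1 Da Db (D_inv (pbK d)) Db.
transitivity (pLA d * (al1 * (1 + a) + al2 * b - al2 * (1 + b) * (b * pbi d))
  + (a * al2 * b * (1 + b) * pbi d - pLA d * (al2 * b))).
  by rewrite /pLA; ring.
by rewrite pbK /pLA; ring.
Qed.

Lemma D_pL0 : D (pL0 d) = al0 * (pL0 d + pL0 d ^+ 2) /\ al0 * pL0 d = al1 * a + al2 * b.
Proof.
have alE : al0 * pL0 d = al1 * a + al2 * b.
  transitivity (al1 * (pL0 d - b * (1 + a) * ((a + b + a * b) * pL0i d))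
    + al2 * (pL0 d - a * (1 + b) * ((a + b + a * b) * pL0i d))).
    by rewrite /alpha0 /pcx /pcy /pL0; ring.
  by rewrite pL0K /pL0; ring.
split=> //; transitivity (al0 * pL0 d * (1 + pL0 d)); last by ring.
by rewrite alE /pL0 !raddfD /= DM /= Da Db; ring.
Qed.
End PentagonDerivation.

Section PentagonDerivationSum.
Variables (A : ratAlgType) (D : {additive A -> A}) (d : pentagon A) (al1 al2 : A).
Hypothesis DM : is_derivation idfun D.
Hypotheses (Da : D (pa d) = al1 * (pa d + pa d ^+ 2)).
Hypotheses (Db : D (pb d) = al2 * (pb d + pb d ^+ 2)).
Local Notation alA := (alphaA d al1 al2).
Local Notation al0 := (alpha0 d al1 al2).
Local Notation alC := (alphaC d al1 al2).

Lemma D_pLC : D (pLC d) = alC * (pLC d + pLC d ^+ 2).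
Proof.
have := @D_pLA _ _ (swap_pentagon d) al2 al1 DM Db Da.
by rewrite swap_LA /alphaA swap_cx swap_cy /alphaC [_ * pcy d + _]addrC.
Qed.

Lemma pdelta_prod : pdelta d = (1 + pLA d) * (1 + pLC d).
Proof. by rewrite p1LA p1LC /pdelta; ring. Qed.

Lemma D_pdelta : D (pdelta d) = pdelta d * (alA * pLA d + alC * pLC d).
Proof.
rewrite {1}pdelta_prod DM /= !(raddfD D) /= (D1 DM) (D_pLA DM Da Db) D_pLC pdelta_prod.
by ring.
Qed.

Lemma D_psigma : pdelta d * D (psigma d) = - (alA * pLA d + alC * pLC d).
Proof.
rewrite (D_inv DM (pdeltaK d)) D_pdelta.
transitivity (- (pdelta d * psigma d) ^+ 2 * (alA * pLA d + alC * pLC d)); first by ring.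
by rewrite pdeltaK; ring.
Qed.

Lemma D_psigmaE : D (psigma d) = D (psigma d) * pdelta d * psigma d.
Proof. by rewrite -mulrA pdeltaK mulr1. Qed.

(** Both sides are D delta, computed from its expression as a sum and from its expression as a
    product. *)
Lemma alpha_sum_pdelta : alA * (pLA d + pLA d ^+ 2) + al0 * (pL0 d + pL0 d ^+ 2)
  + alC * (pLC d + pLC d ^+ 2) = pdelta d * (alA * pLA d + alC * pLC d).
Proof.
have [DL0 _] := D_pL0 DM Da Db.
rewrite -D_pdelta pdelta_sum (raddfD D) (raddfD D) (raddfD D) /= -(D_pLA DM Da Db) -DL0 -D_pLC.
by rewrite (raddfMn D) /= (D1 DM) mul0rn add0r.
Qed.
End PentagonDerivationSum.

Section SourceDerivation.
Variables (A : ratAlgType) (D : {additive A -> A}).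
Hypothesis DM : is_derivation idfun D.

(* eps D - d/ds at s = 0, where s is the variable of the polynomials. *)
Definition sder (p : polyQ A) : fps A :=
  eps * fpsC (D (p : {poly A})`_0) - fpsC (p : {poly A})`_1.

Fact sder_is_zmod_morphism : zmod_morphism sder.
Proof. by move=> p q; rewrite /sder !coefB !raddfB /=; ring. Qed.
HB.instance Definition _ := GRing.isZmodMorphism.Build (polyQ A) (fps A) sder
  sder_is_zmod_morphism.

Definition sval0 : polyQ A -> fps A := peval (@fpsC A) 0.
HB.instance Definition _ := GRing.RMorphism.copy sval0 (peval (@fpsC A) 0).

Lemma sval0E p : sval0 p = fpsC (p : {poly A})`_0.
Proof. by rewrite /sval0 /peval horner_coef0 coef_map. Qed.

Lemma sder_derivation : is_derivation sval0 sder.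
Proof.
move=> p q; rewrite /sder !sval0E coef0M coefM !big_ord_recl big_ord0 /= addr0 DM /=.
by rewrite !(rmorphD, rmorphM) /=; ring.
Qed.

Lemma sval0C c : sval0 c%:P = fpsC c.
Proof. by rewrite sval0E coefC. Qed.

Lemma sderC c : sder c%:P = eps * fpsC (D c).
Proof. by rewrite /sder !coefC /= raddf0 subr0. Qed.
End SourceDerivation.

Lemma gint_euler (A : ratAlgType) (sigma delta : A) (f : fps (polyQ A)) :
  delta * sigma = 1 ->
  gintS sigma (euler f) = fpsC delta * gintS sigma (wX ^+ 2 * f) - gintS sigma f.
Proof.
move=> ds; apply: fpsP => n; rewrite coef_fpsB coef_fpsCM /gintS expr2 -mulrA.
rewrite !coef_fpsCM /euler (gint_parts _ ('X * _)) derivM derivX mul1r raddfD /=.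
by rewrite mulrA ds mul1r addrC addKr.
Qed.

Lemma der_mul3 (R S : comNzRingType) (h : {rmorphism R -> S}) (d : R -> S) a b c :
  is_derivation h d -> d (a * (b * c)) = d a * (h b * h c) + h a * (d b * h c + h b * d c).
Proof. by move=> dM; rewrite !dM rmorphM. Qed.

Lemma flow_conclusion (R : comNzRingType) (sR sQ hQ sa sb ha hb r k1 k2 e Z R0 : R) :
  sR = sQ * (ha * hb) + hQ * (sa * hb + ha * sb) -> sR = - (r * (k1 + k2)) * R0 ->
  R0 = hQ * (ha * hb) -> sa = - (r * k1) * ha -> sb = - (r * k2) * hb -> sQ = e * Z ->
  e * Z * (ha * hb) = 0.
Proof.
move=> -> E R0E saE sbE sQE; rewrite R0E saE sbE sQE in E.
rewrite -[LHS](addrK (hQ * (- (r * k1) * ha * hb + ha * (- (r * k2) * hb)))).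
by rewrite E; ring.
Qed.

Section PentagonFlow.
Variables (A : ratAlgType) (D : {additive A -> A}) (d : pentagon A) (al1 al2 : A).
Hypothesis DM : is_derivation idfun D.
Hypotheses (Da : D (pa d) = al1 * (pa d + pa d ^+ 2)).
Hypotheses (Db : D (pb d) = al2 * (pb d + pb d ^+ 2)).
Local Notation alA := (alphaA d al1 al2).
Local Notation al0 := (alpha0 d al1 al2).
Local Notation alC := (alphaC d al1 al2).

Let dd : pentagon (polyQ A) := map_pentagon (@polyC A) d.
Let sx (al : A) : fps (polyQ A) := fpsC (al%:P * 'X : polyQ A).
Local Notation x := (sx al1).
Local Notation y := (sx al2).
Local Notation h := (@sval0 A).
Local Notation sd := (@sder A D).
Local Notation H := (fext (coefw h)).
Local Notation S := (fext (coefw sd)).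

Let ha : h (pa dd) = fpsC (pa d). Proof. exact: sval0C. Qed.
Let hb : h (pb dd) = fpsC (pb d). Proof. exact: sval0C. Qed.

Let sdM : is_derivation h sd. Proof. exact: sder_derivation. Qed.
Let SM : is_derivation H S.
Proof. exact: fext_derivation (coefw_derivation sdM). Qed.

Let h_sx al : fext h (sx al) = 0.
Proof. by rewrite fextC /= sval0E coefMX /= rmorph0. Qed.

Let sd_sx al : fext sd (sx al) = - fpsC al.
Proof.
by rewrite fextC /= /sder coefMX /= raddf0 rmorph0 mulr0 sub0r coefMX /= coefC.
Qed.

Let S_wX : S wX = 0.
Proof.
rewrite fextC; apply: fpsP => n; apply/polyP => i; rewrite coef_coefw coefX coef0.
case: (i == 1%N); rewrite /= ?raddf0 //.
by rewrite -[1]/(1%:P) sderC (D1 DM) rmorph0 mulr0.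
Qed.

Let S_sx al : S (fconst (sx al)) = - wC al.
Proof. by rewrite fext_coefw_fconst sd_sx fconstN fconstC. Qed.

Let H_sx al : H (fconst (sx al)) = 0.
Proof. by rewrite fext_coefw_fconst h_sx rmorph0. Qed.

(** D also moves z2/z0 and z1/z0, but these multiply x and y, which vanish at s = 0. *)
Let S_pc : S (pc dd x y) = - wC (pcx d * al1 + pcy d * al2).
Proof.
rewrite /pc raddfD /= !SM !H_sx !S_sx !fext_coefw_wC /= !mulr0 !add0r.
rewrite (morph_pcx ha hb) (morph_pcy ha hb) !fconstC.
by rewrite rmorphD !rmorphM /=; ring.
Qed.

Let S_pXA : S (pXA dd x y) = - fpsC (alA%:P : polyQ A).
Proof.
rewrite -/(wC _) /pXA /alphaA raddfD raddfB raddfN /= S_wX S_sx S_pc.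
by rewrite !(rmorphD, rmorphB, rmorphM) /=; ring.
Qed.

Let S_pXC : S (pXC dd x y) = - fpsC (alC%:P : polyQ A).
Proof.
rewrite -/(wC _) /pXC /alphaC raddfD raddfB raddfN /= S_wX S_sx S_pc.
by rewrite !(rmorphD, rmorphB, rmorphM) /=; ring.
Qed.

Let S_pXB : S (pXB dd x y) = - fpsC (al0%:P : polyQ A).
Proof.
rewrite -/(wC _) /pXB /alpha0 raddfB raddfD raddfD /= S_wX !S_sx S_pc.
by move: (pcx d) (pcy d) => cx cy; rewrite !(rmorphD, rmorphB, rmorphM) /=; ring.
Qed.
Let S_psiP Z al (L : A) : S Z = - fpsC (al%:P : polyQ A) -> D L = al * (L + L ^+ 2) ->
  S (psiP Z (L%:P : polyQ A)) = ratA 2%:R^-1 * (eps * wC al)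
    * (wC (L + L ^+ 2) * H Z ^+ 2 - wC L) * H (psiP Z (L%:P : polyQ A)).
Proof.
move=> SZ DL; have hL : h L%:P = fpsC L by exact: sval0C.
rewrite (fext_psiP _ hL) /psiP.
have CE : (L%:P + L%:P ^+ 2 : polyQ A) = (L + L ^+ 2)%:P by rewrite !expr2 rmorphD rmorphM.
have dL : coefw sd (L%:P)%:P = eps * fpsC (al%:P * (L%:P + L%:P ^+ 2) : polyQ A).
  rewrite CE coefwC /= sderC DL fconstM fconst_eps fconstC /wC; congr (_ * fpsC _).
  exact: rmorphM.
have hL2 : coefw h (L%:P)%:P = fpsC (L%:P : polyQ A).
  by apply: etrans (coefwC _ _) _; rewrite /= hL fconstC.
rewrite (der_psiS (coefw_derivation sdM) SZ hL2 dL) CE.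
reflexivity.
Qed.

Let prod3_der (PA PB PC : fps (polyQ (polyQ A))) (tA tB tC : fps (polyQ A)) :
  S PA = tA * H PA -> S PB = tB * H PB -> S PC = tC * H PC ->
  S (PA * PB * PC) = (tA + tB + tC) * H (PA * PB * PC).
Proof. by move=> SA SB SC; rewrite !SM SA SB SC !rmorphM /=; ring. Qed.

Let S_pI : S (pI dd x y) = ratA 2%:R^-1 * eps *
  (wC (alA * (pLA d + pLA d ^+ 2) + al0 * (pL0 d + pL0 d ^+ 2) + alC * (pLC d + pLC d ^+ 2))
     * wX ^+ 2
   - wC (alA * pLA d + al0 * pL0 d + alC * pLC d)) * pI d 0 0.
Proof.
have [DL0 _] := D_pL0 DM Da Db.
have HI : H (pI dd x y) = pI d 0 0 by rewrite (fext_pI ha hb) !h_sx.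
rewrite -HI /pI map_pLA map_pL0 map_pLC.
rewrite (prod3_der (S_psiP S_pXA (D_pLA DM Da Db)) (S_psiP S_pXB DL0)
                   (S_psiP S_pXC (D_pLC DM Da Db))).
congr (_ * _); rewrite (fext_pXA ha hb) (fext_pXB ha hb) (fext_pXC ha hb) !h_sx.
have p0 : pc d 0 0 = 0 by rewrite /pc !rmorph0 !mulr0 addr0.
rewrite /pXA /pXB /pXC p0 !rmorph0 !subr0 !addr0 sqrrN.
move: (alphaA _ _ _) (alpha0 _ _ _) (alphaC _ _ _) (pLA d) (pL0 d) (pLC d).
by move=> A1 A2 A3 L1 L2 L3; rewrite !(rmorphD, rmorphM) /=; ring.
Qed.

(** The motion of the variance, rewritten by [gint_euler], cancels the w^2 term of [S_pI] together
    with the part e of the constant term. What survives is al0 L0 = al1 a + al2 b, the sum of the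
    contributions of the two psi on the other side. *)
Let sd_pR : fext sd (pR dd x y) =
  - (ratA 2%:R^-1 * eps * fpsC (al1 * pa d + al2 * pb d)) * pR d 0 0.
Proof.
have [DL0 alE] := D_pL0 DM Da Db.
have hs : h (psigma dd) = fpsC (psigma d) := morph_psigma ha hb.
have ds : sd (psigma dd) = eps * fpsC (D (psigma d) * pdelta d) * fpsC (psigma d).
  by rewrite map_psigma sderC {1}D_psigmaE (rmorphM (@fpsC A)) mulrA.
rewrite /pR (fext_der_gintS _ sdM hs ds) S_pI (fext_pI ha hb) !h_sx.
rewrite (gint_euler _ (pdeltaK d)) (alpha_sum_pdelta DM Da Db) [D _ * _]mulrC.
rewrite (D_psigma DM Da Db) alE.
set I0 := pI d 0 0; set e := alA * pLA d + alC * pLC d; set k := al1 * pa d + al2 * pb d.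
have -> : alA * pLA d + k + alC * pLC d = e + k by rewrite /e; ring.
have -> : ratA 2%:R^-1 * eps * (wC (pdelta d * e) * wX ^+ 2 - wC (e + k)) * I0 =
    fconst (ratA 2%:R^-1 * eps * fpsC (pdelta d * e)) * (wX ^+ 2 * I0)
    - fconst (ratA 2%:R^-1 * eps * fpsC (e + k)) * I0.
  rewrite !fconstM !fconstC fconst_eps; ring.
rewrite raddfB /= !gintSM.
clearbody e k; move: (gintS _ (wX ^+ 2 * I0)) (gintS _ I0) (pdelta d) => J2 J0 dl.
by rewrite (rmorphN (@fpsC A)) (rmorphM (@fpsC A)) (rmorphD (@fpsC A)) /=; ring.
Qed.

Let sd_psiS al (L : A) : D L = al * (L + L ^+ 2) ->
  fext sd (psiS (sx al) (L%:P : polyQ A)) =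
  - (ratA 2%:R^-1 * eps * fpsC (al * L)) * psiS 0 L.
Proof.
move=> DL; have dL : sd L%:P = eps * fpsC (al * (L + L ^+ 2)) by rewrite sderC DL.
rewrite (der_psiS sdM (sd_sx al) (sval0C L) dL) h_sx; congr (_ * _).
by rewrite [0 ^+ 2]expr2 !mulr0 (rmorphM (@fpsC A)) /=; ring.
Qed.

Let h_psiS al (L : A) : fext h (psiS (sx al) (L%:P : polyQ A)) = psiS 0 L.
Proof. by rewrite (fext_psiS _ (sval0C L)) h_sx. Qed.

Let h_fconst (f : fps A) : fext h (fconst f) = f.
Proof. exact: fsub_fconst. Qed.

Let sd_fconst (f : fps A) : fext sd (fconst f) = eps * fext (@fpsC A \o D) f.
Proof.
rewrite /fconst fext_comp; apply: eqmP => N; apply: eqm_trans (fext_expand _ _) _.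
apply: eqm_sym; apply: eqm_trans (eqmM (@eqm_refl _ _ _) (fext_expand _ _)) _.
rewrite mulr_sumr.
by under [X in eqm _ _ X]eq_bigr => m _ do rewrite /= fextC /= sderC -mulrA.
Qed.

(* Apply [sder] to the factorization [pRE] with x = al1 s, y = al2 s. The choice of al1,
   al2 makes every psi satisfy [der_psiS], and the contributions of x and y cancel. *)
Lemma pQ_flow n : D (pQ d 0 0 n) = 0.
Proof.
have QE : pQ dd 0 0 = fconst (pQ d 0 0).
  have aE : (@fpsC (polyQ A) \o @polyC A) (pa d) = fpsC (pa dd) by [].
  have bE : (@fpsC (polyQ A) \o @polyC A) (pb d) = fpsC (pb dd) by [].
  apply: esym; apply: etrans (fext_pQ 0 0 aE bE) _.
  exact: (congr2 (pQ dd) (rmorph0 _) (rmorph0 _)).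
have sdM' : is_derivation (fext h) (fext sd) by exact: fext_derivation.
have := congr1 (fext sd) (pRE dd x y); rewrite QE => RE.
have RE' := etrans RE (der_mul3 _ _ _ sdM').
have sR : fext sd (pR dd x y) = - (ratA 2%:R^-1 * eps * (fpsC (al1 * pa d)
    + fpsC (al2 * pb d))) * pR d 0 0.
  by apply: etrans sd_pR _; rewrite (rmorphD (@fpsC A)).
have hQ := h_fconst (pQ d 0 0); have ha' := h_psiS al1 (pa d); have hb' := h_psiS al2 (pb d).
have RE0 : pR d 0 0 = fext h (fconst (pQ d 0 0)) *
    (fext h (psiS x (pa dd)) * fext h (psiS y (pb dd))).
  by apply: etrans (pRE d 0 0) _; rewrite hQ; congr (_ * (_ * _)); apply: esym.
have sa : fext sd (psiS x (pa dd)) = - (ratA 2%:R^-1 * eps * fpsC (al1 * pa d))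
    * fext h (psiS x (pa dd)).
  by apply: etrans (sd_psiS Da) _; congr (_ * _); apply: esym.
have sb : fext sd (psiS y (pb dd)) = - (ratA 2%:R^-1 * eps * fpsC (al2 * pb d))
    * fext h (psiS y (pb dd)).
  by apply: etrans (sd_psiS Db) _; congr (_ * _); apply: esym.
have /= EZ := flow_conclusion RE' sR RE0 sa sb (sd_fconst (pQ d 0 0)).
have EZ' : eps * fext (@fpsC A \o D) (pQ d 0 0) * (psiS 0 (pa d) * psiS 0 (pb d)) = 0.
  by apply: etrans EZ; congr (_ * (_ * _)); apply: esym.
have Z0 : eps * fext (@fpsC A \o D) (pQ d 0 0) = 0.
  transitivity (eps * fext (@fpsC A \o D) (pQ d 0 0) * (psiS 0 (pa d) * psiS 0 (pb d))
                * (psiS_inv 0 (pa d) * psiS_inv 0 (pb d))); last by rewrite EZ' mul0r.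
  rewrite -mulrA (mulrACA (psiS 0 (pa d))) psiSK psiSK mul1r; exact: esym (mulr1 _).
have := congr1 (fun f : fps A => f n.+1) Z0.
by rewrite coef_epsM coef_fext_const.
Qed.
End PentagonFlow.

Lemma bernoulli2 : bernoulli 2 = 6%:R^-1.
Proof.
have /eqP := bernoulli_sum 2; rewrite !big_ord_recl big_ord0 /= addr0 mul1r.
have -> : bernoulli (bump 0 0) = - 2%:R^-1 := bernoulli1.
rewrite bernoulli0 addrA addrC addr_eq0 => /eqP b2.
by apply: (@mulfI _ 3%:R) => //; apply: etrans b2 _; apply/eqP.
Qed.

Section SpecialValues.
Variable A : ratAlgType.
Implicit Types (X : fps A).

Lemma Li_0 m : Li m (0 : A) = 0.
Proof.
rewrite /Li; case: m => [|m] /=; first by rewrite map_polyX hornerX.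
by rewrite rmorphM rmorphD rmorphXn /= map_polyX !(hornerXn, hornerD, hornerX, hornerM) expr2 mulr0 addr0 mul0r.
Qed.

Lemma Li_N1 m : Li m.+1 (-1 : A) = 0.
Proof.
rewrite /Li rmorphM rmorphD rmorphXn /= map_polyX.
by rewrite !(hornerXn, hornerD, hornerX, hornerM) sqrrN expr1n addNr mul0r.
Qed.

Lemma psiS_0 X : psiS X 0 = 1.
Proof.
rewrite /psiS /lpsi (_ : lpsi_poly 0 = 0) ?rmorph0 ?fexp0 //.
apply: fpsP => -[|n] //; rewrite /lpsi_poly /diag_poly big1 ?oppr0 // => k _.
by rewrite big1 // => l _; rewrite /lpsi_coef Li_0 mulr0 mul0r.
Qed.

(** At L = -1 only Li_0 survives, so k + l = 2. The pair (0, 2) is excluded from psi; (1, 1) and (2,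
    0) give B_1 = -1/2 and B_2/2 = 1/12. *)
Lemma lpsi_poly_N1 : lpsi_poly (-1 : A) =
  fpsC ((ratA (- 2%:R^-1))%:P * 'X) * eps + fpsC (ratA 12%:R^-1)%:P * eps ^+ 2.
Proof.
apply: fpsP => n; apply/polyP => i; rewrite coef_fpsD !coef_fpsCM coefD.
have -> : eps n = (n == 1)%N%:R :> {poly A} by [].
have -> : (eps ^+ 2) n = (n == 2)%N%:R :> {poly A}.
  rewrite -[eps ^+ 2]mulr1 coef_epsXM; case: n => [|[|[|n]]] //=.
have -> : ((ratA (- 2%:R^-1))%:P * 'X * (n == 1)%N%:R : {poly A})`_i
    = ratA (- 2%:R^-1) * ((i == 1) && (n == 1))%N%:R.
  by case: (n == 1)%N; rewrite ?mulr1 ?mulr0 ?coef0 ?andbF ?mulr0 // coefCM coefX andbT.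
have -> : ((ratA 12%:R^-1)%:P * (n == 2)%N%:R : {poly A})`_i
    = ratA 12%:R^-1 * ((i == 0) && (n == 2))%N%:R.
  by case: (n == 2)%N; rewrite ?mulr1 ?mulr0 ?coef0 ?andbF ?mulr0 // coefC andbT; case: eqP; rewrite ?mulr1 ?mulr0.
have [[r rE]|odd_i] := pselect (exists r, 2 * r + i = n + 2)%N; last first.
  have {}odd_i r : (2 * r + i <> n + 2)%N by move=> rE; apply: odd_i; exists r.
  rewrite coef_lpsi_poly_odd //.
  have /negbTE -> : ~~ ((i == 1) && (n == 1))%N.
    by apply/andP => -[/eqP iE /eqP nE]; apply: (odd_i 1%N); lia.
  have /negbTE -> : ~~ ((i == 0) && (n == 2))%N.
    by apply/andP => -[/eqP iE /eqP nE]; apply: (odd_i 2%N); lia.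
  by rewrite !mulr0 addr0.
have [n0|n_gt0] := posnP n; first by rewrite n0 coef0 !andbF !mulr0 addr0.
rewrite (coef_lpsi_poly_even _ n_gt0 rE).
have [lt2|ge2] := ltnP 2 (r + i).
  have -> : (r + i - 2 = (r + i - 3).+1)%N by lia.
  have /negbTE -> : ~~ ((i == 1) && (n == 1))%N by apply/andP => -[/eqP ? /eqP ?]; lia.
  have /negbTE -> : ~~ ((i == 0) && (n == 2))%N by apply/andP => -[/eqP ? /eqP ?]; lia.
  by rewrite Li_N1 !mulr0 oppr0 addr0.
have -> : (r + i - 2 = 0)%N by lia.
rewrite Li0 mulrN1 opprK.
have [[r1 i1 ->]|[r2 i0 ->]] : [/\ r = 1, i = 1 & n = 1]%N \/ [/\ r = 2, i = 0 & n = 2]%N.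
- have : (r = 1 \/ r = 2)%N by lia.
  by case=> rv; [left | right]; split; lia.
- by rewrite r1 i1 /= bernoulli1 mulr0 addr0 [RHS]mulr1; congr (ratA _); apply/eqP.
- by rewrite r2 i0 /= bernoulli2 mulr0 add0r [RHS]mulr1; congr (ratA _); apply/eqP.
Qed.

Lemma psiS_N1 X : psiS X (-1) = fE (fpsC (ratA (- 2%:R^-1)) * X + fpsC (ratA 12%:R^-1) * eps).
Proof.
rewrite /psiS /lpsi lpsi_poly_N1 /fE mulrDl; congr fexp.
have fsubC c : fsub X (fpsC c%:P) = fpsC c by rewrite fextC /= pevalC.
have fsubX : fsub X (fpsC 'X) = X by rewrite fextC /= pevalX.
rewrite raddfD /= expr2 !(rmorphM (fext _)) /= fext_eps fsubC mulrA; congr (_ * _ + _).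
by rewrite (rmorphM (@fpsC {poly A})) (rmorphM (fext _)) /= fsubX fsubC.
Qed.
End SpecialValues.

(** * The value at infinity and its propagation *)

(* The point z1 = z2 = infinity. *)
Definition pentagon_infty (A : comNzRingType) : pentagon A.
Proof. by apply: (@Pentagon _ (-1) (-1) (-1) (-1) (-1)); ring. Defined.

Section ValueAtInfinity.
Variable A : ratAlgType.
Local Notation d := (pentagon_infty A).
Local Notation K := (@wC A).

Lemma psigma_infty : psigma d = 1. Proof. by rewrite /psigma /=; ring. Qed.
Lemma pLA_infty : pLA d = 0. Proof. by rewrite /pLA /=; ring. Qed.
Lemma pLC_infty : pLC d = 0. Proof. by rewrite /pLC /=; ring. Qed.
Lemma pL0_infty : pL0 d = -1. Proof. by rewrite /pL0 /=; ring. Qed.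

Lemma pXB_00 (d' : pentagon A) : pXB d' 0 0 = wX.
Proof. by rewrite /pXB /pc !rmorph0 !mulr0 !addr0 subr0. Qed.

Lemma pI_infty : pI d 0 0 =
  fE (K (ratA (- 2%:R^-1)) * wX + K (ratA 12%:R^-1) * eps).
Proof.
have psi0 Z : psiP Z 0 = 1 by exact: psiS_0.
rewrite /pI pLA_infty pLC_infty pL0_infty pXB_00 !psi0 mul1r mulr1.
by rewrite /psiP (_ : (-1)%:P = -1 :> polyQ A) ?psiS_N1 // rmorphN rmorph1.
Qed.

(** Completing the square: kappa = 1/2 reproduces the linear term of [pI_infty] at variance 1, at
    the price of kappa^2/2 = 1/8. *)
Lemma gauss_weight_half : gauss_weight (1 : A) (ratA 2%:R^-1) =
  fE (K (ratA (- 2%:R^-1)) * wX - K (ratA 8%:R^-1) * eps).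
Proof.
rewrite /gauss_weight; congr fE; rewrite mul1r -rmorphM (rmorphN (@ratA A)) (rmorphN (@wC A)).
rewrite mulrDr mulrA -(rmorphM (@wC A)) -(rmorphM (@ratA A)).
rewrite (_ : 2%:R^-1 * (2%:R^-1 * 2%:R^-1) = 8%:R^-1 :> rat); last by apply/eqP.
ring.
Qed.

Lemma pR_infty : pR d 0 0 = fE (fpsC (ratA (5%:R / 24%:R)) * eps).
Proof.
rewrite /pR psigma_infty pI_infty.
have -> : K (ratA (- 2%:R^-1)) * wX + K (ratA 12%:R^-1) * eps =
    (K (ratA (- 2%:R^-1)) * wX - K (ratA 8%:R^-1) * eps)
    + fconst (fpsC (ratA (5%:R / 24%:R)) * eps).
  rewrite fconstM fconstC fconst_eps.
  rewrite (_ : 5%:R / 24%:R = 12%:R^-1 + 8%:R^-1 :> rat); last by apply/eqP.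
  by rewrite (rmorphD (@ratA A)) (rmorphD (@wC A)) /=; ring.
rewrite [fE _]fE_D -gauss_weight_half -fconst_fE mulrC gintSM.
have G1 : gintS 1 (gauss_weight 1 (ratA 2%:R^-1)) = 1 :> fps A.
  have := @gintS_shift A 1 1 (ratA 2%:R^-1) (mulr1 1) 1; rewrite rmorph1 mul1r => ->.
  by apply: fpsP => -[|n]; [apply: gintC | apply: raddf0].
by rewrite G1 mulr1.
Qed.

(** The integral contributes 1/12 + 1/8 = 5/24 and each of the two psi at infinity removes 1/12. *)
Lemma pQ_infty : pQ d 0 0 = fE (fpsC (ratA 24%:R^-1) * eps).
Proof.
have psi1 : psiS (0 : fps A) (-1) = fE (fpsC (ratA 12%:R^-1) * eps).
  by rewrite psiS_N1 mulr0 add0r.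
have inv1 : psiS_inv (0 : fps A) (-1) = fE (- (fpsC (ratA 12%:R^-1) * eps)).
  apply: (inv_unique (psiSK _ _)); rewrite psi1.
  by rewrite -[LHS]fE_D subrr fE0.
rewrite /pQ pR_infty /= inv1 -!fE_D; congr fE.
rewrite (_ : 5%:R / 24%:R = 12%:R^-1 + 12%:R^-1 + 24%:R^-1 :> rat); last by apply/eqP.
by rewrite !(rmorphD (@ratA A)) !(rmorphD (@fpsC A)) /=; ring.
Qed.
End ValueAtInfinity.

Section CoefficientZero.
Variable A : comNzRingType.
Definition fps_coef0 (f : fps A) : A := f 0%N.
Fact fps_coef0_is_zmod_morphism : zmod_morphism fps_coef0. Proof. by []. Qed.
Fact fps_coef0_is_monoid_morphism : monoid_morphism fps_coef0.
Proof. by split=> // f g; apply: coef_fpsM0. Qed.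
HB.instance Definition _ := GRing.isZmodMorphism.Build (fps A) A fps_coef0
  fps_coef0_is_zmod_morphism.
HB.instance Definition _ := GRing.isMonoidMorphism.Build (fps A) A fps_coef0
  fps_coef0_is_monoid_morphism.

(* t d/dt, with [eps] in the role of t. *)
Definition feuler (f : fps A) : fps A := eps * fderiv f.
Fact feuler_is_zmod_morphism : zmod_morphism feuler.
Proof. by move=> f g; rewrite /feuler raddfB /= mulrBr. Qed.
HB.instance Definition _ := GRing.isZmodMorphism.Build (fps A) (fps A) feuler
  feuler_is_zmod_morphism.
Lemma feuler_derivation : is_derivation idfun feuler.
Proof. by move=> f g; rewrite /feuler fderivM /=; ring. Qed.
End CoefficientZero.

Lemma feuler_eq0 (A : ratAlgType) (f : fps A) : feuler f = 0 -> f = fpsC (f 0%N).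
Proof.
move=> df; apply: fpsP => -[|n] //; apply: (@natrA_eq0 _ n).
by have := congr1 (fun g : fps A => g n.+1) df; rewrite /feuler coef_epsM.
Qed.

Lemma fext_pQ00 (A B : ratAlgType) (d : pentagon A) (d' : pentagon B)
    (Phi : {rmorphism A -> fps B}) :
  Phi (pa d) = fpsC (pa d') -> Phi (pb d) = fpsC (pb d') ->
  fext Phi (pQ d 0 0) = pQ d' 0 0.
Proof.
move=> aE bE; apply: etrans (fext_pQ 0 0 aE bE) _.
exact: (congr2 (pQ d') (rmorph0 _) (rmorph0 _)).
Qed.

(** * The path from infinity and its specialization *)

Section Path.
Variables (K : ratAlgType) (d : pentagon K).
Local Notation al := (1 + pa d).
Local Notation be := (1 + pb d).

(** The path scales 1 + Li_0(z) = 1/(1 - z) linearly in t, which is the [eps] of this ring: -1 at t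
    = 0 and, for c = 1 + Li_0(z), the given point at t = 1. Then 1 + L0 is scaled by t^2, so all the
    required inverses are geometric series. *)
Let line (c : K) : fps K := fpsC c * eps - 1.
Let line_inv (c : K) : fps K := fun n => - c ^+ n.
Let quad_inv (c : K) : fps K := fun n => if odd n then 0 else - c ^+ n./2.

Fact line_invK c : line c * line_inv c = 1.
Proof.
rewrite /line mulrBl mul1r -mulrA; apply: fpsP => n; rewrite coef_fpsB coef_fpsCM coef_epsM.
case: n => [|n]; rewrite /line_inv coef_fps1 /= opprK; first by rewrite mulr0 add0r.
by rewrite mulrN exprS addNr.
Qed.

Fact quad_invK : (line al + line be + line al * line be) * quad_inv (al * be) = 1.
Proof.
have -> : line al + line be + line al * line be = fpsC (al * be) * eps ^+ 2 - 1.
  by rewrite /line (rmorphM (@fpsC K)) /=; ring.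
rewrite mulrBl mul1r -mulrA; apply: fpsP => n; rewrite coef_fpsB coef_fpsCM coef_epsXM.
case: n => [|[|n]]; rewrite /quad_inv coef_fps1 /= ?mulr0 ?subrr ?sub0r ?opprK //.
rewrite subSS subn1 /= negbK; case: ifP => _; first by rewrite mulr0 subrr.
by rewrite mulrN opprK exprS addNr.
Qed.

Definition pentagon_path : pentagon (fps K) :=
  Pentagon (line_invK al) (line_invK be) quad_invK.

Lemma feuler_line c : feuler (line c) = line_inv c * (line c + line c ^+ 2).
Proof.
transitivity (fpsC c * eps * (line c * line_inv c)); last by rewrite /line; ring.
rewrite line_invK mulr1 /feuler /line raddfB /= fderivM fderivC fderiv_eps.
rewrite -(rmorph1 (@fpsC K)) fderivC; ring.
Qed.

(** [pQ_flow] is used over K[[t]] with D = t d/dt, so each coefficient of Q equals its value at t =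
    0. Two levels of series coexist: the index n counts powers of hbar^(1/2), the coefficients are
    series in t. *)
Lemma pQ_path n : pQ pentagon_path 0 0 n = fpsC (pQ (pentagon_infty K) 0 0 n).
Proof.
have /feuler_eq0 -> := pQ_flow (@feuler_derivation K)
  (feuler_line al : feuler (pa pentagon_path) = _) (feuler_line be) n.
congr fpsC; pose Phi := @fpsC K \o @fps_coef0 K.
have aE : Phi (pa pentagon_path) = fpsC (pa (pentagon_infty K)).
  by rewrite /Phi /= /fps_coef0 /line coef_fpsB coef_fpsCM mulr0 sub0r.
have bE : Phi (pb pentagon_path) = fpsC (pb (pentagon_infty K)).
  by rewrite /Phi /= /fps_coef0 /line coef_fpsB coef_fpsCM mulr0 sub0r.
apply: etrans (congr1 (fun f : fps K => f n) (fext_pQ00 aE bE)).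
by rewrite coef_fext_const.
Qed.
End Path.

Section PolynomialSeries.
Variable K : comNzRingType.

Definition fps_of_poly : {poly K} -> fps K := peval (@fpsC K) eps.
HB.instance Definition _ := GRing.RMorphism.on fps_of_poly.

Lemma coef_fps_of_poly p n : fps_of_poly p n = p`_n.
Proof.
rewrite /fps_of_poly; elim/poly_ind: p n => [|p c IHp] n; first by rewrite rmorph0 coef0.
rewrite rmorphD rmorphM /= pevalX pevalC coef_fpsD mulrC coef_epsM coefD coefMX coefC.
case: n => [|n] /=; first by rewrite add0r.
by rewrite addr0 IHp addr0.
Qed.
End PolynomialSeries.

Lemma frac_sub (R : comNzRingType) (e f n m x y : R) :
  e * x = n -> f * y = m -> e * f * (x - y) = n * f - m * e.
Proof. by move=> <- <-; ring. Qed.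

Lemma frac_mul (R : comNzRingType) (e f n m x y : R) :
  e * x = n -> f * y = m -> e * f * (x * y) = n * m.
Proof. by move=> <- <-; ring. Qed.

Section Specialization.
Variable K : ratAlgType.

(* The place t = 1: [x.2] is the value of the fraction [x.1], whose denominator is
   invertible at 1. The pairs form a ring, so that [fext_pQ] can be applied to both of its
   projections. *)
Definition specializes (x : (fps K * K)%type) : Prop :=
  exists n e : {poly K}, exists2 u, e.[1] * u = 1 &
    fps_of_poly e * x.1 = fps_of_poly n /\ n.[1] = x.2 * e.[1].

Definition spec_pred : {pred (fps K * K)%type} := [pred x | `[< specializes x >]].

Lemma spec_predP x : reflect (specializes x) (x \in spec_pred).
Proof. exact: asboolP. Qed.

Fact spec_pred_closed : subring_closed spec_pred.
Proof.
split.
- apply/spec_predP; exists 1, 1; exists 1; rewrite ?hornerC ?mul1r //.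
  by split=> //; rewrite mulr1.
- move=> x y /spec_predP[n [e [u eu [ex nE]]]] /spec_predP[m [f [v fv [fy mE]]]].
  apply/spec_predP; exists (n * f - m * e), (e * f); exists (u * v).
    by rewrite hornerM mulrACA eu fv mulr1.
  split; last by rewrite hornerD hornerN !hornerM nE mE /=; ring.
  apply: etrans (congr1 (fun t => t * (x.1 - y.1)) (rmorphM (@fps_of_poly K) e f)) _.
  rewrite (rmorphB (@fps_of_poly K)) (rmorphM (@fps_of_poly K) n f).
  rewrite (rmorphM (@fps_of_poly K) m e); exact: frac_sub ex fy.
- move=> x y /spec_predP[n [e [u eu [ex nE]]]] /spec_predP[m [f [v fv [fy mE]]]].
  apply/spec_predP; exists (n * m), (e * f); exists (u * v).
    by rewrite hornerM mulrACA eu fv mulr1.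
  split; last by rewrite !hornerM nE mE /=; ring.
  rewrite (rmorphM (@fps_of_poly K) e f) (rmorphM (@fps_of_poly K) n m).
  exact: frac_mul ex fy.
Qed.
HB.instance Definition _ := GRing.isSubringClosed.Build _ spec_pred spec_pred_closed.

Record spec := Spec { spec_val : (fps K * K)%type; _ : spec_val \in spec_pred }.
HB.instance Definition _ := [isSub for spec_val].
HB.instance Definition _ := [Choice of spec by <:].
HB.instance Definition _ := [SubChoice_isSubComNzRing of spec by <:].

Lemma specP (s : spec) : specializes (val s).
Proof. exact/spec_predP/(valP s). Qed.

Fact spec_rat_subproof q : (fpsC (ratA q), ratA q) \in spec_pred.
Proof.
apply/spec_predP; exists (ratA q)%:P, 1; exists 1; rewrite ?hornerC ?mul1r //.
split; rewrite ?mulr1 // rmorph1 mul1r /fps_of_poly pevalC; reflexivity.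
Qed.
Definition spec_rat q : spec := Spec (spec_rat_subproof q).
Fact spec_rat_zmod : zmod_morphism spec_rat.
Proof. by move=> p q; apply: val_inj; rewrite /= !rmorphB. Qed.
Fact spec_rat_monoid : monoid_morphism spec_rat.
Proof.
by split=> [|p q]; apply: val_inj; rewrite /= ?rmorph1 ?rmorphM.
Qed.
HB.instance Definition _ := GRing.isZmodMorphism.Build rat spec spec_rat spec_rat_zmod.
HB.instance Definition _ := GRing.isMonoidMorphism.Build rat spec spec_rat spec_rat_monoid.
HB.instance Definition _ := ComNzRing_isRatAlgebra.Build spec spec_rat.

Definition spec_series (s : spec) : fps K := (val s).1.
Definition spec_value (s : spec) : K := (val s).2.
Fact spec_series_zmod : zmod_morphism spec_series. Proof. by []. Qed.
Fact spec_series_monoid : monoid_morphism spec_series. Proof. by []. Qed.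
HB.instance Definition _ := GRing.isZmodMorphism.Build spec (fps K) spec_series spec_series_zmod.
HB.instance Definition _ := GRing.isMonoidMorphism.Build spec (fps K) spec_series spec_series_monoid.
Fact spec_value_zmod : zmod_morphism spec_value. Proof. by []. Qed.
Fact spec_value_monoid : monoid_morphism spec_value. Proof. by []. Qed.
HB.instance Definition _ := GRing.isZmodMorphism.Build spec K spec_value spec_value_zmod.
HB.instance Definition _ := GRing.isMonoidMorphism.Build spec K spec_value spec_value_monoid.

(** Polynomials embed in series, so a fraction n/e with constant expansion c satisfies n = c e
    already as polynomials; at 1 the denominator is invertible. *)
Lemma spec_const s c : spec_series s = fpsC c -> spec_value s = c.
Proof.
have [n [e [u eu [es nE]]]] := specP s; rewrite /spec_series /spec_value => sE.
have nc : n = e * c%:P.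
  apply/polyP => i; rewrite -coef_fps_of_poly -es sE mulrC coef_fpsCM coef_fps_of_poly.
  by rewrite coefMC mulrC.
have : (val s).2 * (e.[1] * u) = e.[1] * u * c by rewrite mulrA -nE nc hornerM hornerC; ring.
by rewrite eu mulr1 mul1r.
Qed.
End Specialization.

Section PathSpecialization.
Variables (K : ratAlgType) (d : pentagon K).

Lemma spec_poly (n : {poly K}) f v :
  fps_of_poly n = f -> n.[1] = v -> (f, v) \in @spec_pred K.
Proof.
move=> <- <-; apply/spec_predP; exists n, 1; exists 1; rewrite ?hornerC ?mul1r //.
by split; rewrite ?mulr1 // rmorph1 mul1r.
Qed.

Lemma spec_poly_inv (e : {poly K}) f v :
  fps_of_poly e * f = 1 -> e.[1] * v = 1 -> (f, v) \in @spec_pred K.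
Proof.
move=> ef ev; apply/spec_predP; exists 1, e; exists v => //.
by rewrite ef rmorph1 hornerC mulrC ev.
Qed.

Definition line_poly (c : K) : {poly K} := c%:P * 'X - 1.

Lemma fps_of_line_poly c : fps_of_poly (line_poly c) = fpsC c * eps - 1.
Proof. by rewrite /line_poly /fps_of_poly rmorphB rmorphM rmorph1 /= pevalC pevalX. Qed.

Lemma line_poly1 c : (line_poly (1 + c)).[1] = c.
Proof. by rewrite /line_poly !hornerE addrAC subrr add0r. Qed.

Definition quad_poly : {poly K} :=
  let l := line_poly (1 + pa d) in let m := line_poly (1 + pb d) in l + m + l * m.

Lemma fps_of_quad_poly : fps_of_poly quad_poly * pL0i (pentagon_path d) = 1.
Proof.
apply: etrans (pL0K (pentagon_path d)); congr (_ * _).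
have rmorph_quad (h : {rmorphism {poly K} -> fps K}) p q :
  h (p + q + p * q) = h p + h q + h p * h q by rewrite !rmorphD rmorphM.
apply: etrans (rmorph_quad (@fps_of_poly K) _ _) _ => /=.
by rewrite !fps_of_line_poly.
Qed.

Lemma quad_poly1 : quad_poly.[1] * pL0i d = 1.
Proof. by rewrite /quad_poly hornerD hornerD hornerM !line_poly1 pL0K. Qed.

Lemma line_polyK c f v : (fpsC (1 + c) * eps - 1) * f = 1 -> c * v = 1 ->
  (f, v) \in @spec_pred K.
Proof.
by move=> lf cv; apply: (@spec_poly_inv (line_poly (1 + c))); rewrite ?fps_of_line_poly ?line_poly1.
Qed.

Definition spec_pa : spec K := Spec (spec_poly (fps_of_line_poly _) (line_poly1 (pa d))).
Definition spec_pb : spec K := Spec (spec_poly (fps_of_line_poly _) (line_poly1 (pb d))).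
Definition spec_pai : spec K := Spec (line_polyK (paK (pentagon_path d)) (paK d)).
Definition spec_pbi : spec K := Spec (line_polyK (pbK (pentagon_path d)) (pbK d)).
Definition spec_pL0i : spec K := Spec (spec_poly_inv fps_of_quad_poly quad_poly1).

Definition spec_pentagon : pentagon (spec K).
Proof.
apply: (@Pentagon _ spec_pa spec_pb spec_pai spec_pbi spec_pL0i); apply: val_inj.
- exact: (congr2 pair (paK (pentagon_path d)) (paK d)).
- exact: (congr2 pair (pbK (pentagon_path d)) (pbK d)).
- exact: (congr2 pair (pL0K (pentagon_path d)) (pL0K d)).
Defined.

Lemma pQ_eq_infty : pQ d 0 0 = pQ (pentagon_infty K) 0 0.
Proof.
apply: fpsP => n.
have E1 : fext (@fpsC (fps K) \o @spec_series K) (pQ spec_pentagon 0 0) = pQ (pentagon_path d) 0 0.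
  exact: fext_pQ00.
have E2 : fext (@fpsC K \o @spec_value K) (pQ spec_pentagon 0 0) = pQ d 0 0.
  exact: fext_pQ00.
apply: etrans (esym (congr1 (fun f : fps K => f n) E2)) _.
apply: etrans (coef_fext_const _ _ _) _; apply: spec_const.
apply: etrans (esym (coef_fext_const _ _ _)) _.
apply: etrans (congr1 (fun f : fps (fps K) => f n) E1) _.
exact: pQ_path.
Qed.

Lemma pentagon_identity X Y :
  psiS X (pa d) * psiS Y (pb d) = fE (- (fpsC (ratA 24%:R^-1) * eps)) * pR d X Y.
Proof.
rewrite pRE pQ_eq_infty pQ_infty mulrA -[fE _ * fE _]fE_D addNr fE0 mul1r; reflexivity.
Qed.
End PathSpecialization.

(** * Comparison with the definitions of the statement *)

#[short(type="ratUnitAlgType")]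
HB.structure Definition RatUnitAlgebra := {A of RatAlgebra A & GRing.ComUnitRing A}.

#[short(type="ratIdomainType")]
HB.structure Definition RatIdomain := {A of RatAlgebra A & GRing.IntegralDomain A}.

#[short(type="ratFieldType")]
HB.structure Definition RatField := {A of RatAlgebra A & GRing.Field A}.

Section UnitRingBridge.
Variable A : ratUnitAlgType.
Implicit Types (f g : fps A) (x z : A).

Lemma ratr_ratA q : ratr q = ratA q :> A.
Proof. by rewrite -{2}(divq_num_den q) /ratr rmorphM fmorphV !rmorph_int. Qed.

Lemma fps_exprnE f j : fps_exprn f j = f ^+ j.
Proof. by elim: j => // j IHj; rewrite exprS -IHj. Qed.

Lemma fps_expE f : fps_exp f = fexp f.
Proof.
apply: fpsP => n; apply: eq_bigr => j _.
by rewrite fps_exprnE fmorphV rmorph_nat.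
Qed.
End UnitRingBridge.

HB.instance Definition _ := ComNzRing_isRatAlgebra.Build rat (@idfun rat).

HB.instance Definition _ (A : ratIdomainType) := RatAlgebra.on {poly A}.

HB.instance Definition _ (A : ratIdomainType) :=
  ComNzRing_isRatAlgebra.Build {fraction A} (@FracField.tofrac A \o @ratA A).

Section QuotientRule.
Variables (R : comNzRingType) (F : fieldType) (h : {rmorphism R -> F}).
Variables n d m e n' d' m' e' : R.
Hypotheses (d0 : h d != 0) (e0 : h e != 0).

(** Stated for an abstract morphism [h], so that [field] handles atoms; the instance is the
    embedding of polynomials in their fraction field. *)
Lemma quotient_sub : h n / h d - h m / h e = h (n * e - m * d) / h (d * e).
Proof. by rewrite rmorphB !rmorphM /=; field; rewrite d0 e0. Qed.

Lemma quotient_mul : h n / h d * (h m / h e) = h (n * m) / h (d * e).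
Proof. by rewrite !rmorphM /=; field; rewrite d0 e0. Qed.

Lemma quotient_rule_sub :
  h ((n' * e + n * e' - (m' * d + m * d')) * (d * e) - (n * e - m * d) * (d' * e + d * e'))
    / h ((d * e) ^+ 2)
  = h (n' * d - n * d') / h (d ^+ 2) - h (m' * e - m * e') / h (e ^+ 2).
Proof. by rewrite !(rmorphB, rmorphD, rmorphM, rmorphXn) /=; field; rewrite d0 e0. Qed.

Lemma quotient_rule_mul :
  h ((n' * m + n * m') * (d * e) - n * m * (d' * e + d * e')) / h ((d * e) ^+ 2)
  = h (n' * d - n * d') / h (d ^+ 2) * (h m / h e)
    + h n / h d * (h (m' * e - m * e') / h (e ^+ 2)).
Proof. by rewrite !(rmorphB, rmorphD, rmorphM, rmorphXn) /=; field; rewrite d0 e0. Qed.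
End QuotientRule.

Lemma geometric_log_deriv (R : comNzRingType) (F : fieldType) (h : {rmorphism R -> F}) x :
  h x != 0 -> h (1 - x) != 0 ->
  h 1 / h ((1 - x) ^+ 2) = (h x)^-1 * (h x / h (1 - x) + (h x / h (1 - x)) ^+ 2).
Proof.
have gen (u v w : F) : u != 0 -> v != 0 -> w = u + v ->
    w / v ^+ 2 = u^-1 * (u / v + (u / v) ^+ 2).
  by move=> u0 v0 ->; field; rewrite u0 v0.
by move=> x0 y0; rewrite rmorphXn; apply: gen => //; rewrite -rmorphD addrC subrK.
Qed.

(** * Polylogarithms as rational functions *)

Section RatfunDerivation.
Local Notation F := {fraction {poly rat}}.
Implicit Types f g : F.

Lemma ratfunP f : exists n d : {poly rat}, d != 0 /\ f = n%:F / d%:F.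
Proof.
exists (\n_(repr f)), (\d_(repr f)); split; first exact: denom_ratioP.
exact: ratfun_numden.
Qed.

Fact ratfun_deriv_is_zmod_morphism : zmod_morphism ratfun_deriv.
Proof.
move=> f g; have [n [d [d0 ->]]] := ratfunP f; have [m [e [e0 ->]]] := ratfunP g.
have dF0 : d%:F != 0 by rewrite tofrac_eq0.
have eF0 : e%:F != 0 by rewrite tofrac_eq0.
apply: etrans (congr1 ratfun_deriv (quotient_sub (h := @FracField.tofrac {poly rat}) n m dF0 eF0)) _.
apply: etrans (ratfun_derivE _ (mulf_neq0 d0 e0)) _.
rewrite derivB !derivM (ratfun_derivE n d0) (ratfun_derivE m e0).
have H := quotient_rule_sub (h := @FracField.tofrac {poly rat}) n m
  n^`() d^`() m^`() e^`() dF0 eF0.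
by apply: etrans (etrans _ H) _.
Qed.
HB.instance Definition _ := GRing.isZmodMorphism.Build F F ratfun_deriv
  ratfun_deriv_is_zmod_morphism.

Lemma ratfun_derivM f g :
  ratfun_deriv (f * g) = ratfun_deriv f * g + f * ratfun_deriv g.
Proof.
have [n [d [d0 ->]]] := ratfunP f; have [m [e [e0 ->]]] := ratfunP g.
have dF0 : d%:F != 0 by rewrite tofrac_eq0.
have eF0 : e%:F != 0 by rewrite tofrac_eq0.
apply: etrans (congr1 ratfun_deriv (quotient_mul (h := @FracField.tofrac {poly rat}) n m dF0 eF0)) _.
apply: etrans (ratfun_derivE _ (mulf_neq0 d0 e0)) _.
rewrite !derivM (ratfun_derivE n d0) (ratfun_derivE m e0).
have H := quotient_rule_mul (h := @FracField.tofrac {poly rat}) n m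
  n^`() d^`() m^`() e^`() dF0 eF0.
by apply: etrans (etrans _ H) _.
Qed.

Lemma ratfun_deriv_derivation : is_derivation idfun ratfun_deriv.
Proof. exact: ratfun_derivM. Qed.

Let ell : F := 'X%:F / (1 - 'X)%:F.

Let one_subX_neq0 : 1 - 'X != 0 :> {poly rat}.
Proof. by rewrite -opprB oppr_eq0 polyXsubC_eq0. Qed.

(** The chain rule [der_Li] for the derivation d/dz of Q(z), under which the derivative of z/(1 - z)
    is z^(-1) (ell + ell^2). *)
Lemma polylog_negE m : polylog_neg m = Li m ell.
Proof.
elim: m => [|m IHm]; first by rewrite Li0.
have XF0 : 'X%:F != 0 :> F by rewrite tofrac_eq0 polyX_eq0.
have YF0 : (1 - 'X)%:F != 0 :> F by rewrite tofrac_eq0 one_subX_neq0.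
have dell : ratfun_deriv ell = ('X%:F)^-1 * (ell + ell ^+ 2).
  rewrite /ell ratfun_derivE ?one_subX_neq0 // derivB derivX derivC.
  have -> : 1 * (1 - 'X) - 'X * (0 - 1) = 1 :> {poly rat} by ring.
  have H := geometric_log_deriv (h := @FracField.tofrac {poly rat}) XF0 YF0.
  by apply: etrans (etrans _ H) _.
have E : ratfun_deriv (polylog_neg m) = ('X%:F)^-1 * Li m.+1 ell.
  rewrite IHm; exact: (der_Li m ratfun_deriv_derivation dell).
apply: etrans (congr1 (fun t => 'X%:F * t) E) _; exact: (mulVKf XF0).
Qed.
End RatfunDerivation.

Lemma quotient_horner_step (R : comNzRingType) (F : fieldType) (h : {rmorphism R -> F}) n d x y c :
  h d != 0 -> h y != 0 -> h n / h d * (h x / h y) + h c = h (n * x + c * (d * y)) / h (d * y).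
Proof. by move=> d0 y0; rewrite rmorphD !rmorphM /=; field; rewrite d0 y0. Qed.

Lemma horner_ratA_MXaddC (A : ratAlgType) (p : {poly rat}) c (x : A) :
  (map_poly ratA (p * 'X + c%:P)).[x] = (map_poly ratA p).[x] * x + ratA c.
Proof. by rewrite rmorphD rmorphM /= map_polyX map_polyC hornerMXaddC. Qed.

Section RatfunEval.
Variables (A : ratUnitAlgType) (a u : A).
Hypothesis au : (1 - a) * u = 1.
Local Notation F := {fraction {poly rat}}.
Local Notation ev p := (map_poly ratA p).[a].

Let evM p q : ev (p * q) = ev p * ev q. Proof. by rewrite rmorphM hornerM. Qed.

(** The fraction n/d may be unreduced, which makes the notion stable under the steps of Horner's
    scheme. *)
Definition regular_value (f : F) (v : A) :=
  exists n d : {poly rat}, [/\ d != 0, f = n%:F / d%:F, ev d \is a GRing.unit & ev n = v * ev d].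

(** By Gauss's lemma the reduced denominator divides d, so its value at a divides a unit and is
    itself a unit. *)
Lemma ratfun_eval_value f v : regular_value f v -> ratfun_eval a f = v.
Proof.
case=> n [d [d0 fE du nE]]; rewrite /ratfun_eval.
have D0 : \d_(repr f) != 0 by exact: denom_ratioP.
have eq_nD : n * \d_(repr f) = \n_(repr f) * d.
  have := ratfun_numden f; rewrite {1}fE => /eqP.
  by rewrite eqr_div ?tofrac_eq0 // -!tofracM tofrac_eq => /eqP.
move: (\n_(repr f)) (\d_(repr f)) D0 eq_nD => N D D0 eq_nD.
rewrite !(eq_map_poly (@ratr_ratA A)).
set g := gcdp N D; have g0 : g != 0 by rewrite gcdp_eq0 negb_and D0 orbT.
have Ng : N = N %/ g * g by rewrite divpK ?dvdp_gcdl.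
have Dg : D = D %/ g * g by rewrite divpK ?dvdp_gcdr.
have cop : coprimep (D %/ g) (N %/ g) by rewrite coprimep_sym coprimep_div_gcd ?D0 ?orbT.
have eq_nD1 : n * (D %/ g) = N %/ g * d.
  by apply: (mulIf g0); rewrite -mulrA -Dg eq_nD {1}Ng mulrAC.
have /dvdpP[q dE] : D %/ g %| d.
  by rewrite -(Gauss_dvdpr _ cop) -eq_nD1 dvdp_mulIr.
have Du : ev (D %/ g) \is a GRing.unit.
  by move: du; rewrite dE evM unitrM => /andP[].
apply: (mulIr Du); rewrite divrK //; apply: (mulIr du).
by rewrite -evM -eq_nD1 evM nE mulrAC.
Qed.

Lemma regular_value0 : regular_value 0 0.
Proof.
exists 0, 1; split; rewrite ?oner_neq0 //; first by rewrite tofrac0 mul0r.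
  by rewrite rmorph1 hornerC unitr1.
by rewrite rmorph0 horner0 mul0r.
Qed.

Lemma regular_value_step f v c : regular_value f v ->
  regular_value (f * ('X%:F / (1 - 'X)%:F) + (c%:P)%:F) (v * (a * u) + ratA c).
Proof.
case=> n [d [d0 -> du nE]]; have y0 : 1 - 'X != 0 :> {poly rat}.
  by rewrite -opprB oppr_eq0 polyXsubC_eq0.
have dF0 : d%:F != 0 by rewrite tofrac_eq0.
have yF0 : (1 - 'X : {poly rat})%:F != 0 by rewrite tofrac_eq0.
have evy : ev (1 - 'X) = 1 - a by rewrite rmorphB rmorph1 /= map_polyX !hornerE.
exists (n * 'X + c%:P * (d * (1 - 'X))), (d * (1 - 'X)); split.
- exact: mulf_neq0.
- have H := quotient_horner_step (h := @FracField.tofrac {poly rat}) n 'X c%:P dF0 yF0.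
  by apply: etrans (etrans _ H) _.
- rewrite evM unitrM du evy; apply/unitrPr; by exists u.
rewrite rmorphD hornerD !evM evy nE map_polyX map_polyC hornerX hornerC.
transitivity (v * ev d * a * ((1 - a) * u) + ratA c * (ev d * (1 - a))).
  by rewrite au mulr1.
ring.
Qed.

Lemma ratfun_eval_polylog m : ratfun_eval a (polylog_neg m) = Li m (a * u).
Proof.
apply: ratfun_eval_value; rewrite polylog_negE /Li.
elim/poly_ind: (Li_poly m) => [|p c IHp].
  by rewrite !rmorph0 !horner0; exact: regular_value0.
rewrite (horner_ratA_MXaddC p c (a * u)) (horner_ratA_MXaddC p c ('X%:F / (1 - 'X)%:F)).
exact: regular_value_step.
Qed.
End RatfunEval.

Lemma lpsi_const (A : ratAlgType) (x L : A) n :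
  lpsi (fpsC x) L n = (lpsi_poly L n).[x].
Proof.
apply: etrans (coef_fext_const (horner_eval x) (lpsi_poly L) n).
congr (_ n); apply: eq_fext => p.
by rewrite /peval horner_map.
Qed.

Section PsiBridge.
Variables (A : ratUnitAlgType) (K : fieldType) (iota : {rmorphism K -> A}).

Lemma log_psiE x z : 1 - z != 0 ->
  log_psi x (iota z) = lpsi (fpsC x) (iota (z / (1 - z))).
Proof.
move=> z1; apply: fpsP => n; rewrite lpsi_const; case: n => [|n]; first by rewrite horner0.
have zu : (1 - iota z) * iota (1 - z)^-1 = 1.
  by rewrite -(rmorph1 iota) -rmorphB -rmorphM divff // rmorph1.
rewrite /= hornerN; congr (- _); rewrite horner_sum; apply: eq_bigr => k _.
rewrite horner_sum; apply: eq_bigr => l _; rewrite hornerM hornerC hornerXn.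
rewrite (ratfun_eval_polylog zu) -rmorphM ratr_ratA mulrAC; reflexivity.
Qed.

Lemma psiE x z : 1 - z != 0 -> psi x (iota z) = psiS (fpsC x) (iota (z / (1 - z))).
Proof. by move=> z1; rewrite /psi log_psiE // fps_expE. Qed.
End PsiBridge.

HB.instance Definition _ n (K : ratAlgType) :=
  ComNzRing_isRatAlgebra.Build {mpoly K[n]} (@mpolyC n K \o @ratA K).

Lemma big_ord_double (R : nmodType) (F : nat -> R) N :
  \sum_(i < N.*2) F i = \sum_(j < N) (F j.*2 + F j.*2.+1).
Proof.
elim: N => [|N IHN]; first by rewrite !big_ord0.
by rewrite doubleS !big_ord_recr /= IHN addrA.
Qed.

Section GaussBridge.
Variables (n : nat) (K : ratFieldType) (lambda : K).
Local Notation B := {mpoly K[n]}.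

Lemma gauss_coefE (lam : K) j :
  (ratA ((j.*2)`!%:R / (2 ^ j * j`!)%:R) * lam^-1 ^+ j : K)
  = (2 * lam) ^- j / j`!%:R * (j.*2)`!%:R.
Proof.
rewrite rmorphM fmorphV !rmorph_nat natrM natrX exprMn !invfM exprVn; ring.
Qed.

Lemma gauss_polyE (p : {poly B}) : gauss_poly lambda p = gint (lambda^-1)%:MP p.
Proof.
(* The range is doubled so that indices pair up as 2j and 2j + 1; the odd moments vanish and the
   even ones match the derivatives of order 2j. *)
rewrite (@gintE _ _ (size p).*2); last by rewrite -addnn leq_addr.
rewrite (big_ord_double (fun i => p`_i * gmom (lambda^-1)%:MP i)).
apply: eq_bigr => j _; rewrite /gmom /= odd_double doubleK mulr0 addr0.
rewrite horner_coef0 coef_derivn addn0 ffactnn mul2n -mul_mpolyC.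
rewrite -[p`_ _ *+ _]mulr_natr mulrCA; congr (_ * _).
rewrite -(rmorph_nat (@mpolyC n K)) -rmorphM -rmorphXn -rmorphM gauss_coefE; reflexivity.
Qed.

Lemma gaussE (f : fps {poly B}) : gauss lambda f = gintS (lambda^-1)%:MP f.
Proof. by apply: fpsP => m; apply: gauss_polyE. Qed.
End GaussBridge.

Section Coordinates.
Variables (K : fieldType) (z1 z2 : K).
Hypotheses (z1_neq0 : z1 != 0) (z2_neq0 : z2 != 0).
Hypotheses (z1_neq1 : 1 - z1 != 0) (z2_neq1 : 1 - z2 != 0).
Local Notation z0 := (z1 + z2 - z1 * z2).
Hypothesis z0_neq0 : z0 != 0.

(** Since 1 - z0 = (1 - z1)(1 - z2), one has a + b + a b = z0/(1 - z0), whose inverse is the last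
    witness. *)
Definition pentagon_of_z : pentagon K.
Proof.
apply: (@Pentagon _ (z1 / (1 - z1)) (z2 / (1 - z2)) ((1 - z1) / z1) ((1 - z2) / z2)
  ((1 - z1) * (1 - z2) / z0)); first by field; rewrite ?z1_neq0 ?z1_neq1.
- by field; rewrite ?z2_neq0 ?z2_neq1.
- by field; rewrite ?z0_neq0 ?z1_neq1 ?z2_neq1.
Defined.

Lemma subrLA : 1 - z1 / z0 = z2 * (1 - z1) / z0. Proof. by field; rewrite ?z0_neq0. Qed.
Lemma subrLC : 1 - z2 / z0 = z1 * (1 - z2) / z0. Proof. by field; rewrite ?z0_neq0. Qed.
Lemma subrL0 : 1 - z0 = (1 - z1) * (1 - z2). Proof. by ring. Qed.

Lemma subrLA_neq0 : 1 - z1 / z0 != 0.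
Proof. by rewrite subrLA !mulf_neq0 ?invr_eq0. Qed.
Lemma subrLC_neq0 : 1 - z2 / z0 != 0.
Proof. by rewrite subrLC !mulf_neq0 ?invr_eq0. Qed.
Lemma subrL0_neq0 : 1 - z0 != 0.
Proof. by rewrite subrL0 mulf_neq0. Qed.

Lemma pLA_of_z : pLA pentagon_of_z = z1 / z0 / (1 - z1 / z0).
Proof.
by rewrite subrLA /pLA /=; field; rewrite ?z0_neq0 ?z1_neq0 ?z2_neq0 ?z1_neq1 ?z2_neq1.
Qed.
Lemma pLC_of_z : pLC pentagon_of_z = z2 / z0 / (1 - z2 / z0).
Proof.
by rewrite subrLC /pLC /=; field; rewrite ?z0_neq0 ?z1_neq0 ?z2_neq0 ?z1_neq1 ?z2_neq1.
Qed.
Lemma pL0_of_z : pL0 pentagon_of_z = z0 / (1 - z0).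
Proof. by rewrite subrL0 /pL0 /=; field; rewrite ?z1_neq1 ?z2_neq1. Qed.
Lemma psigma_of_z :
  psigma pentagon_of_z = (z0 ^+ 2 / (z1 * z2 * (1 - z1) * (1 - z2)))^-1.
Proof.
by rewrite /psigma /=; field; rewrite ?z0_neq0 ?z1_neq0 ?z2_neq0 ?z1_neq1 ?z2_neq1.
Qed.
Lemma pcx_of_z : pcx pentagon_of_z = z2 / z0.
Proof. by rewrite /pcx /=; field; rewrite ?z0_neq0 ?z1_neq1 ?z2_neq1. Qed.
Lemma pcy_of_z : pcy pentagon_of_z = z1 / z0.
Proof. by rewrite /pcy /=; field; rewrite ?z0_neq0 ?z1_neq1 ?z2_neq1. Qed.
End Coordinates.

Section MapPentagonCenter.
Variables (A B : comNzRingType) (h : {rmorphism A -> B}) (d : pentagon A).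
Lemma map_pcx : pcx (map_pentagon h d) = h (pcx d).
Proof. by rewrite /pcx !rmorphM rmorphD rmorph1. Qed.
Lemma map_pcy : pcy (map_pentagon h d) = h (pcy d).
Proof. by rewrite /pcy !rmorphM rmorphD rmorph1. Qed.
End MapPentagonCenter.

Section ConstantArguments.
Variables (A : ratAlgType) (d : pentagon A) (x y c : A).
Hypothesis cE : c = pcx d * x + pcy d * y.
Local Notation C := (@fpsC (polyQ A)).

Lemma pc_const : pc d (fpsC x) (fpsC y) = wC c.
Proof. by rewrite /pc !fconstC cE rmorphD !rmorphM. Qed.

Lemma pXA_const : pXA d (fpsC x) (fpsC y) = C (- 'X - y%:P + c%:P).
Proof. by rewrite /pXA pc_const fconstC; rewrite -(rmorphN C) -(rmorphB C) -(rmorphD C). Qed.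
Lemma pXB_const : pXB d (fpsC x) (fpsC y) = C ('X + x%:P + y%:P - c%:P).
Proof. by rewrite /pXB pc_const !fconstC -(rmorphD C) -(rmorphD C) -(rmorphB C). Qed.
Lemma pXC_const : pXC d (fpsC x) (fpsC y) = C (- 'X - x%:P + c%:P).
Proof. by rewrite /pXC pc_const !fconstC -(rmorphN C) -(rmorphB C) -(rmorphD C). Qed.
End ConstantArguments.

Lemma mulr3_eq (R : comNzRingType) (u v w u' v' w' : R) :
  u = u' -> v = v' -> w = w' -> u * v * w = u' * v' * w'.
Proof. by move=> -> -> ->. Qed.

Section PsiPolynomialArgument.
Variables (K : fieldType) (B : ratIdomainType) (iota : {rmorphism K -> B}).

Lemma psi_polyE (W : {poly B}) (Z : fps (polyQ B)) z L :
  1 - z != 0 -> Z = fpsC W -> iota (z / (1 - z)) = L ->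
  psi W (iota z)%:P = psiP Z L.
Proof.
by move=> z1 -> <-; exact: (@psiE {poly B} K (@polyC B \o iota)).
Qed.

End PsiPolynomialArgument.

(** [fE X] is the exponential of X eps, so -hbar/24 is encoded by X = -eps/24 and sits at index
    2. *)
Lemma prefactorE (B : ratUnitAlgType) :
  fps_exp (fun n => if (n == 2)%N then - (24%:R)^-1 else 0) =
  fE (- (fpsC (ratA 24%:R^-1) * eps)) :> fps B.
Proof.
rewrite fps_expE /fE; congr fexp; apply: fpsP => n.
rewrite mulNr -mulrA -expr2 coef_fpsN coef_fpsCM -[eps ^+ 2]mulr1 coef_epsXM.
rewrite fmorphV rmorph_nat; case: n => [|[|[|n]]] //=.
- by rewrite mulr0 oppr0.
- by rewrite mulr0 oppr0.
- by rewrite mulr1.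
- by rewrite mulr0 oppr0.
Qed.

Section PsiPentagon.
Variables (K : fieldType) (B : ratIdomainType) (iota : {rmorphism K -> B}).
Variables (z1 z2 : K).
Hypotheses (z1_neq0 : z1 != 0) (z2_neq0 : z2 != 0).
Hypotheses (z1_neq1 : 1 - z1 != 0) (z2_neq1 : 1 - z2 != 0).
Local Notation z0 := (z1 + z2 - z1 * z2).
Hypothesis z0_neq0 : z0 != 0.

Let dK := pentagon_of_z z1_neq0 z2_neq0 z1_neq1 z2_neq1 z0_neq0.
Let d := map_pentagon iota dK.

Lemma psi_pentagon (x y c : B) : c = iota (z2 / z0) * x + iota (z1 / z0) * y ->
  fps_mul (psi x (iota z1)) (psi y (iota z2)) =
  fps_mul (fps_exp (fun n => if (n == 2)%N then - (24%:R)^-1 else 0))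
    (gintS (iota (z0 ^+ 2 / (z1 * z2 * (1 - z1) * (1 - z2)))^-1)
       (fps_mul
          (fps_mul (psi (- 'X - y%:P + c%:P) (iota (z1 / z0))%:P)
                   (psi ('X + x%:P + y%:P - c%:P) (iota z0)%:P))
          (psi (- 'X - x%:P + c%:P) (iota (z2 / z0))%:P))).
Proof.
move=> cE; rewrite prefactorE.
have cE' : c = pcx d * x + pcy d * y by rewrite map_pcx map_pcy pcx_of_z pcy_of_z.
have IE : pI d (fpsC x) (fpsC y) = fps_mul
          (fps_mul (psi (- 'X - y%:P + c%:P) (iota (z1 / z0))%:P)
                   (psi ('X + x%:P + y%:P - c%:P) (iota z0)%:P))
          (psi (- 'X - x%:P + c%:P) (iota (z2 / z0))%:P).
  apply: mulr3_eq; apply: esym.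
  - apply: psi_polyE (subrLA_neq0 z2_neq0 z1_neq1 z0_neq0) (pXA_const cE') _.
    by rewrite map_pLA pLA_of_z.
  - apply: psi_polyE (subrL0_neq0 z1_neq1 z2_neq1) (pXB_const cE') _.
    by rewrite map_pL0 pL0_of_z.
  - apply: psi_polyE (subrLC_neq0 z1_neq0 z2_neq1 z0_neq0) (pXC_const cE') _.
    by rewrite map_pLC pLC_of_z.
have sE : psigma d = iota (z0 ^+ 2 / (z1 * z2 * (1 - z1) * (1 - z2)))^-1.
  by rewrite map_psigma psigma_of_z.
rewrite -IE -sE (psiE iota x z1_neq1) (psiE iota y z2_neq1).
exact: (pentagon_identity d (fpsC x) (fpsC y)).
Qed.
End PsiPentagon.

HB.instance Definition _ n (K : ratIdomainType) := RatAlgebra.on {mpoly K[n]}.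

Lemma psi_pentagon_mpoly (K : fieldType) (r : {rmorphism rat -> K}) n (x y : {mpoly K[n]})
    (z1 z2 : K) :
  let w : {poly {mpoly K[n]}} := 'X in
  let z0 : K := z1 + z2 - z1 * z2 in
  let delta : K :=
    (z1 + z2 - z1 * z2) ^+ 2 / (z1 * z2 * (1 - z1) * (1 - z2)) in
  let c : {mpoly K[n]} := z0^-1 *: (z2 *: x + z1 *: y) in
  z1 != 0 -> z2 != 0 -> 1 - z1 != 0 -> 1 - z2 != 0 -> z0 != 0 ->
  fps_mul (psi x z1%:MP) (psi y z2%:MP)
  = fps_mul
       (fps_exp (fun n => if (n == 2)%N then - (24%:R)^-1 else 0))
       (gauss delta
          (fps_mul
             (fps_mul (psi (- w - y%:P + c%:P) (z1 / z0)%:MP%:P)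
                      (psi (w + x%:P + y%:P - c%:P) z0%:MP%:P))
             (psi (- w - x%:P + c%:P) (z2 / z0)%:MP%:P))).
Proof.
(* The Q-algebra structure is attached to K locally, so that the statement mentions only its field
   structure. *)
pose K' : ratFieldType := HB.pack (K : Type) K (ComNzRing_isRatAlgebra.Build K r).
move=> w z0 delta c z10 z20 z11 z21 z00.
have cE : c = (z2 / z0)%:MP * x + (z1 / z0)%:MP * y.
  by rewrite /c -!mul_mpolyC mulrDr !mulrA -!rmorphM [_ * z2]mulrC [_ * z1]mulrC.
apply: etrans (congr1 (fps_mul _) (esym (@gaussE n K' delta _))).
exact: (@psi_pentagon K' {mpoly K'[n]} (@mpolyC n K') z1 z2 z10 z20 z11 z21 z00 x y c cE).
Qed.

Lemma tofrac_neq0_meval n (p : {mpoly rat[n]}) v : p.@[v] != 0 -> p%:F != 0.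
Proof. by rewrite tofrac_eq0; apply: contraNneq => ->; rewrite meval0. Qed.

Theorem theorem3p6 :
  let K := {fraction {mpoly rat[2]}} in
  let Kxy := {mpoly K[2]} in
  let z1 : K := ('X_ord0)%:F in
  let z2 : K := ('X_ord_max)%:F in
  let x : Kxy := 'X_ord0 in
  let y : Kxy := 'X_ord_max in
  let w : {poly Kxy} := 'X in
  let z0 : K := z1 + z2 - z1 * z2 in
  let delta : K :=
    (z1 + z2 - z1 * z2) ^+ 2 / (z1 * z2 * (1 - z1) * (1 - z2)) in
  let c : Kxy := z0^-1 *: (z2 *: x + z1 *: y) in
  fps_mul (psi x z1%:MP) (psi y z2%:MP)
  =1 fps_mul
       (fps_exp (fun n => if (n == 2)%N then - (24%:R)^-1 else 0))
       (gauss delta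
          (fps_mul
             (fps_mul (psi (- w - y%:P + c%:P) (z1 / z0)%:MP%:P)
                      (psi (w + x%:P + y%:P - c%:P) z0%:MP%:P))
             (psi (- w - x%:P + c%:P) (z2 / z0)%:MP%:P))).
Proof.
move=> K Kxy z1 z2 x y w z0 delta c n.
(* At (z1, z2) = (2, 3) none of the five denominators vanishes; in particular z0 = -1. *)
pose v (i : 'I_2) : rat := if i == ord0 then 2 else 3.
have z10 : z1 != 0.
  by apply: (@tofrac_neq0_meval _ _ v); rewrite mevalXU.
have z20 : z2 != 0.
  by apply: (@tofrac_neq0_meval _ _ v); rewrite mevalXU.
have z11 : 1 - z1 != 0.
  rewrite /z1 -tofrac1 -tofracB.
  by apply: (@tofrac_neq0_meval _ _ v); rewrite mevalB meval1 mevalXU.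
have z21 : 1 - z2 != 0.
  rewrite /z2 -tofrac1 -tofracB.
  by apply: (@tofrac_neq0_meval _ _ v); rewrite mevalB meval1 mevalXU.
have z00 : z0 != 0.
  rewrite /z0 /z1 /z2 -tofracM -tofracD -tofracB.
  by apply: (@tofrac_neq0_meval _ _ v); rewrite mevalB mevalD mevalM !mevalXU.
exact: (congr1 (fun f : fps Kxy => f n)
  (@psi_pentagon_mpoly _ (@FracField.tofrac {mpoly rat[2]} \o @mpolyC 2 rat) 2 x y z1 z2 z10 z20 z11 z21 z00)).
Qed.
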